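(* Let $n,m\ge 1$ be integers, let $0<a\le 2$, and let $p,\lambda$ be real numbers such that either $1<p<\infty$ and $\lambda\ge 0$, or $p=1$ and $\lambda>-1$. Then for each $k=1,\dots,n+m$ the transformation of power series $$\sum_{\alpha}c_\alpha\xi^\alpha\ \longmapsto\ \sum_{|\alpha|\neq 0}\frac{\alpha_k}{|\alpha|}\,c_\alpha\xi^\alpha$$ maps $A^p_\lambda(\Omega_a)$ into $A^p_\lambda(\Omega_a)$; that is, if $f(\xi)=\sum_\alpha c_\alpha\xi^\alpha$ is the Taylor expansion on $\Omega_a$ of a function in $A^p_\lambda(\Omega_a)$, then $\sum_{|\alpha|\ne0}\frac{\alpha_k}{|\alpha|}c_\alpha\xi^\alpha$ is the Taylor expansion of a function in $A^p_\lambda(\Omega_a)$. In other words, the sequence $\{\alpha_k/|\alpha|\}$ is a multiplier of $A^p_\lambda(\Omega_a)$ into $A^p_\lambda(\Omega_a)$.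
   Context: For integers $n,m\ge1$ and $0<a\le 2$, the egg domain is $\Omega_a=\{\xi=(z,w)\in\mathbb{C}^{n+m}: z\in\mathbb{C}^n,\ w\in\mathbb{C}^m,\ |z|^2+|w|^{2/a}<1\}$, where $|z|^2=\sum_{j=1}^n|z_j|^2$ and $|w|^2=\sum_{j=1}^m|w_j|^2$; one writes $\xi=(\xi_1,\dots,\xi_{n+m})$. It is a Reinhardt domain containing the origin, and every holomorphic function on it has a Taylor expansion $\sum_\alpha c_\alpha\xi^\alpha$ converging on $\Omega_a$. Put $h(\xi)=h(z,w)=(1-|z|^2)^a-|w|^2$, which is positive on $\Omega_a$. Let $dv$ be the volume (Lebesgue) measure on $\Omega_a$. For $\lambda>-1$ and $1\le p<\infty$, the weighted Bergman space $A^p_\lambda(\Omega_a)$ is the space of holomorphic functions $f$ on $\Omega_a$ with $\int_{\Omega_a}h^\lambda(\xi)|f(\xi)|^p\,dv(\xi)<\infty$. Here $\alpha=(\alpha_1,\dots,\alpha_{n+m})$ ranges over multi-indices of non-negative integers, $|\alpha|=\alpha_1+\cdots+\alpha_{n+m}$, and $\xi^\alpha=\xi_1^{\alpha_1}\cdots\xi_{n+m}^{\alpha_{n+m}}$. *)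

(* Defs.v *)
From HB Require Import structures.
From mathcomp Require Import all_boot all_order all_algebra.
From mathcomp Require Import all_classical all_reals all_analysis.
From mathcomp.real_closed Require Export complex.
From mathcomp Require summability.

Set Implicit Arguments.
Unset Strict Implicit.
Unset Printing Implicit Defensive.
Import Order.TTheory GRing.Theory Num.Theory.
Import numFieldNormedType.Exports.
Local Open Scope classical_set_scope.
Local Open Scope ring_scope.

(* The canonical sigma-finite instance on [mu \x nu] is shadowed in
   MathComp-Analysis by the one on products of subprobabilities, so that
   it cannot be inferred; hence this lemma. *)
Lemma product_measure_sigma_finite d1 d2 (T1 : measurableType d1)
    (T2 : measurableType d2) (R : realType)
    (mu : {sigma_finite_measure set T1 -> \bar R})
    (nu : {sigma_finite_measure set T2 -> \bar R}) :
  sigma_finite setT (mu \x nu)%E.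
Proof.
have /sigma_finiteP[F [TF ndF Foo]] := sigma_finiteT mu.
have /sigma_finiteP[G [TG ndG Goo]] := sigma_finiteT nu.
exists (fun n => F n `*` G n).
  rewrite -setXTT TF TG predeqE => -[x y]; split.
    move=> [/= [n _ Fnx] [k _ Gky]]; exists (maxn n k) => //; split.
    - by move: x Fnx; exact/subsetPset/ndF/leq_maxl.
    - by move: y Gky; exact/subsetPset/ndG/leq_maxr.
  by move=> [n _ []/= ? ?]; split; exists n.
move=> k; have [? ?] := Foo k; have [? ?] := Goo k.
split; first exact: measurableX.
by rewrite product_measure1E// lte_mul_pinfty// ge0_fin_numE.
Qed.

Section measure_power.
Context d (T : measurableType d) (R : realType).

Definition tuple_cons n (p : T * n.-tuple T) : n.+1.-tuple T :=
  [tuple of p.1 :: p.2].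

Lemma measurable_tuple_cons n : measurable_fun setT (@tuple_cons n).
Proof. exact: measurable_cons. Qed.

Section step.
Variables (mu : {sigma_finite_measure set T -> \bar R}) (n : nat)
  (nu : {sigma_finite_measure set (n.-tuple T) -> \bar R}).

Definition measure_cons : set (n.+1.-tuple T) -> \bar R :=
  pushforward (mu \x nu)%E (@tuple_cons n).

Let measure_cons0 : measure_cons set0 = 0%E.
Proof. by rewrite /measure_cons /pushforward preimage_set0 measure0. Qed.

Let measure_cons_ge0 A : (0 <= measure_cons A)%E.
Proof. exact: (measure_ge0 (mu \x nu)%E). Qed.

Let measure_cons_sigma_additive : semi_sigma_additive measure_cons.
Proof.
move=> F mF tF mUF; rewrite /measure_cons /pushforward preimage_bigcup.
have mpre A : measurable A -> measurable (@tuple_cons n @^-1` A).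
  by move=> mA; rewrite -[X in measurable X]setTI; exact: measurable_tuple_cons.
apply: measure_semi_sigma_additive.
- by move=> k; exact: mpre.
- apply/trivIsetP => /= i j _ _ ij; rewrite -preimage_setI.
  by move/trivIsetP : tF => /(_ _ _ _ _ ij) ->//; rewrite preimage_set0.
- by rewrite -preimage_bigcup; exact: mpre.
Qed.

HB.instance Definition _ := isMeasure.Build _ _ _ measure_cons
  measure_cons0 measure_cons_ge0 measure_cons_sigma_additive.

Let measure_cons_sigma_finite : sigma_finite setT measure_cons.
Proof.
have [F TF Foo] := product_measure_sigma_finite mu nu.
pose uncons (t : n.+1.-tuple T) : T * n.-tuple T :=
  (thead t, [tuple of behead t]).
have munc : measurable_fun setT uncons.
  by apply/measurable_fun_pair => /=;
    [exact: measurable_tnth|exact: measurable_behead].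
exists (fun k => uncons @^-1` F k).
  by rewrite -preimage_bigcup -TF preimage_setT.
move=> k; have [mF Fk] := Foo k; split.
  by rewrite -[X in measurable X]setTI; exact: munc.
rewrite /measure_cons /pushforward -comp_preimage.
rewrite (_ : uncons \o @tuple_cons n = id)//.
apply/funext => -[x t]; rewrite /uncons /tuple_cons /=; congr pair.
exact/val_inj.
Qed.

HB.instance Definition _ := Measure_isSigmaFinite.Build _ _ _ measure_cons
  measure_cons_sigma_finite.

End step.

Fixpoint measure_pow (mu : {sigma_finite_measure set T -> \bar R}) n :
    {sigma_finite_measure set (n.-tuple T) -> \bar R} :=
  match n with
  | 0 => dirac ([tuple] : 0.-tuple T)
  | n'.+1 => measure_cons mu (measure_pow mu n')
  end.

Lemma measure_pow_box (mu : {sigma_finite_measure set T -> \bar R}) n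
    (A : 'I_n -> set T) : (forall i, measurable (A i)) ->
  measure_pow mu n [set t | forall i, A i (tnth t i)] =
  (\prod_(i < n) mu (A i))%E.
Proof.
elim: n A => [|n ih] A mA /=.
  by rewrite big_ord0 diracE mem_set//= => -[].
have mbox : measurable [set t : n.-tuple T |
    forall i, A (lift ord0 i) (tnth t i)].
  rewrite (_ : mkset _ = \bigcap_(i in [set: 'I_n])
      ((@tnth n T)^~ i @^-1` A (lift ord0 i))); last first.
    by apply/seteqP; split => t /= At i; [move=> _|]; exact: At.
  apply: fin_bigcap_measurable => //= i _.
  by rewrite -[X in measurable X]setTI; exact: measurable_tnth.
rewrite big_ord_recl -ih; last by move=> i; exact: mA.
rewrite -product_measure1E// /measure_cons /pushforward; congr (_ _).
apply/seteqP; split => -[x t] /= At.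
  split=> [|i]; first exact: (At ord0).
  by have := At (lift ord0 i); rewrite tnthS.
move=> i; case: At => Ax At.
by case: (unliftP ord0 i) => [j|] ->; rewrite ?tnthS//; exact: At.
Qed.

End measure_power.

Section lebesgue_plane.
Context (R : realType).

Definition lebesgue_plane :
    set (measurableTypeR R * measurableTypeR R) -> \bar R :=
  (lebesgue_measure \x lebesgue_measure)%E.

HB.instance Definition _ := Measure.on lebesgue_plane.

HB.instance Definition _ := Measure_isSigmaFinite.Build _ _ _ lebesgue_plane
  (product_measure_sigma_finite lebesgue_measure lebesgue_measure).

End lebesgue_plane.
Arguments lebesgue_plane {R}.

(* The library puts these structures on every abstract numClosedFieldType, but
   they are not inferred on the concrete one R[i]. *)
Section complex_normed_module.
Context (R : realType).

#[export, non_forgetful_inheritance]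
HB.instance Definition _ := GRing.ComAlgebra.copy R[i] R[i]^o.
#[export, non_forgetful_inheritance]
HB.instance Definition _ := Vector.copy R[i] R[i]^o.
#[export, non_forgetful_inheritance]
HB.instance Definition _ := NormedModule.copy R[i] R[i]^o.

End complex_normed_module.

Section complex_space.
Context (R : realType) (N : nat).

(* Lebesgue measure on 'rV[R[i]]_N is used through the identification [cvec]
   of (R^2)^N with C^N: an integral over C^N is the integral over (R^2)^N of
   the composition with [cvec]. *)
Definition lebesgue_cvec :
    {sigma_finite_measure
       set (N.-tuple (measurableTypeR R * measurableTypeR R)) -> \bar R} :=
  measure_pow lebesgue_plane N.

Definition cvec (t : N.-tuple (measurableTypeR R * measurableTypeR R)) :
    'rV[R[i]]_N :=
  \row_j Complex (tnth t j).1 (tnth t j).2.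

(* The norm of MathComp-Analysis on 'rV[R[i]]_N is the sup norm, and takes
   values in R[i]; it only serves to define differentiability. *)
Definition enorm (z : 'rV[R[i]]_N) : R :=
  Num.sqrt (\sum_j Normc.normc (z ord0 j) ^+ 2).

Definition holomorphic_on (D : set 'rV[R[i]]_N) (f : 'rV[R[i]]_N -> R[i]) :=
  forall xi, D xi -> differentiable f xi.

Definition mindex := {ffun 'I_N -> nat}.

Definition mdeg (alpha : mindex) : nat := (\sum_i alpha i)%N.

Definition monomial (alpha : mindex) (xi : 'rV[R[i]]_N) : R[i] :=
  \prod_i xi ord0 i ^+ alpha i.

(* Unordered convergence to f, along the finite sets of multi-indices, at each
   point of D. If D is a complete Reinhardt domain, then such a c is unique
   and is the family of Taylor coefficients of f at 0. *)
Definition taylor_expansion_on (D : set 'rV[R[i]]_N) (c : mindex -> R[i])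
    (f : 'rV[R[i]]_N -> R[i]) :=
  forall xi, D xi ->
    summability.partial_sum (fun alpha => c alpha * monomial alpha xi)
      @ summability.totally --> f xi.

End complex_space.

Section egg_domain.
Context (R : realType) (n m : nat) (a : R).

Definition egg : set 'rV[R[i]]_(n + m) :=
  [set xi | enorm (lsubmx xi) ^+ 2 + enorm (rsubmx xi) `^ (2 / a) < 1].

Definition egg_weight (xi : 'rV[R[i]]_(n + m)) : R :=
  (1 - enorm (lsubmx xi) ^+ 2) `^ a - enorm (rsubmx xi) ^+ 2.

(* Functions are total, but only their values on [egg] matter. *)
Definition bergman (p lambda : R) : set ('rV[R[i]]_(n + m) -> R[i]) :=
  [set f | holomorphic_on egg f /\
    (\int[lebesgue_cvec R (n + m)]_(t in @cvec R (n + m) @^-1` egg)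
      (egg_weight (cvec t) `^ lambda * Normc.normc (f (cvec t)) `^ p)%:E
      < +oo)%E].

End egg_domain.

(* Main.v *)
(* Write M_c(x) for the mean of |f|^p over the torus of radii x, f = sum c_al
   xi^al.  The kernels of Poisson and Cauchy, discretized on roots of unity, show
   that M_c increases in each radius, that M of (al_k c_al), divided by the p-th
   power of the k-th radius r, increases in r, and that the latter is at most
   (r' - r)^-p M_c at radius r' > r.  Since al_k / |al| is the integral of
   al_k t^(|al| - 1) over ]0, 1[, M of the multiplied coefficients is then bounded
   by a Hardy type integral of M_c along the k-th radius.

   Let r_m be the end of the section of the domain in the k-th radius.  For p > 1
   and lambda >= 0 the section of the weight decreases in r, and Fubini's theorem
   and int_s^r_m (r_m - r)^(-1/2) dr = 2 (r_m - s)^(1/2) conclude; midpoints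
   (s + r_m) / 2 enter through the Cauchy estimate.  For p = 1 one has to bound
   K(s) = int_s^r_m h^lambda r dr.  If xi_k is one of the w_j, it is a multiple of
   h^(lambda + 1).  If it is one of the z_j and lambda is close to -1, the
   corresponding bound C x^(1 - a) h^(lambda + 1), x = 1 - |z|^2, holds only after
   integration in the radius of some w_j, over tails ]t, +oo[; as the means
   increase in that radius, this is enough. *)

From HB Require Import structures.
Require Import Defs.
From mathcomp Require Import all_boot all_order all_algebra.
From mathcomp Require Import all_classical all_reals all_analysis.
From mathcomp Require Import measurable_realfun.
From mathcomp.real_closed Require Import complex.
From mathcomp Require Import ring lra.

Set Implicit Arguments.
Unset Strict Implicit.
Unset Printing Implicit Defensive.
Import Order.TTheory GRing.Theory Num.Theory.
Import numFieldNormedType.Exports.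
Local Open Scope classical_set_scope.
Local Open Scope ring_scope.

(** * Lebesgue measure in the plane and polar coordinates *)

(** What has to be recovered is the loss (r' - r)^-p of the Cauchy estimate near the boundary. For p
    = 1 it is recovered by the extra power of h in K(s). With b the value of x at r_m, x^a - b^a is
    comparable to x^(a - 1) (x - b), and x - b = r_m^2 - s^2; so x^(1 - a) h is comparable to r_m
    (r_m - s). This is the origin of the factor x^(1 - a). For p > 1 it is recovered by Jensen's
    inequality in t with the weight (1 - t r / r_m)^(- 1 - e), where e (p - 1) = 1/2; the exponents
    -1/2 on both sides of the Hardy integral result from this choice.

    The obstacle for p = 1 and a variable z_i is that K(s) has no pointwise bound. Where w = 0 the
    section of the weight is (A - r^2)^(a lambda), which is not integrable up to r_m once a lambda
    <= -1, as may happen for a > 1; for small w the integral is finite but not uniformly comparable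
    to x^(1 - a) h^(lambda + 1). One integration in |w_j| raises the exponent to lambda + 1 >= 0,
    and for nonnegative exponents the monotonicity of the weight suffices. *)

Section lebesgue_affine.
Context (R : realType).
Local Notation mu := (@lebesgue_measure R).

Lemma affine_preimage_itvoc (c d a b : R) : 0 < c ->
  (fun x => c * x + d) @^-1` `]a, b]%classic =
  `](a - d) / c, (b - d) / c]%classic.
Proof.
move=> c0; apply/seteqP; split => x /=; rewrite !in_itv/=.
  by rewrite ltr_pdivrMr// ler_pdivlMr// ltrBlDr lerBrDr mulrC.
by rewrite ltr_pdivrMr// ler_pdivlMr// ltrBlDr lerBrDr mulrC.
Qed.

Lemma measurable_affine (c d : R) :
  measurable_fun setT (fun x : R => c * x + d).
Proof. by apply: measurable_funD => //; apply: measurable_funM. Qed.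

(** The push-forward of [mu] by the affine map, times [c], agrees with [mu] on half-open intervals,
    hence everywhere by uniqueness of Lebesgue measure. *)
Lemma ge0_integral_affine (c d : R) (f : R -> \bar R) : 0 < c ->
  measurable_fun setT f -> (forall x, 0 <= f x)%E ->
  (\int[mu]_x f (c * x + d)%R = c^-1%:E * \int[mu]_x f x)%E.
Proof.
move=> c0 mf f0.
have ci0 : 0 <= c^-1 by rewrite invr_ge0 ltW.
have c00 := ltW c0.
pose phi : measurableTypeR R -> measurableTypeR R := fun x : R => (c * x + d)%R.
have mphi : measurable_fun setT phi by exact: measurable_affine.
pose m := mscale (NngNum c00)
  (measure_function_pushforward__canonical__measure_function_Measure mu mphi).
have muE A : measurable A -> mu A = m A.
  apply: lebesgue_measure_unique => _ [[a b] /= _ <-].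
  rewrite /m /mscale/= /pushforward affine_preimage_itvoc//.
  rewrite !lebesgue_measure_itv/= !lte_fin ltr_pM2r ?invr_gt0// ltrD2r.
  case: ifPn => ab; last by rewrite mule0.
  rewrite -!EFinB -EFinM; congr (_%:E).
  rewrite -mulrBl mulrC -mulrA mulVf ?gt_eqF// mulr1; ring.
have -> : (\int[mu]_x f x = \int[m]_x f x)%E.
  by apply: eq_measure_integral => A mA _; exact: muE.
rewrite /m ge0_integral_mscale//= muleA -EFinM mulVf ?gt_eqF// mul1e.
by rewrite ge0_integral_pushforward.
Qed.

End lebesgue_affine.

Section plane.
Context (R : realType).
Local Notation mu := (@lebesgue_measure R).
Local Notation plane := (measurableTypeR R * measurableTypeR R)%type.
Local Notation lam := (@lebesgue_plane R).

Definition plane_norm (p : plane) : R := Num.sqrt (p.1 ^+ 2 + p.2 ^+ 2).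

Definition plane_scale (r : R) (p : plane) : plane := (r * p.1, r * p.2).

Definition plane_mul (u p : plane) : plane :=
  (u.1 * p.1 - u.2 * p.2, u.2 * p.1 + u.1 * p.2).

Lemma plane_tonelliE (F : plane -> \bar R) : measurable_fun setT F ->
  (forall p, 0 <= F p)%E ->
  (\int[lam]_p F p = \int[mu]_x \int[mu]_y F (x, y))%E /\
  (\int[lam]_p F p = \int[mu]_y \int[mu]_x F (x, y))%E.
Proof.
move=> mF F0; split; first by rewrite [LHS]fubini_tonelli1.
by rewrite [LHS]fubini_tonelli1//; exact: fubini_tonelli.
Qed.

Lemma measurable_sqrt : measurable_fun setT (@Num.sqrt R).
Proof. apply: continuous_measurable_fun; exact: sqrt_continuous. Qed.

Lemma measurable_plane_norm : measurable_fun setT plane_norm.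
Proof.
apply: (measurableT_comp measurable_sqrt).
by apply: measurable_funD; apply: measurable_funX.
Qed.

Lemma measurable_plane_mul d (T : measurableType d) (f g : T -> plane) :
  measurable_fun setT f -> measurable_fun setT g ->
  measurable_fun setT (fun x => plane_mul (f x) (g x)).
Proof.
move=> mf mg.
have mf1 : measurable_fun setT (fun x => (f x).1) by exact: measurableT_comp.
have mf2 : measurable_fun setT (fun x => (f x).2) by exact: measurableT_comp.
have mg1 : measurable_fun setT (fun x => (g x).1) by exact: measurableT_comp.
have mg2 : measurable_fun setT (fun x => (g x).2) by exact: measurableT_comp.
apply: measurable_fun_pair.
  by apply: measurable_funB; apply: measurable_funM.
by apply: measurable_funD; apply: measurable_funM.
Qed.

Lemma ge0_integral_shearx (a : R) (F : plane -> \bar R) :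
  measurable_fun setT F -> (forall p, 0 <= F p)%E ->
  (\int[lam]_p F ((p.1 + a * p.2)%R, p.2) = \int[lam]_p F p)%E.
Proof.
move=> mF F0.
have mG : measurable_fun setT (fun p : plane => ((p.1 + a * p.2)%R, p.2) : plane).
  apply: measurable_fun_pair => //.
  by apply: measurable_funD => //; apply: measurable_funM.
rewrite (plane_tonelliE (measurableT_comp mF mG) (fun p => F0 _)).2.
rewrite (plane_tonelliE mF F0).2.
apply: eq_integral => y _ /=.
have mFy : measurable_fun setT (fun x : R => F (x, y)).
  exact: (measurableT_comp mF (measurable_pair2 y)).
have := ge0_integral_affine (a * y) ltr01 mFy (fun x => F0 _).
by rewrite invr1 mul1e => <-; apply: eq_integral => x _; rewrite mul1r.
Qed.

Lemma ge0_integral_sheary (a : R) (F : plane -> \bar R) :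
  measurable_fun setT F -> (forall p, 0 <= F p)%E ->
  (\int[lam]_p F (p.1, (a * p.1 + p.2)%R) = \int[lam]_p F p)%E.
Proof.
move=> mF F0.
have mG : measurable_fun setT (fun p : plane => (p.1, (a * p.1 + p.2)%R) : plane).
  apply: measurable_fun_pair => //.
  by apply: measurable_funD => //; apply: measurable_funM.
rewrite (plane_tonelliE (measurableT_comp mF mG) (fun p => F0 _)).1.
rewrite (plane_tonelliE mF F0).1.
apply: eq_integral => x _ /=.
have mFy : measurable_fun setT (fun y : R => F (x, y)).
  exact: (measurableT_comp mF (measurable_pair1 x)).
have := ge0_integral_affine (a * x) ltr01 mFy (fun x => F0 _).
by rewrite invr1 mul1e => <-; apply: eq_integral => y _; rewrite mul1r addrC.
Qed.

(** A rotation with nonzero sine s and cosine c is a product of three shears: by a in x, by s in y,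
    by a in x again, where a = (c - 1) / s is minus the tangent of the half angle. Shears preserve
    area by Tonelli and translation invariance. *)
Let rotation_neq0 (u : plane) (F : plane -> \bar R) :
  u.1 ^+ 2 + u.2 ^+ 2 = 1 -> u.2 != 0 ->
  measurable_fun setT F -> (forall p, 0 <= F p)%E ->
  (\int[lam]_p F (plane_mul u p) = \int[lam]_p F p)%E.
Proof.
case: u => c s /= cs1 s0 mF F0; pose a := (c - 1) / s.
have mx : measurable_fun setT (fun p : plane => ((p.1 + a * p.2)%R, p.2) : plane).
  apply: measurable_fun_pair => //.
  by apply: measurable_funD => //; apply: measurable_funM.
have my : measurable_fun setT (fun p : plane => (p.1, (s * p.1 + p.2)%R) : plane).
  apply: measurable_fun_pair => //.
  by apply: measurable_funD => //; apply: measurable_funM.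
have mFx := measurableT_comp mF mx.
have mFxy := measurableT_comp mFx my.
rewrite -[RHS](ge0_integral_shearx a mF F0).
rewrite -[RHS](ge0_integral_sheary s mFx (fun p => F0 _)).
rewrite -[RHS](ge0_integral_shearx a mFxy (fun p => F0 _)).
have as_ : a * s = c - 1 by rewrite /a divfK.
have ac : a * (1 + c) = - s.
  by apply: (mulIf s0); rewrite mulrAC as_ mulNr -expr2 -[s ^+ 2](addKr (c ^+ 2)) cs1; ring.
apply: eq_integral => -[x y] _ /=; congr (F (_, _)) => /=.
  have -> : x + a * y + a * (s * (x + a * y) + y) =
      x + (a * s) * (x + a * y) + 2 * a * y by ring.
  by rewrite as_ -[s]opprK -ac; ring.
by rewrite mulrDr mulrA [s * a]mulrC as_; ring.
Qed.

Lemma ge0_integral_rotation (u : plane) (F : plane -> \bar R) :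
  u.1 ^+ 2 + u.2 ^+ 2 = 1 ->
  measurable_fun setT F -> (forall p, 0 <= F p)%E ->
  (\int[lam]_p F (plane_mul u p) = \int[lam]_p F p)%E.
Proof.
move=> u1 mF F0; have [u20|u20] := eqVneq u.2 0; last by rewrite rotation_neq0.
case: u u1 u20 => c s /= + s0; rewrite {}s0 expr0n/= addr0.
move=> /eqP; rewrite sqrf_eq1 => /orP[/eqP ->|/eqP ->].
  apply: eq_integral => -[x y] _; congr F; rewrite /plane_mul/=.
  by congr (_, _); ring.
(* The half turn is the square of the quarter turn (0, 1), which is a product of shears. *)
have i1 : (0 : R) ^+ 2 + 1 ^+ 2 = 1 by ring.
have mG : measurable_fun setT (F \o plane_mul (0, 1)).
  by apply: (measurableT_comp mF); exact: measurable_plane_mul.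
rewrite -[RHS](@rotation_neq0 (0, 1))//= ?oner_neq0//.
rewrite -[RHS](@rotation_neq0 (0, 1) (F \o plane_mul (0, 1)))//= ?oner_neq0//.
apply: eq_integral => -[x y] _; congr F; rewrite /plane_mul/=.
by congr (_, _); ring.
Qed.

Lemma ge0_integral_plane_scale (r : R) (F : plane -> \bar R) : 0 < r ->
  measurable_fun setT F -> (forall p, 0 <= F p)%E ->
  (\int[lam]_p F (plane_scale r p) = (r ^- 2)%:E * \int[lam]_p F p)%E.
Proof.
move=> r0 mF F0.
have mG : measurable_fun setT (plane_scale r).
  by apply: measurable_fun_pair => //; apply: measurable_funM.
rewrite (plane_tonelliE (measurableT_comp mF mG) (fun p => F0 _)).1.
rewrite (plane_tonelliE mF F0).1.
have mF2 x : measurable_fun setT (fun y : R => F (x, y)).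
  exact: (measurableT_comp mF (measurable_pair1 x)).
have mI : measurable_fun setT (fun x => \int[mu]_y F (x, y))%E.
  by apply: measurable_fun_fubini_tonelli_F.
have I0 x : (0 <= \int[mu]_y F (x, y))%E by exact: integral_ge0.
transitivity (\int[mu]_x (r^-1%:E * \int[mu]_y F ((r * x)%R, y)))%E.
  apply: eq_integral => x _ /=.
  have := ge0_integral_affine 0 r0 (mF2 (r * x)) (fun y => F0 _).
  by move=> <-; apply: eq_integral => y _; rewrite addr0.
rewrite ge0_integralZl//; last 2 first.
- by apply: (measurableT_comp mI); apply: measurable_funM.
- by rewrite lee_fin invr_ge0 ltW.
have := ge0_integral_affine 0 r0 mI I0.
have -> : (\int[mu]_x (fun x0 => \int[mu]_y F (x0, y)) (r * x + 0)%R =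
  \int[mu]_x \int[mu]_y F ((r * x)%R, y))%E.
  by apply: eq_integral => x _; rewrite addr0.
by move=> ->; rewrite muleA -EFinM -expr2 exprVn.
Qed.

End plane.

Section radial.
Context (R : realType).
Local Notation mu := (@lebesgue_measure R).
Local Notation plane := (measurableTypeR R * measurableTypeR R)%type.
Local Notation lam := (@lebesgue_plane R).

Lemma lebesgue_plane_scale (r : R) (A : set plane) : 0 < r -> measurable A ->
  lam (plane_scale r @^-1` A) = ((r ^- 2)%:E * lam A)%E.
Proof.
move=> r0 mA.
have mS : measurable_fun setT (plane_scale r).
  by apply: measurable_fun_pair => //; apply: measurable_funM.
have mSA : measurable (plane_scale r @^-1` A).
  by rewrite -[X in measurable X]setTI; exact: mS.
have mI : measurable_fun setT (fun p : plane => (\1_A p : R)%:E).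
  by apply/measurable_EFinP; exact: measurable_indic.
have I0 (p : plane) : (0 <= (\1_A p : R)%:E)%E by rewrite lee_fin.
transitivity (\int[lam]_p (\1_(plane_scale r @^-1` A) p : R)%:E)%E.
  by rewrite integral_indic// setIT.
transitivity (\int[lam]_p (\1_A (plane_scale r p) : R)%:E)%E => //.
by rewrite (ge0_integral_plane_scale r0 mI I0) integral_indic// setIT.
Qed.

Definition disc (r : R) : set plane := [set p | plane_norm p < r].
Definition wedge (r : R) : set plane := [set p | 0 < p.2 < p.1 /\ p.1 < r].

Lemma measurable_disc r : measurable (disc r).
Proof.
rewrite (_ : disc r = @plane_norm R @^-1` `]-oo, r[%classic); last first.
  by apply/seteqP; split => p /=; rewrite in_itv/=.
by rewrite -[X in measurable X]setTI; exact: measurable_plane_norm.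
Qed.

Let measurable_cone : measurable [set p : plane | 0 < p.2 < p.1].
Proof.
rewrite (_ : mkset _ = [set p | 0 < p.2] `&` [set p | p.2 < p.1]); last first.
  by apply/seteqP; split => p /= => [/andP[]|[? ?]]; [|exact/andP].
apply: measurableI.
  rewrite (_ : mkset _ = snd @^-1` `]0, +oo[%classic); last first.
    by apply/seteqP; split => p /=; rewrite in_itv/= andbT.
  by rewrite -[X in measurable X]setTI; exact: measurable_snd.
rewrite (_ : mkset _ = (fun p : plane => p.2 < p.1) @^-1` [set true]) //.
rewrite -[X in measurable X]setTI.
exact: (measurable_fun_ltr measurable_snd measurable_fst).
Qed.

Lemma measurable_wedge r : measurable (wedge r).
Proof.
rewrite (_ : wedge r = [set p | 0 < p.2 < p.1] `&` fst @^-1` `]-oo, r[%classic).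
  apply: measurableI => //; rewrite -[X in measurable X]setTI.
  exact: measurable_fst.
by apply/seteqP; split => p /=; rewrite in_itv.
Qed.

Lemma plane_norm_scale r p : 0 <= r -> @plane_norm R (plane_scale r p) = r * plane_norm p.
Proof.
move=> r0; rewrite /plane_norm /= !exprMn -mulrDr sqrtrM ?sqr_ge0//.
by rewrite sqrtr_sqr ger0_norm.
Qed.

Lemma plane_norm_ge0 p : 0 <= @plane_norm R p.
Proof. exact: sqrtr_ge0. Qed.

Lemma lebesgue_disc r : 0 < r -> lam (disc r) = ((r ^+ 2)%:E * lam (disc 1))%E.
Proof.
move=> r0; have ri0 : 0 < r^-1 by rewrite invr_gt0.
rewrite -[r in (r ^+ 2)%:E]invrK exprVn -lebesgue_plane_scale//; last first.
  exact: measurable_disc.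
congr (lam _); apply/seteqP; split => p /=; rewrite /disc/= plane_norm_scale ?ltW//.
  by rewrite mulrC ltr_pdivrMr// mul1r.
by rewrite mulrC ltr_pdivrMr// mul1r.
Qed.

Lemma lebesgue_wedge r : 0 < r -> lam (wedge r) = ((r ^+ 2)%:E * lam (wedge 1))%E.
Proof.
move=> r0; have ri0 : 0 < r^-1 by rewrite invr_gt0.
rewrite -[r in (r ^+ 2)%:E]invrK exprVn -lebesgue_plane_scale//; last first.
  exact: measurable_wedge.
congr (lam _); apply/seteqP; split => -[x y] /=; rewrite /wedge/=.
  by rewrite pmulr_rgt0// ltr_pM2l// => -[-> xr]; rewrite mulrC ltr_pdivrMr// mul1r.
by rewrite pmulr_rgt0// ltr_pM2l// => -[-> xr]; split => //; rewrite mulrC ltr_pdivrMr// mul1r in xr.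
Qed.

Let lam_itv (a b c d : R) : a < b -> c < d ->
  lam (`]a, b[%classic `*` `]c, d[%classic) = ((b - a) * (d - c))%:E.
Proof.
move=> ab cd; rewrite /lebesgue_plane product_measure1E//.
have muE x y : x < y -> mu `]x, y[%classic = (y - x)%:E.
  by move=> xy; rewrite lebesgue_measure_itv/= lte_fin xy.
by rewrite EFinM; congr (_ * _)%E; exact: muE.
Qed.

Lemma lebesgue_disc1 : (0 < lam (disc 1) < +oo)%E.
Proof.
apply/andP; split.
  apply: (@lt_le_trans _ _ (lam (`]0, 2^-1[%classic `*` `]0, 2^-1[%classic))).
    by rewrite lam_itv// lte_fin subr0 mulr_gt0.
  apply: le_measure; rewrite ?inE//; [exact: measurableX|exact: measurable_disc|].
  move=> -[x y] /= []; rewrite !in_itv/= => /andP[x0 x1] /andP[y0 y1].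
  rewrite /disc/= /plane_norm/= -[X in _ < X]sqrtr1 ltr_sqrt//.
  nra.
apply: (@le_lt_trans _ _ (lam (`](-1), 1[%classic `*` `](-1), 1[%classic))).
  apply: le_measure; rewrite ?inE//; [exact: measurable_disc|exact: measurableX|].
  move=> -[x y] /=; rewrite /disc/= /plane_norm/= -[X in _ < X]sqrtr1 ltr_sqrt//= => xy.
  rewrite !in_itv/= -!ltr_norml.
  by split; rewrite -sqrtr_sqr -[X in _ < X]sqrtr1 ltr_sqrt//; nra.
by rewrite lam_itv ?ltry// lt_neqAle; lra.
Qed.

Lemma lebesgue_wedge1 : (0 < lam (wedge 1) < +oo)%E.
Proof.
apply/andP; split.
  apply: (@lt_le_trans _ _ (lam (`]2^-1, 1[%classic `*` `]0, 2^-1[%classic))).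
    by rewrite lam_itv ?lte_fin; lra.
  apply: le_measure; rewrite ?inE//; [exact: measurableX|exact: measurable_wedge|].
  move=> -[x y] /= []; rewrite !in_itv/= => /andP[x0 x1] /andP[y0 y1].
  by rewrite /wedge/=; split => //; apply/andP; split => //; lra.
apply: (@le_lt_trans _ _ (lam (`]0, 1[%classic `*` `]0, 1[%classic))).
  apply: le_measure; rewrite ?inE//; [exact: measurable_wedge|exact: measurableX|].
  by move=> -[x y] /= [/= /andP[? ?] ?]; rewrite !in_itv/=; split; apply/andP; split; lra.
by rewrite lam_itv// ltry.
Qed.

(** The norm on the plane and the first coordinate on the cone 0 < y < x both push the measure
    forward to one whose value on ]-oo, b[ is a multiple of b^2, by homogeneity. The two images are
    thus proportional, and since the fibre of the cone over r has length r, the density r dr appears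
    without angles. [K] is the ratio of the areas of the unit disc and of the triangle [wedge 1]. *)
Lemma radial_integral : exists2 K : R, 0 < K &
  forall Phi : R -> \bar R, measurable_fun setT Phi -> (forall r, 0 <= Phi r)%E ->
  (\int[lam]_p Phi (plane_norm p) =
   K%:E * \int[mu]_(r in `]0%R, +oo[) (r%:E * Phi r))%E.
Proof.
have [/andP[D0 Doo] /andP[T0 Too]] := (lebesgue_disc1, lebesgue_wedge1).
have Dfin : lam (disc 1) \is a fin_num by rewrite ge0_fin_numE// ltW.
have Tfin : lam (wedge 1) \is a fin_num by rewrite ge0_fin_numE// ltW.
pose D := fine (lam (disc 1)); pose T := fine (lam (wedge 1)).
have DP : 0 < D by rewrite fine_gt0// D0.
have TP : 0 < T by rewrite fine_gt0// T0.
pose nrm : plane -> measurableTypeR R := @plane_norm R.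
have mnrm : measurable_fun setT nrm by exact: measurable_plane_norm.
pose mc := mrestr lam measurable_cone.
pose m1 : {measure set (measurableTypeR R) -> \bar R} := mscale (NngNum (ltW DP))
  (measure_function_pushforward__canonical__measure_function_Measure mc
    (@measurable_fst _ _ (measurableTypeR R) (measurableTypeR R))).
pose m2 : {measure set (measurableTypeR R) -> \bar R} := mscale (NngNum (ltW TP))
  (measure_function_pushforward__canonical__measure_function_Measure lam
    mnrm).
have m1E (b : R) : 0 < b -> m1 `]-oo, b[%classic = (D * (b ^+ 2 * T))%:E.
  move=> b0; transitivity (D%:E * lam (fst @^-1` `]-oo, b[%classic `&`
      [set p : plane | (0 < p.2 < p.1)%R]))%E => //.
  rewrite (_ : _ `&` _ = wedge b); last first.
    by apply/seteqP; split => p /=; rewrite in_itv/= => -[].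
  by rewrite lebesgue_wedge// [RHS]EFinM; congr (_ * _)%E; rewrite [RHS]EFinM fineK.
have m2E (b : R) : 0 < b -> m2 `]-oo, b[%classic = (T * (b ^+ 2 * D))%:E.
  move=> b0.
  transitivity (T%:E * lam (@plane_norm R @^-1` `]-oo, b[%classic))%E => //.
  rewrite (_ : _ @^-1` _ = disc b); last first.
    by apply/seteqP; split => p /=; rewrite in_itv.
  by rewrite lebesgue_disc// [RHS]EFinM; congr (_ * _)%E; rewrite [RHS]EFinM fineK.
have m10 (b : R) : b <= 0 -> m1 `]-oo, b[%classic = 0%E.
  move=> b0; transitivity (D%:E * lam (fst @^-1` `]-oo, b[%classic `&`
      [set p : plane | (0 < p.2 < p.1)%R]))%E => //.
  rewrite (_ : _ `&` _ = set0) ?measure0 ?mule0//.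
  apply/seteqP; split => p //=; rewrite in_itv/= => -[pb /andP[p2 p12]].
  by have := lt_trans p2 (lt_trans p12 pb); rewrite ltNge b0.
have m20 (b : R) : b <= 0 -> m2 `]-oo, b[%classic = 0%E.
  move=> b0.
  transitivity (T%:E * lam (@plane_norm R @^-1` `]-oo, b[%classic))%E => //.
  rewrite (_ : _ @^-1` _ = set0) ?measure0 ?mule0//.
  apply/seteqP; split => p //=; rewrite in_itv/= => pb.
  by have := le_lt_trans (plane_norm_ge0 p) pb; rewrite ltNge b0.
have m12 A : measurable A -> m1 A = m2 A.
  have := @measure_unique _ R (measurableTypeR R) (@RGenInftyO.G R) (fun n => `]-oo, n%:R[%classic) _ _ _ _ m1 m2 _ _ A.
  apply.
  - exact: RGenInftyO.measurableE.
  - move=> _ _ [x ->] [y ->]; exists (Num.min x y).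
    by apply/seteqP; split => z /=; rewrite !in_itv/= lt_min; [move=> [-> ->]|move=> /andP[]].
  - by move=> n; exists n%:R.
  - apply/seteqP; split => // x _; exists (Num.trunc `|x|).+1 => //=.
    rewrite in_itv/=; apply: le_lt_trans (ler_norm x) _.
    exact: truncnS_gt.
  - move=> _ [b ->]; have [b0|b0] := ltP 0 b.
      by rewrite m1E// m2E//; congr (_%:E); ring.
    by rewrite m10// m20.
  - move=> n; have [b0|b0] := ltP 0 (n%:R : R); first by rewrite m1E// ltry.
    by rewrite m10.
exists (D / T); first by rewrite divr_gt0.
move=> Phi mPhi Phi0.
have : (\int[m1]_x Phi x = \int[m2]_x Phi x)%E.
  by apply: eq_measure_integral => A mA _; exact: m12.
have mP2 : measurable_fun setT (fun p : plane => Phi p.1).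
  by apply: measurableT_comp => //; exact: measurable_fst.
rewrite [LHS]ge0_integral_mscale// [RHS]ge0_integral_mscale//=.
have -> : (\int[pushforward mc fst]_x Phi x = \int[mc]_p Phi p.1)%E.
  by rewrite (ge0_integral_pushforward (@measurable_fst _ _ (measurableTypeR R) (measurableTypeR R)) mc).
have -> : (\int[pushforward lam nrm]_x Phi x = \int[lam]_p Phi (plane_norm p))%E.
  by rewrite (ge0_integral_pushforward mnrm lam).
have -> : (\int[mc]_p Phi p.1 =
    \int[mu]_(r in `]0%R, +oo[) (r%:E * Phi r))%E.
  have mc0 : mc (~` [set p : plane | 0 < p.2 < p.1]) = 0%E.
    by rewrite /mc /mrestr setICl measure0.
  rewrite (@ge0_negligible_integral _ _ _ _ _ (~` [set p : plane | 0 < p.2 < p.1]))//; last first.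
    exact: measurableC.
  rewrite setTD setCK.
  transitivity (\int[lam]_(p in [set p : plane | (0 < p.2 < p.1)%R]) Phi p.1)%E.
    apply: eq_measure_integral => A mA AC; rewrite /mc /mrestr/=.
    by congr (lam _); apply/setIidPl.
  rewrite integral_mkcond.
  rewrite (plane_tonelliE _ _).1; last 2 first.
  - by apply/(measurable_restrictT _ _).1 => //; exact: measurable_funTS.
  - by move=> p; rewrite patchE; case: ifPn.
  rewrite [RHS]integral_mkcond; apply: eq_integral => x _.
  have -> : (fun y : R => (fun p : plane => Phi p.1) \_ [set p : plane | (0 < p.2 < p.1)%R] (x, y)) =
     (fun=> Phi x) \_ `]0, x[%classic.
    apply/funext => y; rewrite !patchE/=; congr (if _ then _ else _).
  rewrite -integral_mkcond patchE mem_setE in_itv/= andbT.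
  have muE : mu `]0%R, x[%classic = if (0 < x)%R then x%:E else 0%E.
    by rewrite lebesgue_measure_itv/= lte_fin; case: ifPn => //; rewrite oppr0 adde0.
  transitivity (Phi x * mu `]0%R, x[%classic)%E; first exact: integral_cst.
  by rewrite muE; case: ifPn => x0; rewrite ?mule0// muleC.
move=> DTE; rewrite EFinM [(D%:E * _)%E]muleC -muleA DTE muleA -EFinM mulVf ?gt_eqF//.
by rewrite mul1e.
Qed.

End radial.

(** * Integrals over tuples of plane vectors and means over tori *)

Section measure_pow_theory.
Context d (T : measurableType d) (R : realType).
Variable mu : {sigma_finite_measure set T -> \bar R}.
Local Open Scope ereal_scope.

Lemma ge0_integral_measure_powS n (F : n.+1.-tuple T -> \bar R) :
  measurable_fun setT F -> (forall t, 0 <= F t) ->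
  \int[measure_pow mu n.+1]_t F t =
  \int[mu]_x \int[measure_pow mu n]_t F (tuple_cons (x, t)).
Proof.
move=> mF F0.
have mtc := @measurable_tuple_cons d T n.
have mG := measurableT_comp mF mtc.
rewrite -(@fubini_tonelli1 _ _ _ _ _ mu (measure_pow mu n) _ mG (fun p => F0 _)).
rewrite (ge0_integral_pushforward mtc (mu \x measure_pow mu n))//.
Qed.

Definition tset n (t : n.-tuple T) (k : 'I_n) (x : T) : n.-tuple T :=
  [tuple if i == k then x else tnth t i | i < n].

Definition tmap n (phi : 'I_n -> T -> T) (t : n.-tuple T) : n.-tuple T :=
  [tuple phi i (tnth t i) | i < n].

Lemma measurable_tset n d' (T' : measurableType d') (t : T' -> n.-tuple T) k (x : T' -> T) :
  measurable_fun setT t -> measurable_fun setT x ->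
  measurable_fun setT (fun y => tset (t y) k (x y)).
Proof.
move=> mt mx; apply/measurable_fun_tnthP => i.
rewrite (_ : _ \o _ = if i == k then x else (@tnth n T)^~ i \o t); last first.
  by apply/funext => y /=; rewrite tnth_mktuple; case: ifP.
by case: ifP => // _; apply: measurableT_comp => //; exact: measurable_tnth.
Qed.

Lemma measurable_tmap n (phi : 'I_n -> T -> T) :
  (forall i, measurable_fun setT (phi i)) -> measurable_fun setT (tmap phi).
Proof.
move=> mphi; apply/measurable_fun_tnthP => i.
rewrite (_ : _ \o _ = phi i \o (@tnth n T)^~ i); last first.
  by apply/funext => y /=; rewrite tnth_mktuple.
by apply: measurableT_comp => //; exact: measurable_tnth.
Qed.

Lemma ge0_integral_tmap n (phi : 'I_n -> T -> T) (F : n.-tuple T -> \bar R) :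
  (forall i, measurable_fun setT (phi i)) ->
  (forall i (G : T -> \bar R), measurable_fun setT G -> (forall x, 0 <= G x) ->
     \int[mu]_x G (phi i x) = \int[mu]_x G x) ->
  measurable_fun setT F -> (forall t, 0 <= F t) ->
  \int[measure_pow mu n]_t F (tmap phi t) = \int[measure_pow mu n]_t F t.
Proof.
elim: n phi F => [|n ih] phi F mphi phiE mF F0.
  by apply: eq_integral => t _; congr F; rewrite (tuple0 t) [LHS]tuple0.
rewrite ge0_integral_measure_powS//; last first.
  by apply: (measurableT_comp mF); exact: measurable_tmap.
rewrite [RHS]ge0_integral_measure_powS//.
pose phi' i := phi (lift ord0 i).
have tmapE x t : tmap phi (tuple_cons (x, t)) =
    tuple_cons (phi ord0 x, tmap phi' t).
  apply: eq_from_tnth => i; rewrite tnth_mktuple.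
  by case: (unliftP ord0 i) => [j|] ->; rewrite ?tnthS ?tnth0//= tnth_mktuple.
have mG := measurableT_comp mF (@measurable_tuple_cons d T n).
have mI := measurable_fun_fubini_tonelli_F (m2 := measure_pow mu n) _ mG (fun p => F0 _).
rewrite -[RHS](phiE ord0 _ mI); last by move=> x; apply: integral_ge0 => t _; exact: F0.
apply: eq_integral => x _; under eq_integral do rewrite tmapE.
apply: (ih phi' (fun t => F (tuple_cons (phi ord0 x, t)))) => //.
- by move=> i; exact: mphi.
- by move=> i; exact: phiE.
- exact: (measurableT_comp mG (measurable_pair1 _)).
Qed.

(** Tonelli in the k-th coordinate without shortening the tuple: the coordinate made idle by the
    inner integral is still integrated outside, where the density [w] of total mass 1 absorbs it. *)
Lemma ge0_integral_tset n (k : 'I_n) (w : T -> \bar R) (F : n.-tuple T -> \bar R) :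
  measurable_fun setT w -> (forall x, 0 <= w x) -> \int[mu]_x w x = 1 ->
  measurable_fun setT F -> (forall t, 0 <= F t) ->
  \int[measure_pow mu n]_t F t =
  \int[measure_pow mu n]_t (w (tnth t k) * \int[mu]_x F (tset t k x)).
Proof.
move=> mw w0 w1; elim: n k F => [[]//|n ih] k F mF F0.
rewrite ge0_integral_measure_powS//.
have mG := measurableT_comp mF (@measurable_tuple_cons d T n).
have mwF : measurable_fun setT (fun t : n.+1.-tuple T =>
    w (tnth t k) * \int[mu]_x F (tset t k x)).
  apply: emeasurable_funM.
    by apply: measurableT_comp => //; exact: measurable_tnth.
  apply: (measurable_fun_fubini_tonelli_F (m2 := mu) (fun p => F (tset p.1 k p.2))) => //.
  apply: measurableT_comp => //.
  by apply: measurable_tset; [exact: measurable_fst|exact: measurable_snd].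
rewrite [RHS]ge0_integral_measure_powS//; last first.
  by move=> t; apply: mule_ge0 => //; apply: integral_ge0 => x _; exact: F0.
have tset0 x t y : tset (tuple_cons (x, t)) ord0 y = tuple_cons (y, t).
  apply: eq_from_tnth => i; rewrite tnth_mktuple.
  by case: (unliftP ord0 i) => [j|] ->; rewrite ?tnthS ?tnth0//= eqxx.
have tsetS x (t : n.-tuple T) j y : tset (tuple_cons (x, t)) (lift ord0 j) y = tuple_cons (x, tset t j y).
  apply: eq_from_tnth => i; rewrite tnth_mktuple.
  by case: (unliftP ord0 i) => [l|] ->; rewrite ?tnthS ?tnth0//= tnth_mktuple (inj_eq lift_inj).
case: (unliftP ord0 k) => [j|] ->; last first.
  have mI := measurable_fun_fubini_tonelli_G (m1 := mu) _ mG (fun p => F0 _).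
  have I0 t : 0 <= \int[mu]_y F (tuple_cons (y, t)).
    by apply: integral_ge0 => y _; exact: F0.
  pose I := \int[measure_pow mu n]_t \int[mu]_y F (tuple_cons (y, t)).
  have II0 : 0 <= I by apply: integral_ge0 => t _; exact: I0.
  transitivity (\int[mu]_x (w x * I)).
    rewrite ge0_integralZr// w1 mul1e.
    exact: (fubini_tonelli (m1 := mu) (m2 := measure_pow mu n) _ mG (fun p => F0 _)).
  apply: eq_integral => x _.
  rewrite /I -ge0_integralZl//.
  apply: eq_integral => t _; rewrite tnth0; congr (_ * _).
  by apply: eq_integral => y _; rewrite tset0.
apply: eq_integral => x _.
rewrite (ih j)//; last exact: (measurableT_comp mG (measurable_pair1 _)).
apply: eq_integral => t _; rewrite tnthS; congr (_ * _).
by apply: eq_integral => y _; rewrite tsetS.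
Qed.

End measure_pow_theory.

Lemma emeasurable_patch d (T : measurableType d) (R : realType) (D : set T)
    (f : T -> \bar R) :
  measurable D -> measurable_fun setT f -> measurable_fun setT (f \_ D).
Proof.
by move=> mD mf; apply/(measurable_restrictT f mD).1; exact: measurable_funTS.
Qed.

Section torus_average.
Context (R : realType) (N : nat).
Local Notation mu := (@lebesgue_measure R).
Local Notation plane := (measurableTypeR R * measurableTypeR R)%type.
Local Notation lam := (@lebesgue_plane R).
Local Notation lamN := (lebesgue_cvec R N).
Implicit Types (p q u : plane) (t s w : N.-tuple plane) (x : N.-tuple R).

(** The value at the origin is an arbitrary unit vector, so that [plane_norm_phase] and
    [plane_normK] hold at every point. *)
Definition phase p : plane :=
  if plane_norm p == 0 then (1, 0) else plane_scale (plane_norm p)^-1 p.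

Lemma measurable_inv_plane_norm : measurable_fun setT (fun p => (@plane_norm R p)^-1).
Proof.
rewrite (_ : (fun p => _) = (fun p => plane_norm p `^ (-1))).
  exact: (measurableT_comp (measurable_powR _) (@measurable_plane_norm R)).
by apply/funext => p; rewrite powR_inv1// plane_norm_ge0.
Qed.

Lemma measurable_phase : measurable_fun setT phase.
Proof.
rewrite /phase; apply: measurable_fun_ifT => //.
  have m0 : measurable_fun setT (fun _ : plane => 0 : R) by exact: measurable_cst.
  exact: (measurable_fun_eqr (@measurable_plane_norm R) m0).
by apply: measurable_fun_pair; apply: measurable_funM => //;
  exact: measurable_inv_plane_norm.
Qed.

Lemma plane_norm_mul u p : plane_norm (plane_mul u p) = plane_norm u * @plane_norm R p.
Proof.
rewrite /plane_norm -sqrtrM ?addr_ge0 ?sqr_ge0//=; congr Num.sqrt; ring.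
Qed.

Lemma plane_norm_phase p : plane_norm (phase p) = 1.
Proof.
rewrite /phase; case: ifPn => [_|p0].
  by rewrite /plane_norm/= expr1n expr0n/= addr0 sqrtr1.
by rewrite plane_norm_scale ?mulVf// invr_ge0 plane_norm_ge0.
Qed.

Lemma plane_normP u : plane_norm u = 1 -> u.1 ^+ 2 + u.2 ^+ 2 = 1.
Proof.
move=> u1; rewrite -[LHS]sqr_sqrtr ?addr_ge0 ?sqr_ge0//.
by rewrite -/(plane_norm u) u1 expr1n.
Qed.

Lemma phase_mul u p : plane_norm u = 1 -> plane_norm p != 0 ->
  phase (plane_mul u p) = plane_mul u (phase p).
Proof.
move=> u1 p0; rewrite /phase plane_norm_mul u1 mul1r (negbTE p0).
by rewrite /plane_mul /plane_scale/=; congr (_, _); ring.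
Qed.

Lemma plane_norm_eq0 p : plane_norm p = 0 -> p = (0, 0).
Proof.
case: p => a b /= /eqP; rewrite sqrtr_eq0/= => ab0.
have [a0 b0] := (sqr_ge0 a, sqr_ge0 b).
have : a ^+ 2 + b ^+ 2 == 0 by rewrite eq_le ab0 addr_ge0.
by rewrite paddr_eq0// !sqrf_eq0 => /andP[/eqP -> /eqP ->].
Qed.

Lemma plane_normK p : plane_scale (plane_norm p) (phase p) = p.
Proof.
rewrite /phase; case: ifPn => [/eqP p0|p0].
  by rewrite p0 (plane_norm_eq0 p0) /plane_scale/= !mul0r.
by case: p p0 => a b p0; rewrite /plane_scale/= !mulrA mulfV// !mul1r.
Qed.

Definition tnorm t : N.-tuple R := [tuple plane_norm (tnth t i) | i < N].
Definition trot w t : N.-tuple plane := [tuple plane_mul (tnth w i) (tnth t i) | i < N].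
Definition tphase s : N.-tuple plane := [tuple phase (tnth s i) | i < N].
Definition tpolar x s : N.-tuple plane :=
  [tuple plane_scale (tnth x i) (phase (tnth s i)) | i < N].
Definition pdisc : set (N.-tuple plane) :=
  [set s | forall i, 0 < plane_norm (tnth s i) < 1].

Lemma measurable_tnorm : measurable_fun setT tnorm.
Proof.
apply/measurable_fun_tnthP => i.
rewrite (_ : _ \o _ = @plane_norm R \o (@tnth N plane)^~ i); last first.
  by apply/funext => y /=; rewrite tnth_mktuple.
apply: measurableT_comp; first exact: measurable_plane_norm.
exact: measurable_tnth.
Qed.

Lemma measurable_trot d (T : measurableType d) (f g : T -> N.-tuple plane) :
  measurable_fun setT f -> measurable_fun setT g ->
  measurable_fun setT (fun y => trot (f y) (g y)).
Proof.
move=> mf mg; apply/measurable_fun_tnthP => i.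
rewrite (_ : _ \o _ = fun y => plane_mul (tnth (f y) i) (tnth (g y) i)); last first.
  by apply/funext => y /=; rewrite tnth_mktuple.
apply: measurable_plane_mul; apply: (measurableT_comp (measurable_tnth _)) => //.
Qed.

Lemma measurable_tphase : measurable_fun setT tphase.
Proof.
apply/measurable_fun_tnthP => i.
rewrite (_ : _ \o _ = phase \o (@tnth N plane)^~ i); last first.
  by apply/funext => y /=; rewrite tnth_mktuple.
apply: measurableT_comp; first exact: measurable_phase.
exact: measurable_tnth.
Qed.

Lemma measurable_tpolar d (T : measurableType d) (f : T -> N.-tuple R) (g : T -> N.-tuple plane) :
  measurable_fun setT f -> measurable_fun setT g ->
  measurable_fun setT (fun y => tpolar (f y) (g y)).
Proof.
move=> mf mg; apply/measurable_fun_tnthP => i.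
rewrite (_ : _ \o _ = fun y => plane_scale (tnth (f y) i) (phase (tnth (g y) i))); last first.
  by apply/funext => y /=; rewrite tnth_mktuple.
have mfi : measurable_fun setT (fun y => tnth (f y) i).
  exact: (measurableT_comp (measurable_tnth _)).
have mgi : measurable_fun setT (fun y => phase (tnth (g y) i)).
  apply: (measurableT_comp measurable_phase).
  exact: (measurableT_comp (measurable_tnth _)).
by apply: measurable_fun_pair; apply: measurable_funM => //; exact: measurableT_comp.
Qed.

Lemma measurable_pdisc : measurable pdisc.
Proof.
rewrite (_ : pdisc = \bigcap_(i in [set: 'I_N])
      ((@tnth N plane)^~ i @^-1` [set p | 0 < plane_norm p < 1])); last first.
  by apply/seteqP; split => t /= At i; [move=> _|]; exact: At.
apply: fin_bigcap_measurable => //= i _.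
rewrite -[X in measurable X]setTI; apply: measurable_tnth => //.
rewrite (_ : mkset _ = @plane_norm R @^-1` `]0, 1[%classic); last first.
  by apply/seteqP; split => p /=; rewrite in_itv.
by rewrite -[X in measurable X]setTI; exact: measurable_plane_norm.
Qed.

Lemma trot_isom w (F : N.-tuple plane -> \bar R) :
  (forall i, plane_norm (tnth w i) = 1) ->
  measurable_fun setT F -> (forall t, 0 <= F t)%E ->
  (\int[lamN]_t F (trot w t) = \int[lamN]_t F t)%E.
Proof.
move=> w1 mF F0.
apply: (@ge0_integral_tmap _ _ _ (@lebesgue_plane R) N (fun i => plane_mul (tnth w i))) => //.
- by move=> i; exact: measurable_plane_mul.
- by move=> i G mG G0; apply: ge0_integral_rotation => //; exact: plane_normP.
Qed.

Lemma pdisc_trot w s : (forall i, plane_norm (tnth w i) = 1) ->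
  pdisc (trot w s) = pdisc s.
Proof.
move=> w1; apply/propext; split => sP i; have := sP i;
  by rewrite tnth_mktuple plane_norm_mul w1 mul1r.
Qed.

Lemma trot_tpolar w x s : (forall i, plane_norm (tnth w i) = 1) -> pdisc s ->
  trot w (tpolar x s) = tpolar x (trot w s).
Proof.
move=> w1 sP; apply: eq_from_tnth => i; rewrite !tnth_mktuple phase_mul//; last first.
  by have /andP[/gt_eqF ->] := sP i.
by rewrite /plane_mul /plane_scale/=; congr (_, _); ring.
Qed.

(* [x] is a tuple of radii. The torus is parametrized by the arguments of the
   coordinates of a point of the punctured polydisc [pdisc], so that no measure on
   the circle is needed; this multiplies the mean by the measure of [pdisc]. *)
Definition torus_mean (F : N.-tuple plane -> \bar R) x : \bar R :=
  (\int[lamN]_(s in pdisc) F (tpolar x s))%E.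

Lemma torus_mean_ge0 F x : (forall t, 0 <= F t)%E -> (0 <= torus_mean F x)%E.
Proof. by move=> F0; exact: integral_ge0. Qed.

Lemma measurable_torus_mean F : measurable_fun setT F -> (forall t, 0 <= F t)%E ->
  measurable_fun setT (torus_mean F).
Proof.
move=> mF F0; rewrite (_ : torus_mean F = fun x =>
    \int[lamN]_s ((F (tpolar x s)) * (\1_pdisc s)%:E))%E; last first.
  apply/funext => x; rewrite /torus_mean integral_mkcond.
  apply: eq_integral => s _; rewrite patchE indicE.
  by case: ifPn; rewrite ?mule1 ?mule0.
apply: (measurable_fun_fubini_tonelli_F (m2 := lamN)
  (fun p : N.-tuple R * N.-tuple plane => F (tpolar p.1 p.2) * (\1_pdisc p.2)%:E)%E).
  apply: emeasurable_funM.
    apply: measurableT_comp => //; exact: measurable_tpolar.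
  apply/measurable_EFinP; apply: measurableT_comp => //.
  by apply: measurable_indic; exact: measurable_pdisc.
by move=> p; apply: mule_ge0 => //; rewrite lee_fin.
Qed.

Lemma torus_mean_trot F w x : (forall i, plane_norm (tnth w i) = 1) ->
  measurable_fun setT F -> (forall t, 0 <= F t)%E ->
  torus_mean (F \o trot w) x = torus_mean F x.
Proof.
move=> w1 mF F0; rewrite /torus_mean [LHS]integral_mkcond [RHS]integral_mkcond.
rewrite -[RHS](trot_isom w1).
- apply: eq_integral => s _; rewrite !patchE.
  have -> : (trot w s \in pdisc) = (s \in pdisc).
    by apply/idP/idP => /set_mem; rewrite ?pdisc_trot// => sP; apply/mem_set;
      rewrite ?pdisc_trot.
  by case: ifPn => // /set_mem sP; rewrite /= trot_tpolar.
- apply: emeasurable_patch; first exact: measurable_pdisc.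
  by apply: measurableT_comp => //; exact: measurable_tpolar.
- by move=> s; rewrite patchE; case: ifPn.
Qed.

(** The mean is invariant under rotation by the phases of [t]. As multiplication of phases commutes,
    it becomes an average over rotations of the point [t] itself. *)
Lemma torus_mean_tnorm F t : measurable_fun setT F -> (forall t, 0 <= F t)%E ->
  torus_mean F (tnorm t) = (\int[lamN]_(s in pdisc) F (trot (tphase s) t))%E.
Proof.
move=> mF F0; rewrite -(@torus_mean_trot F (tphase t))//; last first.
  by move=> i; rewrite tnth_mktuple plane_norm_phase.
apply: eq_integral => s _; congr F; apply: eq_from_tnth => i.
rewrite !tnth_mktuple -[tnth t i in RHS]plane_normK.
by rewrite /plane_mul /plane_scale/=; congr (_, _); ring.
Qed.

(** After [torus_mean_tnorm] and Tonelli, the inner integral for fixed [s] is that of [F] rotated by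
    the phases of [s]. Rotations preserve both the measure and the radii, so it does not depend on
    [s]. This does the work of polar coordinates in all variables at once. *)
Lemma integral_torus_mean (W : N.-tuple R -> \bar R) F :
  measurable_fun setT W -> (forall x, 0 <= W x)%E ->
  measurable_fun setT F -> (forall t, 0 <= F t)%E ->
  (\int[lamN]_t (W (tnorm t) * torus_mean F (tnorm t)) =
   lamN pdisc * \int[lamN]_t (W (tnorm t) * F t))%E.
Proof.
move=> mW W0 mF F0.
have mWt : measurable_fun setT (fun t => W (tnorm t)).
  by apply: measurableT_comp => //; exact: measurable_tnorm.
have mPi : measurable_fun setT (fun s => (\1_pdisc s : R)%:E).
  apply/measurable_EFinP; apply: measurable_indic; exact: measurable_pdisc.
pose G (p : N.-tuple plane * N.-tuple plane) : \bar R :=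
  ((\1_pdisc p.2)%:E * (W (tnorm p.1) * F (trot (tphase p.2) p.1)))%E.
have mG : measurable_fun setT G.
  apply: emeasurable_funM; first exact: (measurableT_comp mPi measurable_snd).
  apply: emeasurable_funM; first exact: (measurableT_comp mWt measurable_fst).
  apply: measurableT_comp => //; apply: measurable_trot => //.
  exact: (measurableT_comp measurable_tphase measurable_snd).
have G0 (pq : N.-tuple plane * N.-tuple plane) : (0 <= G pq)%E.
  by rewrite mule_ge0// ?lee_fin// mule_ge0.
transitivity (\int[lamN]_t \int[lamN]_s G (t, s))%E.
  apply: eq_integral => t _; rewrite torus_mean_tnorm// integral_mkcond.
  rewrite -ge0_integralZl//; last 2 first.
  - apply: emeasurable_patch; first exact: measurable_pdisc.
    apply: measurableT_comp => //; apply: measurable_trot => //.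
    exact: measurable_tphase.
  - by move=> s _; rewrite patchE; case: ifPn.
  apply: eq_integral => s _; rewrite patchE /G/= indicE.
  by case: ifPn; rewrite ?mul1e// mul0e mule0.
rewrite (fubini_tonelli _ mG G0)/=.
pose I := (\int[lamN]_t (W (tnorm t) * F t))%E.
transitivity (\int[lamN]_s ((\1_pdisc s)%:E * I))%E.
  apply: eq_integral => s _; rewrite /G/=.
  have mH : measurable_fun setT (fun t => W (tnorm t) * F (trot (tphase s) t))%E.
    apply: emeasurable_funM => //; apply: measurableT_comp => //.
    exact: measurable_trot.
  rewrite ge0_integralZl//; last by move=> t _; rewrite mule_ge0.
  congr (_ * _)%E; rewrite /I -(@trot_isom (tphase s) (fun t => W (tnorm t) * F t)%E).
  - apply: eq_integral => t _; congr (W _ * _)%E.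
    apply: eq_from_tnth => i; rewrite !tnth_mktuple plane_norm_mul.
    by rewrite plane_norm_phase mul1r.
  - by move=> i; rewrite tnth_mktuple plane_norm_phase.
  - exact: emeasurable_funM.
  - by move=> t; rewrite mule_ge0.
rewrite ge0_integralZr//.
- by rewrite integral_indic ?setIT//; exact: measurable_pdisc.
- by apply: integral_ge0 => t _; rewrite mule_ge0.
Qed.

Lemma lebesgue_pdisc : (0 < lamN pdisc < +oo)%E.
Proof.
have mA : measurable [set p : plane | 0 < plane_norm p < 1].
  rewrite (_ : mkset _ = @plane_norm R @^-1` `]0, 1[%classic); last first.
    by apply/seteqP; split => p /=; rewrite in_itv.
  by rewrite -[X in measurable X]setTI; exact: measurable_plane_norm.
have -> : lamN pdisc = (\prod_(i < N) lam [set p : plane | (0 < plane_norm p < 1)%R])%E.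
  exact: (measure_pow_box (@lebesgue_plane R) (A := fun=> [set p : plane | 0 < plane_norm p < 1])).
have A01 : (0 < lam [set p : plane | (0 < plane_norm p < 1)%R] < +oo)%E.
  have [/andP[D0 Doo] /andP[T0 Too]] := (lebesgue_disc1 R, lebesgue_wedge1 R).
  apply/andP; split.
    apply: (@lt_le_trans _ _ (lam (wedge 2^-1))).
      by rewrite lebesgue_wedge// mule_gt0// lte_fin exprn_gt0.
    apply: le_measure; rewrite ?inE//; first exact: measurable_wedge.
    move=> -[x y] /= [] /= /andP[y0 yx] x2.
    rewrite /plane_norm/= sqrtr_gt0 -[X in _ && (_ < X)]sqrtr1 ltr_sqrt//.
    by apply/andP; split; nra.
  apply: (@le_lt_trans _ _ (lam (disc 1))) => //.
  apply: le_measure; rewrite ?inE//; first exact: measurable_disc.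
  by move=> p /= /andP[].
elim/big_rec: _ => [|i x _ /andP[x0 xoo]]; first by rewrite lte01 ltry.
case/andP: A01 => A0 A1; rewrite mule_gt0//=.
by rewrite lte_mul_pinfty// ?ltW// ge0_fin_numE// ltW.
Qed.

Lemma tnorm_tset t k p : tnorm (tset t k p) = tset (tnorm t) k (plane_norm p).
Proof.
by apply: eq_from_tnth => i; rewrite !tnth_mktuple; case: ifP.
Qed.

(* Polar coordinates in the k-th variable only. *)
Lemma le_integral_tnorm (k : 'I_N) (Phi Psi : N.-tuple R -> \bar R) :
  measurable_fun setT Phi -> (forall x, 0 <= Phi x)%E ->
  measurable_fun setT Psi -> (forall x, 0 <= Psi x)%E ->
  (forall x, (forall i, (0 <= tnth x i)%R) ->
    \int[mu]_(r in `]0%R, +oo[) (r%:E * Phi (tset x k r)) <=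
    \int[mu]_(r in `]0%R, +oo[) (r%:E * Psi (tset x k r)))%E ->
  (\int[lamN]_t Phi (tnorm t) <= \int[lamN]_t Psi (tnorm t))%E.
Proof.
move=> mPhi Phi0 mPsi Psi0 PhiPsi.
have [/andP[D0 Doo]] := lebesgue_disc1 R.
have Dfin : lam (disc 1) \is a fin_num by rewrite ge0_fin_numE// ltW.
(* The uniform density on the unit disc, of total mass 1, for [ge0_integral_tset]. *)
pose w (p : plane) : \bar R := ((fine (lam (disc 1)))^-1%:E * (\1_(disc 1) p)%:E)%E.
have mdisc1 : measurable_fun setT (fun p : plane => (\1_(disc 1) p : R)%:E).
  by apply/measurable_EFinP; apply: measurable_indic; exact: measurable_disc.
have mw : measurable_fun setT w by exact: measurable_funeM.
have w0 p : (0 <= w p)%E.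
  by rewrite mule_ge0// lee_fin// invr_ge0 fine_ge0// ltW.
have w1 : (\int[lam]_p w p = 1)%E.
  rewrite ge0_integralZl//; last by rewrite lee_fin invr_ge0 fine_ge0// ltW.
  rewrite integral_indic// ?setIT; last exact: measurable_disc.
  by rewrite -[X in (_ * X)%E]fineK// -EFinM mulVf// gt_eqF// fine_gt0// D0.
have mnorm (f : N.-tuple R -> \bar R) : measurable_fun setT f -> measurable_fun setT (fun t => f (tnorm t)).
  move=> mf; apply: (measurableT_comp mf); exact: measurable_tnorm.
rewrite (ge0_integral_tset k mw w0 w1 (mnorm _ mPhi))//.
rewrite (ge0_integral_tset k mw w0 w1 (mnorm _ mPsi))//.
have mI (f : N.-tuple R -> \bar R) : measurable_fun setT f -> (forall x, 0 <= f x)%E ->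
    measurable_fun setT (fun t => w (tnth t k) * \int[lam]_p f (tnorm (tset t k p)))%E.
  move=> mf f0; apply: emeasurable_funM.
    by apply: (measurableT_comp mw); exact: measurable_tnth.
  apply: (measurable_fun_fubini_tonelli_F (m2 := @lebesgue_plane R)
    (fun tp : N.-tuple plane * plane => f (tnorm (tset tp.1 k tp.2)))) => //.
  apply: (measurableT_comp (mnorm _ mf)).
  by apply: measurable_tset; [exact: measurable_fst|exact: measurable_snd].
apply: ge0_le_integral => //.
- by move=> t _; rewrite mule_ge0// integral_ge0.
- exact: mI.
- exact: mI.
- move=> t _; apply: lee_wpmul2l => //.
  have [K K0 KE] := radial_integral R.
  have mset (f : N.-tuple R -> \bar R) : measurable_fun setT f -> measurable_fun setT (fun r => f (tset (tnorm t) k r)).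
    move=> mf; apply: (measurableT_comp mf).
    by apply: measurable_tset => //; exact: measurable_id.
  under eq_integral do rewrite tnorm_tset.
  under [leRHS]eq_integral do rewrite tnorm_tset.
  rewrite (KE (fun r => Phi (tset (tnorm t) k r)))//; last exact: mset.
  rewrite (KE (fun r => Psi (tset (tnorm t) k r)))//; last exact: mset.
  apply: lee_wpmul2l; first by rewrite lee_fin ltW.
  by apply: PhiPsi => i; rewrite tnth_mktuple plane_norm_ge0.
Qed.

End torus_average.

From mathcomp Require Import finmap.

(** * Unordered sums and power series *)

Section complex_norm.
Context (R : realType).
Implicit Types z : R[i].
Local Notation nc := (@Normc.normc R).

Lemma normc_ge0 z : 0 <= nc z. Proof. by case: z => a b; exact: sqrtr_ge0. Qed.

Lemma normcD z1 z2 : nc (z1 + z2) <= nc z1 + nc z2. Proof. exact: le_normcD. Qed.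

Lemma normcN z : nc (- z) = nc z. Proof. exact: normcN. Qed.

Lemma normcB z1 z2 : nc (z1 - z2) = nc (z2 - z1).
Proof. by rewrite -normcN opprB. Qed.

Lemma normc_sum I (s : seq I) (P : pred I) (a : I -> R[i]) :
  nc (\sum_(i <- s | P i) a i) <= \sum_(i <- s | P i) nc (a i).
Proof.
elim/big_rec2: _ => [|i x z _ h]; first by rewrite Normc.normc0.
by apply: le_trans (normcD _ _) _; apply: lerD.
Qed.

Lemma normcX z n : nc (z ^+ n) = nc z ^+ n.
Proof.
elim: n => [|n ih]; first by rewrite !expr0 Normc.normc1.
by rewrite !exprS Normc.normcM ih.
Qed.

Lemma normc_prod I (s : seq I) (P : pred I) (a : I -> R[i]) :
  nc (\prod_(i <- s | P i) a i) = \prod_(i <- s | P i) nc (a i).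
Proof.
by elim/big_rec2: _ => [|i x z _ h]; rewrite ?Normc.normc1// Normc.normcM h.
Qed.

Lemma normc_real (x : R) : nc x%:C%C = `|x|.
Proof. by rewrite /Normc.normc/= expr0n/= addr0 sqrtr_sqr. Qed.

Lemma normc_nat n : nc n%:R = n%:R.
Proof. by rewrite -(rmorph_nat (real_complex R)) normc_real ger0_norm. Qed.

Lemma le_Re_normc z : `|complex.Re z| <= nc z.
Proof.
by case: z => a b /=; rewrite -sqrtr_sqr ler_wsqrtr// lerDl sqr_ge0.
Qed.

Lemma le_Im_normc z : `|complex.Im z| <= nc z.
Proof.
by case: z => a b /=; rewrite -sqrtr_sqr ler_wsqrtr// lerDr sqr_ge0.
Qed.

Lemma normc_le_ReIm z : nc z <= `|complex.Re z| + `|complex.Im z|.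
Proof.
case: z => a b /=; rewrite -[leRHS]ger0_norm ?addr_ge0// -sqrtr_sqr.
rewrite ler_wsqrtr// sqrrD !real_normK ?num_real//.
by rewrite -addrA lerD2l lerDr mulrn_wge0// mulr_ge0.
Qed.

Lemma ler_distnormc z1 z2 : `|nc z1 - nc z2| <= nc (z1 - z2).
Proof.
rewrite ler_norml; apply/andP; split.
  rewrite lerNl opprB lerBlDr normcB; apply: le_trans (normcD _ _).
  by rewrite subrK.
by rewrite lerBlDr; apply: le_trans (normcD _ _); rewrite subrK.
Qed.

End complex_norm.

Section unordered_sums.
Local Open Scope fset_scope.
Local Open Scope ring_scope.
Context (R : realType) (I : choiceType).
Local Notation nc := (@Normc.normc R).
Implicit Types (a : I -> R[i]) (b : I -> R) (A : {fset I}).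

Lemma big_fset_split (V : nmodType) A0 A (F : I -> V) : A0 `<=` A ->
  (\sum_(i <- A) F i = \sum_(i <- A0) F i + \sum_(i <- A `\` A0) F i)%R.
Proof.
move=> sA; rewrite (big_fsetID _ (mem A0))/=; congr (_ + _)%R.
  by apply: eq_fbigl => i; rewrite !inE/= andbC; case: (boolP (i \in A0)) => //= /(fsubsetP sA).
by apply: eq_fbigl => i; rewrite !inE/= andbC.
Qed.

Definition bounded_sums b := exists B, forall A, \sum_(i <- A) b i <= B.

Lemma bounded_sums_tail b : (forall i, 0 <= b i) -> bounded_sums b ->
  forall e : R, 0 < e -> exists A0, forall A, \sum_(i <- A `\` A0) b i <= e.
Proof.
move=> b0 [B bB] e e0; pose S := [set s | exists A, s = \sum_(i <- A) b i]%classic.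
have supS : has_sup S.
  by split; [exists 0; exists fset0; rewrite big_seq_fset0|
    exists B => _ [A ->]; exact: bB].
have [_ [A0 ->] A0e] := sup_adherent e0 supS; exists A0 => A.
have : \sum_(i <- A0 `|` A) b i <= sup S.
  by apply: ub_le_sup; [exact: supS.2|exists (A0 `|` A)].
rewrite (@big_fset_split _ A0) ?fsubsetUl//.
rewrite (_ : (A0 `|` A) `\` A0 = A `\` A0); first by lra.
by apply/fsetP => i; rewrite !inE; case: (i \in A0).
Qed.

Definition has_rsum b (s : R) := forall e : R, 0 < e -> exists A0, forall A,
  A0 `<=` A -> `|\sum_(i <- A) b i - s| <= e.

Lemma bounded_has_rsum b : (forall i, 0 <= b i) -> bounded_sums b ->
  exists s, has_rsum b s.
Proof.
move=> b0 [B bB]; pose S := [set s | exists A, s = \sum_(i <- A) b i]%classic.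
have supS : has_sup S.
  by split; [exists 0; exists fset0; rewrite big_seq_fset0|
    exists B => _ [A ->]; exact: bB].
exists (sup S) => e e0; have [_ [A0 ->] A0e] := sup_adherent e0 supS.
exists A0 => A A0A; rewrite distrC ger0_norm; last first.
  by rewrite subr_ge0; apply: ub_le_sup; [exact: supS.2|exists A].
rewrite (big_fset_split _ A0A).
have : 0 <= \sum_(i <- A `\` A0) b i by exact: sumr_ge0.
lra.
Qed.

Definition has_csum a (z : R[i]) := forall e : R, 0 < e -> exists A0, forall A,
  A0 `<=` A -> nc (\sum_(i <- A) a i - z) <= e.

Definition csummable a := bounded_sums (nc \o a).

(* 0 when there is no sum. *)
Definition csum a : R[i] := xget 0 [set z | has_csum a z]%classic.

Lemma has_rsumB b1 b2 s1 s2 : has_rsum b1 s1 -> has_rsum b2 s2 ->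
  has_rsum (fun i => b1 i - b2 i) (s1 - s2).
Proof.
move=> h1 h2 e e0; have e20 : 0 < e / 2 by rewrite divr_gt0.
have [[A1 H1] [A2 H2]] := (h1 _ e20, h2 _ e20).
exists (A1 `|` A2) => A; rewrite fsubUset => /andP[s1A s2A].
have -> : \sum_(i <- A) (b1 i - b2 i) - (s1 - s2) =
    (\sum_(i <- A) b1 i - s1) + (s2 - \sum_(i <- A) b2 i).
  by rewrite sumrB; ring.
have := ler_normD (\sum_(i <- A) b1 i - s1) (s2 - \sum_(i <- A) b2 i).
have := H1 _ s1A; have := H2 _ s2A; rewrite (distrC s2); lra.
Qed.

Lemma has_csum_ReIm a s1 s2 : has_rsum (fun i => complex.Re (a i)) s1 ->
  has_rsum (fun i => complex.Im (a i)) s2 -> has_csum a (Complex s1 s2).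
Proof.
move=> h1 h2 e e0; have e20 : 0 < e / 2 by rewrite divr_gt0.
have [[A1 H1] [A2 H2]] := (h1 _ e20, h2 _ e20).
exists (A1 `|` A2) => A; rewrite fsubUset => /andP[s1A s2A].
apply: le_trans (normc_le_ReIm _) _.
have -> : complex.Re (\sum_(i <- A) a i - Complex s1 s2) =
    \sum_(i <- A) complex.Re (a i) - s1.
  by rewrite (raddfB (@complex.Re R)) (raddf_sum (@complex.Re R)).
have -> : complex.Im (\sum_(i <- A) a i - Complex s1 s2) =
    \sum_(i <- A) complex.Im (a i) - s2.
  by rewrite (raddfB (@complex.Im R)) (raddf_sum (@complex.Im R)).
have := H1 _ s1A; have := H2 _ s2A; lra.
Qed.

Lemma bounded_sums_le b1 b2 : (forall i, b1 i <= b2 i) ->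
  bounded_sums b2 -> bounded_sums b1.
Proof.
by move=> b12 [B bB]; exists B => A; apply: le_trans (bB A); exact: ler_sum.
Qed.

Lemma has_rsum_of_bounded b : bounded_sums (fun i => `|b i|) -> exists s, has_rsum b s.
Proof.
move=> bb.
have [s1 h1] : exists s, has_rsum (fun i => `|b i| + b i) s.
  apply: bounded_has_rsum => [i|]; first by have := ler_norm (- b i); rewrite normrN; lra.
  have [B bB] := bb; exists (B + B) => A; rewrite big_split/= lerD//.
  by apply: le_trans (bB A); apply: ler_sum => i _; exact: ler_norm.
have [s2 h2] := bounded_has_rsum (fun i => normr_ge0 (b i)) bb.
exists (s1 - s2); rewrite (_ : b = fun i => `|b i| + b i - `|b i|); last first.
  by apply/funext => i; rewrite addrAC subrr add0r.
exact: has_rsumB.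
Qed.

Lemma csumP a : csummable a -> has_csum a (csum a).
Proof.
move=> ba; apply: (@xgetPex _ 0 [set z | has_csum a z]%classic).
have [s1 h1] : exists s, has_rsum (fun i => complex.Re (a i)) s.
  by apply: has_rsum_of_bounded; apply: bounded_sums_le ba => i; exact: le_Re_normc.
have [s2 h2] : exists s, has_rsum (fun i => complex.Im (a i)) s.
  by apply: has_rsum_of_bounded; apply: bounded_sums_le ba => i; exact: le_Im_normc.
by exists (Complex s1 s2); exact: has_csum_ReIm.
Qed.

Lemma has_csum_normc_le a z B : has_csum a z -> (forall A, nc (\sum_(i <- A) a i) <= B) ->
  nc z <= B.
Proof.
move=> az aB; apply/ler_addgt0Pr => e e0; have [A0 H] := az _ e0.
have := H _ (fsubset_refl A0); rewrite normcB => h.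
have := normcD (z - \sum_(i <- A0) a i) (\sum_(i <- A0) a i).
by rewrite subrK; have := aB A0; lra.
Qed.

Lemma has_csum_lin a1 a2 z1 z2 (u : R[i]) : has_csum a1 z1 -> has_csum a2 z2 ->
  has_csum (fun i => a1 i + u * a2 i) (z1 + u * z2).
Proof.
move=> h1 h2 e e0; have e20 : 0 < e / 2 by rewrite divr_gt0.
have u0 : 0 < nc u + 1 by have := normc_ge0 u; lra.
have e30 : 0 < e / 2 / (nc u + 1) by rewrite divr_gt0.
have [[A1 H1] [A2 H2]] := (h1 _ e20, h2 _ e30).
exists (A1 `|` A2) => A; rewrite fsubUset => /andP[s1A s2A].
rewrite big_split/= -mulr_sumr opprD addrACA -mulrBr.
apply: le_trans (normcD _ _) _; rewrite Normc.normcM.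
have k1 := H1 _ s1A; have k2 := H2 _ s2A.
have : nc u * nc (\sum_(i <- A) a2 i - z2) <= (nc u + 1) * (e / 2 / (nc u + 1)).
  by apply: ler_pM => //; rewrite ?normc_ge0//; lra.
rewrite [leRHS]mulrC divfK ?gt_eqF//; lra.
Qed.

Lemma has_csum_unique a z1 z2 : has_csum a z1 -> has_csum a z2 -> z1 = z2.
Proof.
move=> h1 h2; have h := has_csum_lin (-1) h1 h2.
apply/eqP; rewrite -subr_eq0 -[- z2]mulN1r; apply/eqP/Normc.eq0_normc.
apply: le_anti; rewrite normc_ge0 andbT; apply: has_csum_normc_le h _ => A.
by rewrite big1 ?Normc.normc0// => i _; rewrite mulN1r subrr.
Qed.

Lemma csumE a z : csummable a -> has_csum a z -> csum a = z.
Proof. by move=> /csumP; exact: has_csum_unique. Qed.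

Lemma csum_normc_le a B : csummable a -> (forall A, nc (\sum_(i <- A) a i) <= B) ->
  nc (csum a) <= B.
Proof. by move=> /csumP; exact: has_csum_normc_le. Qed.

Lemma csummable_le a b : bounded_sums b -> (forall i, nc (a i) <= b i) -> csummable a.
Proof. by move=> bb ab; apply: bounded_sums_le bb. Qed.

Lemma csummable_lin a1 a2 (u : R[i]) : csummable a1 -> csummable a2 ->
  csummable (fun i => a1 i + u * a2 i).
Proof.
move=> [B1 h1] [B2 h2]; exists (B1 + nc u * B2) => A.
apply: (@le_trans _ _ (\sum_(i <- A) (nc (a1 i) + nc u * nc (a2 i)))).
  by apply: ler_sum => i _ /=; rewrite -Normc.normcM; exact: normcD.
rewrite big_split/= -mulr_sumr lerD ?(h1 A)//.
by apply: ler_wpM2l; [exact: normc_ge0|exact: h2].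
Qed.

Lemma csum_lin a1 a2 (u : R[i]) : csummable a1 -> csummable a2 ->
  csum (fun i => a1 i + u * a2 i) = csum a1 + u * csum a2.
Proof.
move=> h1 h2; apply: csumE; first exact: csummable_lin.
by apply: has_csum_lin; exact: csumP.
Qed.

Lemma csummable0 : csummable (fun _ => 0).
Proof. by exists 0 => A; rewrite big1// => i _; exact: Normc.normc0. Qed.

Lemma csum0 : csum (fun _ => 0) = 0.
Proof.
apply: csumE; first exact: csummable0.
move=> e e0; exists fset0 => A _; rewrite big1// subrr Normc.normc0; exact: ltW.
Qed.

Lemma csumZ a (u : R[i]) : csummable a -> csum (fun i => u * a i) = u * csum a.
Proof.
move=> h; have := csum_lin u csummable0 h; rewrite csum0 add0r => <-.
by congr csum; apply/funext => i; rewrite add0r.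
Qed.

Lemma csummableZ a (u : R[i]) : csummable a -> csummable (fun i => u * a i).
Proof.
move=> h; have := csummable_lin u csummable0 h.
by under eq_fun do rewrite add0r.
Qed.

Lemma csum_sum J (s : seq J) (a : J -> I -> R[i]) (u : J -> R[i]) :
  (forall j, csummable (a j)) ->
  csummable (fun i => \sum_(j <- s) u j * a j i) /\
  csum (fun i => \sum_(j <- s) u j * a j i) = \sum_(j <- s) u j * csum (a j).
Proof.
move=> h; elim: s => [|j s [ih1 ih2]].
  under eq_fun do rewrite big_nil.
  by rewrite big_nil csum0; split=> //; exact: csummable0.
under eq_fun do rewrite big_cons addrC.
split; first exact: csummable_lin.
by rewrite csum_lin// big_cons ih2 addrC.
Qed.

(** Tannery's theorem, that is, dominated convergence for sums: on a finite set [A0] the terms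
    converge, and outside of it both families are dominated by a tail of [b], whence two thirds of
    [e]. *)
Lemma csum_tannery (a_ : nat -> I -> R[i]) a b :
  (forall i, 0 <= b i) -> bounded_sums b -> (forall n i, nc (a_ n i) <= b i) ->
  (forall i, nc (a_ n i - a i) @[n --> \oo] --> (0 : R)) ->
  csummable a /\ nc (csum (a_ n)) @[n --> \oo] --> nc (csum a).
Proof.
move=> b0 bb a_b a_a.
have ab i : nc (a i) <= b i.
  apply/ler_addgt0Pr => e e0.
  have /cvgrPdist_lt/(_ _ e0)[n _ /(_ n (leqnn n))] := a_a i.
  rewrite sub0r normrN ger0_norm ?normc_ge0// => h.
  have := ler_distnormc (a i) (a_ n i); rewrite normcB => /(le_trans (ler_norm _)).
  by have := a_b n i; lra.
have sa : csummable a by exact: csummable_le bb ab.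
have sa_ n : csummable (a_ n) by exact: csummable_le bb (a_b n).
split => //; apply/cvgrPdist_le => e e0.
have e3 : 0 < e / 3 by rewrite divr_gt0.
have [A0 HA0] := bounded_sums_tail b0 bb e3.
have cv (s : seq I) : \sum_(i <- s) nc (a_ n i - a i) @[n --> \oo] --> (0 : R).
  elim: s => [|i s ih].
    by under eq_fun do rewrite big_nil; exact: cvg_cst.
  under eq_fun do rewrite big_cons.
  by have h := cvgD (a_a i) ih; rewrite addr0 in h; exact: h.
have /cvgrPdist_le/(_ _ e3) near0 := cv A0.
near=> n.
have := ler_distnormc (csum a) (csum (a_ n)) => /le_trans; apply.
rewrite normcB -[csum (a_ n) - _]addrC -mulN1r addrC -csum_lin//.
apply: csum_normc_le; first exact: csummable_lin.
move=> A; apply: le_trans (normc_sum _ _ _) _.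
under eq_bigr do rewrite mulN1r.
rewrite (big_fsetID _ (mem A0))/=.
have : \sum_(i <- A0) nc (a_ n i - a i) <= e / 3.
  have : `|0 - \sum_(i <- A0) nc (a_ n i - a i)| <= e / 3 by near: n.
  rewrite sub0r normrN ger0_norm// sumr_ge0// => i _; exact: normc_ge0.
have : \sum_(i <- [fset x in A | x \in A0]) nc (a_ n i - a i) <=
    \sum_(i <- A0) nc (a_ n i - a i).
  rewrite (@big_fset_split _ [fset x in A | x \in A0] A0); last first.
    by apply/fsubsetP => i; rewrite !inE => /andP[].
  by rewrite lerDl sumr_ge0// => i _; exact: normc_ge0.
have : \sum_(i <- [fset x in A | x \notin A0]) nc (a_ n i - a i) <=
    \sum_(i <- A `\` A0) b i + \sum_(i <- A `\` A0) b i.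
  rewrite -big_split/= (_ : [fset x in A | x \notin A0] = A `\` A0); last first.
    by apply/fsetP => i; rewrite !inE andbC.
  apply: ler_sum => i _; apply: le_trans (normcD _ _) _.
  by rewrite normcN lerD.
have := HA0 A; lra.
Unshelve. all: by end_near. Qed.

End unordered_sums.

Section taylor.
Local Open Scope fset_scope.
Local Open Scope ring_scope.
Context (R : realType).
Local Notation nc := (@Normc.normc R).

Lemma totally_cvgP (I : choiceType) (a : I -> R[i]) (z : R[i]) :
  (summability.partial_sum a @ summability.totally --> z)%classic <-> has_csum a z.
Proof.
have psE (A : {fset I}) : summability.partial_sum a A = \sum_(i <- A) a i.
  by rewrite /summability.partial_sum big_seq_fsetE.
have nE (x : R[i]) : `|x| = (nc x)%:C%C by rewrite normc_def; case: x.
have FF : Filter (@summability.totally I).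
  exact: (@filter_filter _ _ (@summability.totally_filter I)).
split.
  move=> /cvgrPdist_le az e e0.
  have eC : 0 < e%:C%C by rewrite ltcR.
  have [A0 _ H] := az _ eC; exists A0 => A A0A.
  by have := H A A0A; rewrite /= psE nE lecR normcB.
move=> az; apply/cvgrPdist_le => e e0.
(* In the partial order of [R[i]] a positive number is real. *)
have er : e = (complex.Re e)%:C%C.
  by move: e0; rewrite ltcE => /andP[/eqP/= + _]; case: e => e1 e2 /= ->.
have e0' : 0 < complex.Re e by move: e0; rewrite {1}er ltcR.
have [A0 H] := az _ e0'; exists A0 => // A A0A.
by rewrite /= psE nE normcB er lecR; exact: H.
Qed.

(** The nonnegative and the negative terms of [A] form two finite subfamilies, and the sum of
    absolute values over each is at most [C]. *)
Lemma rcvg_bounded_sums (I : choiceType) (b : I -> R) (C : R) :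
  (forall A : {fset I}, `|\sum_(i <- A) b i| <= C) ->
  forall A : {fset I}, \sum_(i <- A) `|b i| <= C + C.
Proof.
move=> bC A; rewrite (big_fsetID _ (fun i => 0 <= b i))/=; apply: lerD.
  apply: le_trans (bC [fset x in A | 0 <= b x]); rewrite ger0_norm; last first.
    by rewrite big_seq sumr_ge0// => i; rewrite !inE => /andP[].
  rewrite big_seq [leRHS]big_seq; apply: ler_sum => i.
  by rewrite !inE => /andP[_ /ger0_norm ->].
apply: le_trans (bC [fset x in A | ~~ (0 <= b x)]); rewrite -normrN.
rewrite -sumrN ger0_norm; last first.
  rewrite big_seq sumr_ge0// => i; rewrite !inE -ltNge => /andP[_ /ltW].
  by rewrite oppr_ge0.
rewrite big_seq [leRHS]big_seq; apply: ler_sum => i.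
by rewrite !inE -ltNge => /andP[_ /ltr0_norm ->].
Qed.

(** Unordered convergence is absolute. The sum over any [A] differs from the sum over its union with
    [A0], which is close to [z], by a part of the fixed finite family [A0]. So all finite sums are
    bounded, and [rcvg_bounded_sums] applies to real and imaginary parts. *)
Lemma has_csum_csummable (I : choiceType) (a : I -> R[i]) z : has_csum a z -> csummable a.
Proof.
move=> /(_ _ ltr01)[A0 H].
pose C := 1 + nc z + \sum_(i <- A0) nc (a i).
have aC (A : {fset I}) : nc (\sum_(i <- A) a i) <= C.
  have := H (A0 `|` A) (fsubsetUl _ _).
  have -> : A0 `|` A = (A0 `\` A) `|` A.
    by apply/fsetP => i; rewrite !inE; case: (i \in A0); case: (i \in A).
  rewrite (@big_fset_split _ _ A) ?fsubsetUr//.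
  have -> : ((A0 `\` A) `|` A) `\` A = A0 `\` A.
    by apply/fsetP => i; rewrite !inE; case: (i \in A0); case: (i \in A).
  set x := \sum_(i <- A) a i; set y := \sum_(i <- A0 `\` A) a i => h.
  have yC : nc y <= \sum_(i <- A0) nc (a i).
    apply: le_trans (normc_sum _ _ _) _.
    rewrite [leRHS](@big_fset_split _ _ (A0 `\` A)) ?fsubsetDl// lerDl.
    by apply: sumr_ge0 => i _; exact: normc_ge0.
  have -> : x = (x + y - z) + (z - y) by ring.
  rewrite /C; apply: le_trans (normcD _ _) _.
  have := normcD z (- y); rewrite normcN; lra.
exists (C + C + (C + C)) => A.
apply: (@le_trans _ _ (\sum_(i <- A) (`|complex.Re (a i)| + `|complex.Im (a i)|))).
  by apply: ler_sum => i _; exact: normc_le_ReIm.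
rewrite big_split/=; apply: lerD.
  apply: rcvg_bounded_sums => {}A; rewrite -(raddf_sum (@complex.Re R)).
  exact: le_trans (le_Re_normc _) (aC A).
apply: rcvg_bounded_sums => {}A; rewrite -(raddf_sum (@complex.Im R)).
exact: le_trans (le_Im_normc _) (aC A).
Qed.

End taylor.

Section psums.
Local Open Scope fset_scope.
Local Open Scope ring_scope.
Context (R : realType) (I : countType).
Local Notation nc := (@Normc.normc R).

(** An exhaustion of the countable index type by finite sets: it turns an unordered sum into the
    limit of a sequence, as measurability requires. *)
Definition initial_fset (n : nat) : {fset I} :=
  [fset i in pmap (@pickle_inv I) (iota 0 n)].

Lemma in_initial_fset n (i : I) : (i \in initial_fset n) = (choice.pickle i < n)%N.
Proof.
rewrite !inE mem_pmap; apply/mapP/idP => [[k]|ilt].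
  rewrite mem_iota add0n/= => kn ki.
  by have := @pickle_invK I k; rewrite -ki /= => ->.
by exists (choice.pickle i); rewrite ?mem_iota ?add0n//= pickleK_inv.
Qed.

Lemma initial_fset_sup (A : {fset I}) : exists n0, forall n, (n0 <= n)%N -> A `<=` initial_fset n.
Proof.
exists (\max_(i <- A) (choice.pickle i).+1) => n An; apply/fsubsetP => i iA.
rewrite in_initial_fset; apply: leq_trans An.
by apply: (@leq_bigmax_seq _ _ xpredT (fun i => (choice.pickle i).+1)).
Qed.

Definition psum (a : I -> R[i]) n := \sum_(i <- initial_fset n) a i.

Lemma cvg_psum (a : I -> R[i]) : csummable a ->
  nc (psum a n - csum a) @[n --> \oo] --> (0 : R).
Proof.
move=> /csumP az; apply/cvgrPdist_le => e e0; have [A0 H] := az _ e0.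
have [n0 hn] := initial_fset_sup A0.
exists n0 => // n /= /hn /H; rewrite sub0r normrN ger0_norm//; exact: normc_ge0.
Qed.

Lemma cvg_nc (z_ : nat -> R[i]) z : nc (z_ n - z) @[n --> \oo] --> (0 : R) ->
  nc (z_ n) @[n --> \oo] --> nc z.
Proof.
move=> /cvgrPdist_le h; apply/cvgrPdist_le => e e0.
near=> n; apply: le_trans (ler_distnormc _ _) _; rewrite normcB.
have : `|0 - nc (z_ n - z)| <= e by near: n; exact: h.
by rewrite sub0r normrN ger0_norm// normc_ge0.
Unshelve. all: by end_near. Qed.

End psums.

(** * Differentiability of power series *)

Lemma differentiable_first_order (K : numFieldType) (V W : normedModType K) (f : V -> W)
    (L : {linear V -> W}) x : continuous L ->
  (forall eps : K, 0 < eps -> \forall v \near nbhs (0 : V),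
    `|f (v + x) - (f x + L v)| <= eps * `|v|) ->
  differentiable f x.
Proof.
move=> Lc H.
have fE : f \o shift x = cst (f x) + L +o_ 0 id by apply/eqaddoP.
by apply/diff_locallyP; rewrite (diff_unique Lc fE).
Qed.

Section holomorphy.
Context (R : realType) (N : nat).
Local Notation nc := (@Normc.normc R).
Implicit Types (x v : 'rV[R[i]]_N) (e B th : R).

(** Values, increments and first-order remainders on the polydisc of radius [e] about [x], all
    measured by one constant [B], with the right power of [th] on the smaller polydisc of radius
    [th * e]. Having a single [B] makes the property multiplicative: a factor y_j multiplies [B] by
    |x_j| + e, and a monomial gets its own value at the enlarged radii. *)
Let second_order (F : 'rV[R[i]]_N -> R[i]) x e B (D : 'I_N -> R[i]) :=
  [/\ nc (F x) <= B, forall i, nc (D i) * e <= B &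
   forall v th, 0 <= th <= 1 -> (forall i, nc (v ord0 i) <= th * e) ->
   [/\ nc (F (x + v)) <= B, nc (F (x + v) - F x) <= th * B &
     nc (F (x + v) - F x - \sum_i D i * v ord0 i) <= th ^+ 2 * B]].

Let second_orderM F x e B D j : 0 < e -> 0 <= B -> second_order F x e B D ->
  second_order (fun y => F y * y ord0 j) x e (B * (nc (x ord0 j) + e))
    (fun i => D i * x ord0 j + F x *+ (i == j)).
Proof.
move=> e0 B0 [FB DB H]; have x0 := normc_ge0 (x ord0 j).
split.
- rewrite Normc.normcM; apply: ler_pM => //; first exact: normc_ge0.
  by rewrite lerDl ltW.
- move=> i; apply: (@le_trans _ _ ((nc (D i) * nc (x ord0 j) + nc (F x)) * e)).
    apply: ler_wpM2r; first exact: ltW.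
    apply: le_trans (normcD _ _) _; rewrite Normc.normcM lerD2l.
    by case: (i == j) => //; rewrite mulr0n Normc.normc0 normc_ge0.
  rewrite mulrDl mulrDr mulrAC; apply: lerD; first exact: ler_wpM2r.
  by apply: ler_wpM2r => //; exact: ltW.
- move=> v th /[dup] thP /andP[th0 th1] vth.
  have [h1 h2 h3] := H v th thP vth.
  have vj := vth j; have v0 := normc_ge0 (v ord0 j).
  have the0 : 0 <= th * e by rewrite mulr_ge0// ltW.
  have vje : nc (v ord0 j) <= e by apply: le_trans vj _; rewrite ler_piMl// ltW.
  rewrite !mxE; split.
  + rewrite Normc.normcM; apply: ler_pM => //; try exact: normc_ge0.
    by apply: le_trans (normcD _ _) _; rewrite lerD2l.
  + have -> : F (x + v) * (x ord0 j + v ord0 j) - F x * x ord0 j =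
      (F (x + v) - F x) * x ord0 j + F (x + v) * v ord0 j by ring.
    apply: le_trans (normcD _ _) _; rewrite !Normc.normcM !mulrDr; apply: lerD.
      by rewrite mulrA; exact: ler_wpM2r.
    rewrite mulrCA; apply: ler_pM => //; exact: normc_ge0.
  + have -> : \sum_i (D i * x ord0 j + F x *+ (i == j)) * v ord0 i =
       (\sum_i D i * v ord0 i) * x ord0 j + F x * v ord0 j.
      under eq_bigr do rewrite mulrDl.
      rewrite big_split/=; congr (_ + _).
        by rewrite mulr_suml; apply: eq_bigr => i _; rewrite mulrAC.
      rewrite (bigD1 j)//= eqxx mulr1n big1 ?addr0// => i /negbTE ->.
      by rewrite mulr0n mul0r.
    have -> : F (x + v) * (x ord0 j + v ord0 j) - F x * x ord0 j -
       ((\sum_i D i * v ord0 i) * x ord0 j + F x * v ord0 j) =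
       (F (x + v) - F x - \sum_i D i * v ord0 i) * x ord0 j +
       (F (x + v) - F x) * v ord0 j by ring.
    apply: le_trans (normcD _ _) _; rewrite !Normc.normcM !mulrDr; apply: lerD.
      by rewrite mulrA; exact: ler_wpM2r.
    apply: (@le_trans _ _ ((th * B) * (th * e))).
      by apply: ler_pM => //; exact: normc_ge0.
    by rewrite expr2 [leRHS]mulrA; lra.
Qed.

Definition monomial_bound (al : mindex N) x e : R :=
  \prod_i (nc (x ord0 i) + e) ^+ al i.

Lemma monomial_bound_ge0 al x e : 0 <= e -> 0 <= monomial_bound al x e.
Proof.
move=> e0; apply: prodr_ge0 => i _; apply: exprn_ge0.
by rewrite addr_ge0// normc_ge0.
Qed.

Lemma monomial_second_order al x e : 0 < e -> exists D,
  second_order (monomial al) x e (monomial_bound al x e) D.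
Proof.
move=> e0; rewrite /monomial_bound /monomial.
have be0 j : 0 <= nc (x ord0 j) + e by rewrite addr_ge0 ?normc_ge0// ltW.
elim: (index_enum _) => [|j s [D h]].
  exists (fun=> 0); split.
  - by rewrite !big_nil Normc.normc1.
  - by move=> i; rewrite big_nil Normc.normc0 mul0r.
  - move=> v th /andP[th0 th1] _; rewrite !big_nil Normc.normc1 subrr Normc.normc0.
    rewrite big1 => [|i _]; last by rewrite mul0r.
    by rewrite subrr Normc.normc0 !mulr1 sqr_ge0.
rewrite (_ : (fun y => _) = fun y : 'rV[R[i]]_N =>
    (\prod_(i <- s) y ord0 i ^+ al i) * y ord0 j ^+ al j); last first.
  by apply/funext => y; rewrite big_cons mulrC.
rewrite big_cons mulrC.
elim: (al j) => [|k [D' h']].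
  exists D; rewrite mulr1; rewrite (_ : (fun y => _) = fun y : 'rV[R[i]]_N =>
    (\prod_(i <- s) y ord0 i ^+ al i))//.
  by apply/funext => y; rewrite mulr1.
eexists; rewrite (_ : (fun y => _) = fun y : 'rV[R[i]]_N =>
    (\prod_(i <- s) y ord0 i ^+ al i) * y ord0 j ^+ k * y ord0 j); last first.
  by apply/funext => y; rewrite exprSr mulrA.
rewrite exprSr mulrA; apply: second_orderM h' => //.
by rewrite mulr_ge0 ?exprn_ge0// prodr_ge0// => i _; exact: exprn_ge0.
Qed.

Lemma normc_coord_le (v : 'rV[R[i]]_N) i : (nc (v ord0 i))%:C%C <= `|v|.
Proof.
have -> : (nc (v ord0 i))%:C%C = `|v ord0 i| by rewrite normc_def; case: (v ord0 i).
rewrite [in leRHS]/Num.norm/= mx_normE -[leLHS]nngE num_le.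
exact: (le_bigmax _ (fun ij : 'I_1 * 'I_N => `|v ij.1 ij.2|%:nng) (ord0, i)).
Qed.

(** The second-order bounds of the monomials are summed: absolute convergence at the enlarged radii
    |x_i| + e makes the sum of the remainders at most (|v| / e)^2 C, and the derivative is the sum
    of the derivatives [D] of the terms. *)
Lemma differentiable_power_series (d : mindex N -> R[i]) x e : 0 < e ->
  bounded_sums (fun al => nc (d al) * monomial_bound al x e) ->
  differentiable (fun y => csum (fun al => d al * monomial al y)) x.
Proof.
move=> e0 bd; have [C CB] := bd.
have C0 : 0 <= C by have := CB fset0; rewrite big_seq_fset0.
have b0 al : 0 <= nc (d al) * monomial_bound al x e.
  by rewrite mulr_ge0 ?normc_ge0// monomial_bound_ge0// ltW.
have [D HD] := boolp.choice (fun al => monomial_second_order al x e0).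
have sD i : csummable (fun al => d al * D al i).
  apply: (@csummable_le _ _ _ (fun al => nc (d al) * monomial_bound al x e * e^-1)).
    exists (C / e) => A; rewrite -mulr_suml; apply: ler_wpM2r; last exact: CB.
    by rewrite invr_ge0 ltW.
  move=> al; rewrite Normc.normcM -mulrA; apply: ler_wpM2l; first exact: normc_ge0.
  by have [_ h _] := HD al; rewrite ler_pdivlMr.
have s0 : csummable (fun al => d al * monomial al x).
  apply: (csummable_le bd) => al; rewrite Normc.normcM.
  by apply: ler_wpM2l; [exact: normc_ge0|have [] := HD al].
pose L (v : 'rV[R[i]]_N) : R[i] := \sum_i v ord0 i * csum (fun al => d al * D al i).
have Llin : linear L.
  move=> u v w; rewrite /L scaler_sumr -big_split/=; apply: eq_bigr => i _.
  by rewrite !mxE mulrDl -mulrA.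
pose Lmix := GRing.isLinear.Build _ _ _ _ L Llin.
pose Lp : {linear 'rV[R[i]]_N -> R[i]} := HB.pack L Lmix.
have Lc : continuous Lp.
  rewrite /Lp/= /L; apply: continuous_big => [|i _ w].
    exact: add_continuous.
  have h := @coord_continuous R[i] 1 N ord0 i w.
  by apply: (cvgMr_tmp h); exact: nbhs_filter.
pose f : 'rV[R[i]]_N -> R[i] := fun y => csum (fun al => d al * monomial al y).
apply: (@differentiable_first_order _ _ _ f Lp) => // eps eps0.
have er : eps = (complex.Re eps)%:C%C.
  by move: eps0; rewrite ltcE => /andP[/eqP/= + _]; case: (eps) => e1 e2 /= ->.
have eps0' : 0 < complex.Re eps by move: eps0; rewrite {1}er ltcR.
(* Within this radius (|v| / e)^2 C is at most eps |v|; [C + 1] in the denominator allows for C =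
   0. *)
pose r := Num.min e (e ^+ 2 * complex.Re eps / (C + 1)).
have r0 : 0 < r.
  by rewrite lt_min e0/= divr_gt0 ?mulr_gt0 ?exprn_gt0// ltr_wpDl.
have rC : 0 < r%:C%C by rewrite ltcR.
near=> v.
have vr : `|v| <= r%:C%C by near: v; apply: cvgr0_norm_le.
have [hn hnE] : exists hn : R, `|v| = hn%:C%C.
  by exists (complex.Re `|v|); rewrite RRe_real// normr_real.
have hn0 : 0 <= hn by rewrite -ler0c -hnE; exact: normr_ge0.
have hnr : hn <= r by rewrite -lecR -hnE; exact: vr.
pose th := hn / e.
have th0 : 0 <= th by rewrite divr_ge0// ltW.
have th1 : th <= 1.
  by rewrite ler_pdivrMr// mul1r; apply: le_trans hnr _; rewrite ge_min lexx.
have vth i : nc (v ord0 i) <= th * e.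
  by rewrite divfK ?gt_eqF// -lecR -hnE normc_coord_le.
have thP : 0 <= th <= 1 by exact/andP.
have sv : csummable (fun al => d al * monomial al (x + v)).
  apply: (csummable_le bd) => al; rewrite Normc.normcM.
  apply: ler_wpM2l; first exact: normc_ge0.
  by have [_ _ /(_ v th thP vth)[]] := HD al.
have [sL LE] := csum_sum (index_enum 'I_N) (fun i => v ord0 i) sD.
have nE (z : R[i]) : `|z| = (nc z)%:C%C by rewrite normc_def; case: z.
have -> : f (v + x) - (f x + Lp v) = csum (fun al => d al * monomial al (x + v)
    + (-1) * (d al * monomial al x + 1 * \sum_i v ord0 i * (d al * D al i))).
  rewrite csum_lin//; last exact: csummable_lin.
  by rewrite csum_lin// LE mul1r mulN1r /f [v + x]addrC.
rewrite nE hnE er -rmorphM/= lecR.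
apply: (@le_trans _ _ (th ^+ 2 * C)).
  apply: csum_normc_le; first by apply: csummable_lin => //; exact: csummable_lin.
  move=> A; apply: le_trans (normc_sum _ _ _) _.
  apply: le_trans (ler_wpM2l (sqr_ge0 th) (CB A)).
  rewrite mulr_sumr; apply: ler_sum => al _.
  have -> : d al * monomial al (x + v) +
      -1 * (d al * monomial al x + 1 * (\sum_i v ord0 i * (d al * D al i))) =
      d al * (monomial al (x + v) - monomial al x - \sum_i D al i * v ord0 i).
    have -> : \sum_i v ord0 i * (d al * D al i) = d al * \sum_i D al i * v ord0 i.
      by rewrite mulr_sumr; apply: eq_bigr => i _; ring.
    ring.
  rewrite Normc.normcM mulrCA; apply: ler_wpM2l; first exact: normc_ge0.
  by have [_ _ /(_ v th thP vth)[]] := HD al.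
have hnr' : hn <= e ^+ 2 * complex.Re eps / (C + 1).
  by apply: le_trans hnr _; rewrite ge_min lexx orbT.
have C1 : 0 < C + 1 by rewrite ltr_wpDl.
have -> : th ^+ 2 * C = hn * (hn * C / e ^+ 2) by rewrite /th; field; rewrite gt_eqF.
rewrite mulrC; apply: ler_wpM2r => //.
rewrite ler_pdivrMr ?exprn_gt0// mulrC [leRHS]mulrC.
rewrite ler_pdivlMr// in hnr'; apply: le_trans hnr'.
by rewrite mulrC; apply: ler_wpM2l => //; rewrite lerDl.
Unshelve. all: by end_near. Qed.

End holomorphy.

(** * Measurability of power series *)

Section complex_measurability.
Context (R : realType) (d : measure_display) (T : measurableType d).
Implicit Types f g : T -> R[i].

Definition cmeasurable f :=
  measurable_fun setT (fun x => complex.Re (f x)) /\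
  measurable_fun setT (fun x => complex.Im (f x)).

Lemma cmeasurable_cst z : cmeasurable (fun=> z).
Proof. by split. Qed.

Lemma cmeasurableD f g : cmeasurable f -> cmeasurable g ->
  cmeasurable (fun x => f x + g x).
Proof.
move=> [f1 f2] [g1 g2]; split.
  under eq_fun do rewrite (raddfD (@complex.Re R)); exact: measurable_funD.
under eq_fun do rewrite (raddfD (@complex.Im R)); exact: measurable_funD.
Qed.

Lemma cmeasurableM f g : cmeasurable f -> cmeasurable g ->
  cmeasurable (fun x => f x * g x).
Proof.
move=> [f1 f2] [g1 g2]; split.
  rewrite (_ : (fun x => _) = fun x => complex.Re (f x) * complex.Re (g x) -
    complex.Im (f x) * complex.Im (g x)); last first.
    by apply/funext => x; case: (f x) => a b; case: (g x).
  by apply: measurable_funB; apply: measurable_funM.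
rewrite (_ : (fun x => _) = fun x => complex.Re (f x) * complex.Im (g x) +
    complex.Im (f x) * complex.Re (g x)); last first.
  by apply/funext => x; case: (f x) => a b; case: (g x).
by apply: measurable_funD; apply: measurable_funM.
Qed.

Lemma cmeasurable_sum I (s : seq I) (f : I -> T -> R[i]) :
  (forall i, cmeasurable (f i)) -> cmeasurable (fun x => \sum_(i <- s) f i x).
Proof.
move=> mf; elim: s => [|i s ih].
  by under eq_fun do rewrite big_nil; exact: cmeasurable_cst.
by under eq_fun do rewrite big_cons; exact: cmeasurableD.
Qed.

Lemma cmeasurableX f n : cmeasurable f -> cmeasurable (fun x => f x ^+ n).
Proof.
move=> mf; elim: n => [|n ih].
  by under eq_fun do rewrite expr0; exact: cmeasurable_cst.
by under eq_fun do rewrite exprS; exact: cmeasurableM.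
Qed.

Lemma cmeasurable_prod I (s : seq I) (f : I -> T -> R[i]) :
  (forall i, cmeasurable (f i)) -> cmeasurable (fun x => \prod_(i <- s) f i x).
Proof.
move=> mf; elim: s => [|i s ih].
  by under eq_fun do rewrite big_nil; exact: cmeasurable_cst.
by under eq_fun do rewrite big_cons; exact: cmeasurableM.
Qed.

Lemma measurable_normc f : cmeasurable f -> measurable_fun setT (fun x => Normc.normc (f x)).
Proof.
move=> [f1 f2]; rewrite (_ : (fun x => _) = fun x => Num.sqrt (complex.Re (f x) ^+ 2 +
    complex.Im (f x) ^+ 2)); last by apply/funext => x; case: (f x).
apply: (measurableT_comp (@measurable_sqrt R)).
by apply: measurable_funD; apply: measurable_funX.
Qed.

End complex_measurability.

Section power_series_measurability.
Context (R : realType) (N : nat).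
Local Notation plane := (measurableTypeR R * measurableTypeR R)%type.
Local Notation nc := (@Normc.normc R).
Implicit Types (c : mindex N -> R[i]) (t : N.-tuple plane) (x : N.-tuple R).

Definition term c t (al : mindex N) : R[i] := c al * monomial al (cvec t).

Lemma cmeasurable_term c al : cmeasurable (fun t : N.-tuple plane => term c t al).
Proof.
apply: cmeasurableM; first exact: cmeasurable_cst.
apply: cmeasurable_prod => i; apply: cmeasurableX; split.
  under eq_fun do rewrite mxE; apply: (measurableT_comp measurable_fst).
  exact: measurable_tnth.
under eq_fun do rewrite mxE; apply: (measurableT_comp measurable_snd).
exact: measurable_tnth.
Qed.

(* The p-th power of the modulus of the sum of the power series where it converges
   (see [pow_normE]); a limit superior of partial sums, hence measurable everywhere. *)
Definition pow_norm (p : R) c t : \bar R :=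
  limn_esup (fun n => ((nc (psum (term c t) n) `^ p)%:E)).

Lemma measurable_pow_norm p c : measurable_fun setT (pow_norm p c).
Proof.
apply: measurable_fun_limn_esup => n; apply/measurable_EFinP.
apply: (measurableT_comp (measurable_powR p)).
apply: measurable_normc; apply: cmeasurable_sum => al; exact: cmeasurable_term.
Qed.

Lemma cvg_powR (u : nat -> R) (l p : R) : 0 < p -> (forall n, 0 <= u n) ->
  u n @[n --> \oo] --> l -> u n `^ p @[n --> \oo] --> l `^ p.
Proof.
move=> p0 u0 ul.
have l0 : 0 <= l.
  have <- : limn u = l by exact: cvg_lim.
  by apply: limr_ge; [apply/cvg_ex; exists l|near=> n].
move: l0; rewrite le_eqVlt => /predU1P[l0|l0]; last first.
  apply: (@continuous_cvg _ _ _ _ _ _ (fun y : R => y `^ p)) ul.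
  apply: differentiable_continuous; apply/derivable1_diffP.
  by apply: derivable_powR; rewrite in_itv/= l0.
(* [powR] equals 1 at negative reals, hence is not continuous at 0; here u n >= 0 and the threshold
   e^(1 / p) give the limit directly. *)
rewrite -l0 in ul *; rewrite powR0 ?gt_eqF//.
apply/cvgrPdist_le => e e0; have ep : 0 < e `^ p^-1 by exact: powR_gt0.
have /cvgrPdist_le/(_ _ ep) H := ul.
near=> n; have : `|0 - u n| <= e `^ p^-1 by near: n.
rewrite !sub0r !normrN !ger0_norm ?powR_ge0// => h.
have -> : e = (e `^ p^-1) `^ p.
  by rewrite -powRrM mulVf ?gt_eqF// powRr1// ltW.
by apply: ge0_ler_powR => //; rewrite ?nnegrE ?powR_ge0// ltW.
Unshelve. all: by end_near. Qed.

Lemma pow_normE p c t : 0 < p -> csummable (term c t) ->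
  pow_norm p c t = (nc (csum (term c t)) `^ p)%:E.
Proof.
move=> p0 sc.
have h : (nc (psum (term c t) n) `^ p)%:E @[n --> \oo] --> (nc (csum (term c t)) `^ p)%:E.
  apply: cvg_EFin; first by near=> n.
  apply: cvg_powR => // [n|]; first exact: normc_ge0.
  by apply: cvg_nc; exact: cvg_psum.
rewrite /pow_norm is_cvg_limn_esupE; first exact/cvg_lim.
by apply/cvg_ex; eexists; exact: h.
Unshelve. all: by end_near. Qed.

Lemma pow_norm_ge0 p c t : (0 <= pow_norm p c t)%E.
Proof.
apply: (@le_trans _ _ (limn_einf (fun n => (nc (psum (term c t) n) `^ p)%:E))); last first.
  exact: limn_einf_sup.
rewrite limn_einf_lim; apply: lime_ge; first exact: is_cvg_einfs.
near=> n; apply: le_ereal_inf_tmp => _ [m _ <-]; rewrite lee_fin; exact: powR_ge0.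
Unshelve. all: by end_near. Qed.

End power_series_measurability.

(** * Multipliers given by kernels on roots of unity *)

Section jensen.
Context (R : realType).

(** Young's inequality with the exponents p and p / (p - 1), applied to y and Y^(p - 1), says that
    the graph of the p-th power lies above its tangent at Y. *)
Lemma powR_tangent (p y Y : R) : 1 <= p -> 0 <= y -> 0 <= Y ->
  Y `^ p + p * Y `^ (p - 1) * (y - Y) <= y `^ p.
Proof.
move=> p1 y0 Y0; have p0 : 0 < p by lra.
have [->|pn1] := eqVneq p 1.
  by rewrite subrr powRr0 !powRr1//; lra.
have pp : 0 < p - 1 by rewrite subr_gt0 lt_neqAle eq_sym pn1.
have q0 : 0 < p / (p - 1) by rewrite divr_gt0.
have pq : p^-1 + (p / (p - 1))^-1 = 1 by field; rewrite !gt_eqF.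
have := conjugate_powR y0 (powR_ge0 Y (p - 1)) p0 q0 pq.
rewrite -powRrM (_ : (p - 1) * (p / (p - 1)) = p); last by field; rewrite gt_eqF.
have E : Y `^ p = Y * Y `^ (p - 1) by rewrite mulr_powRB1.
move=> /(ler_wpM2l (ltW p0)); rewrite mulrDr.
have -> : p * (y `^ p / p) = y `^ p by field; rewrite gt_eqF.
have -> : p * (Y `^ p / (p / (p - 1))) = (p - 1) * Y `^ p by field; rewrite !gt_eqF.
move=> h; rewrite -lerBrDl; apply: le_trans (_ : p * (y * Y `^ (p - 1)) - p * Y `^ p <= _).
  by rewrite E; lra.
lra.
Qed.

(** The tangent inequalities at the weighted mean [Y] are summed, where the linear terms cancel. The
    weights are not normalized, and homogeneity in them produces the factor B^(p - 1). *)
Lemma jensen_powR (I : Type) (s : seq I) (b y : I -> R) (p : R) : 1 <= p ->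
  (forall i, 0 <= b i) -> (forall i, 0 <= y i) ->
  (\sum_(i <- s) b i * y i) `^ p <=
  (\sum_(i <- s) b i) `^ (p - 1) * \sum_(i <- s) b i * y i `^ p.
Proof.
move=> p1 b0 y0; have p0 : 0 < p by lra.
set B := \sum_(i <- s) b i; have B0 : 0 <= B by exact: sumr_ge0.
have S0 : 0 <= \sum_(i <- s) b i * y i by apply: sumr_ge0 => i _; rewrite mulr_ge0.
have [BE|Bn0] := eqVneq B 0.
  have bi0 : \sum_(i <- s) b i * y i = 0.
    apply: le_anti; rewrite S0 andbT.
    move: BE; rewrite /B => {B B0 S0}; elim: s => [|i s ih]; rewrite ?big_nil ?big_cons//.
    move=> /eqP; rewrite paddr_eq0 ?sumr_ge0// => /andP[/eqP -> /eqP/ih].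
    by rewrite mul0r add0r.
  rewrite bi0 powR0 ?gt_eqF// mulr_ge0 ?powR_ge0//.
  by apply: sumr_ge0 => i _; rewrite mulr_ge0 ?powR_ge0.
have BP : 0 < B by rewrite lt_neqAle eq_sym Bn0.
pose Y := (\sum_(i <- s) b i * y i) / B.
have Y0 : 0 <= Y by rewrite divr_ge0.
have YB : \sum_(i <- s) b i * y i = B * Y by rewrite mulrC divfK.
rewrite YB powRM// -(@mulr_powRB1 _ B)// mulrAC mulrC; apply: ler_wpM2l.
  exact: powR_ge0.
rewrite mulrC.
have -> : Y `^ p * B = \sum_(i <- s) b i * (Y `^ p + p * Y `^ (p - 1) * (y i - Y)).
  under eq_bigr do rewrite mulrDr mulrCA.
  rewrite big_split/= -mulr_suml -mulr_sumr mulrC -/B.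
  under eq_bigr do rewrite mulrBr.
  by rewrite sumrB YB -mulr_suml -/B subrr mulr0 addr0.
by apply: ler_sum => i _; apply: ler_wpM2l => //; exact: powR_tangent.
Qed.

End jensen.

Section multipliers.
Context (R : realType) (N : nat).
Local Notation plane := (measurableTypeR R * measurableTypeR R)%type.
Local Notation nc := (@Normc.normc R).
Local Notation lamN := (lebesgue_cvec R N).
Implicit Types (c : mindex N -> R[i]) (t : N.-tuple plane) (x : N.-tuple R)
  (S : pred 'I_N).

Definition rmonomial (al : mindex N) x : R := \prod_i tnth x i ^+ al i.

Definition rsummable c x := bounded_sums (fun al => nc (c al) * rmonomial al x).

(** The exponent picked up by a monomial when the variables of [S] are rotated together; [S] will be
    the k-th variable or all the others. *)
Definition sdeg S (al : mindex N) : nat := (\sum_(i | S i) al i)%N.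

Lemma rmonomial_ge0 al x : (forall i, 0 <= tnth x i) -> 0 <= rmonomial al x.
Proof. by move=> x0; apply: prodr_ge0 => i _; exact: exprn_ge0. Qed.

Lemma normc_cplx (q : plane) : nc (Complex q.1 q.2) = plane_norm q.
Proof. by []. Qed.

Lemma normc_monomial al t : nc (monomial al (cvec t)) = rmonomial al (tnorm t).
Proof.
rewrite normc_prod; apply: eq_bigr => i _.
by rewrite normcX mxE normc_cplx tnth_mktuple.
Qed.

Lemma tnorm_tpolar x s : (forall i, 0 <= tnth x i) -> tnorm (tpolar x s) = x.
Proof.
move=> x0; apply: eq_from_tnth => i; rewrite !tnth_mktuple plane_norm_scale//.
by rewrite plane_norm_phase mulr1.
Qed.

Lemma csummable_term c t : rsummable c (tnorm t) -> csummable (term c t).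
Proof.
by move=> h; apply: (csummable_le h) => al; rewrite Normc.normcM normc_monomial.
Qed.

Definition rot_tuple S (w : R[i]) : N.-tuple plane :=
  [tuple if S i then (complex.Re w, complex.Im w) else (1, 0) | i < N].

Lemma monomial_trot S w al t :
  monomial al (cvec (trot (rot_tuple S w) t)) = w ^+ sdeg S al * monomial al (cvec t).
Proof.
rewrite /monomial /sdeg -prodrXr [X in X * _]big_mkcond -big_split/=; apply: eq_bigr => i _.
rewrite !mxE !tnth_mktuple; case: (S i); rewrite /plane_mul/=; last first.
  by rewrite !mul1r !mul0r subr0 add0r.
rewrite -exprMn; congr (_ ^+ _); case: w => a b; case: (tnth t i) => u v /=.
by congr Complex; ring.
Qed.

Lemma plane_norm_rot_tuple S w : nc w = 1 ->
  forall i, plane_norm (tnth (rot_tuple S w) i) = 1.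
Proof.
move=> w1 i; rewrite tnth_mktuple; case: ifP => _; last first.
  by rewrite /plane_norm/= expr1n expr0n addr0 sqrtr1.
by rewrite -w1; case: (w).
Qed.

Lemma tnorm_trot w t : (forall i, plane_norm (tnth w i) = 1) ->
  tnorm (trot w t) = tnorm t.
Proof.
move=> w1; apply: eq_from_tnth => i.
by rewrite !tnth_mktuple plane_norm_mul w1 mul1r.
Qed.

Section roots_average.
Variables (p : R) (p1 : 1 <= p) (S : pred 'I_N).
Let p0 : 0 < p. Proof. by move: p1; lra. Qed.

(** On the torus the new series is the combination with coefficients [k j] of the old one rotated by
    w^j in the variables of [S]. Jensen's inequality holds at each point, and all rotations have the
    same mean. *)
Lemma torus_mean_roots_average c x (M : nat) (w : R[i]) (k : nat -> R[i]) (B : R) :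
  (forall i, 0 <= tnth x i) -> rsummable c x -> nc w = 1 ->
  \sum_(j < M) nc (k j) <= B ->
  (torus_mean (pow_norm p (fun al => (\sum_(j < M) k j * w ^+ (j * sdeg S al)) * c al)%R) x
   <= (B `^ p)%:E * torus_mean (pow_norm p c) x)%E.
Proof.
move=> x0 sx w1 kB.
set c' := (fun al => _); pose A := \sum_(j < M) nc (k j).
have A0 : 0 <= A by apply: sumr_ge0 => j _; exact: normc_ge0.
have wj1 (j : nat) : nc (w ^+ j) = 1 by rewrite normcX w1 expr1n.
pose W j := rot_tuple S (w ^+ j).
have W1 j : forall i, plane_norm (tnth (W j) i) = 1 by exact: plane_norm_rot_tuple.
have tE s : tnorm (tpolar x s) = x by exact: tnorm_tpolar.
have sW s j : csummable (term c (trot (W j) (tpolar x s))).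
  by apply: csummable_term; rewrite tnorm_trot// tE.
have c'E s : csummable (term c' (tpolar x s)) /\
    csum (term c' (tpolar x s)) = \sum_(j < M) k j * csum (term c (trot (W j) (tpolar x s))).
  have [h1 h2] := csum_sum (index_enum 'I_M) (fun j => k j) (fun j => sW s (j : nat)).
  have E : term c' (tpolar x s) =
      (fun al => \sum_(j < M) k j * term c (trot (W j) (tpolar x s)) al).
    apply/funext => al; rewrite /term /c' -mulrA mulr_suml; apply: eq_bigr => j _.
    rewrite monomial_trot exprM; ring.
  by rewrite E; split.
have pw s j : pow_norm p c (trot (W j) (tpolar x s)) =
    (nc (csum (term c (trot (W j) (tpolar x s)))) `^ p)%:E by exact: pow_normE.
apply: (@le_trans _ _ ((A `^ (p - 1))%:E *
    \sum_(j < M) ((nc (k j))%:E * torus_mean (pow_norm p c \o trot (W j)) x))%E); last first.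
  under eq_bigr => j _.
    rewrite torus_mean_trot//; first over.
    - exact: measurable_pow_norm.
    - exact: pow_norm_ge0.
  rewrite -ge0_sume_distrl; last by move=> j _; rewrite lee_fin normc_ge0.
  rewrite sumEFin muleA -EFinM; apply: lee_wpmul2r.
    by apply: torus_mean_ge0 => t; exact: pow_norm_ge0.
  rewrite lee_fin mulrC mulr_powRB1//.
  apply: ge0_ler_powR => //; first exact: ltW.
  by rewrite nnegrE; exact: le_trans kB.
have mT j : measurable_fun setT (fun s => pow_norm p c (trot (W j) (tpolar x s))).
  apply: (measurableT_comp (measurable_pow_norm p c)).
  by apply: measurable_trot => //; exact: measurable_tpolar.
rewrite /torus_mean.
under eq_bigr => j _.
  rewrite -ge0_integralZl//; last 4 first.
  - exact: measurable_pdisc.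
  - by apply: measurable_funTS; exact: mT.
  - by move=> s _; exact: pow_norm_ge0.
  - by rewrite lee_fin normc_ge0.
  over.
rewrite -ge0_integral_sum//; last 3 first.
- exact: measurable_pdisc.
- by move=> j; apply: measurable_funTS; apply: measurable_funeM; exact: mT.
- by move=> j s _; rewrite mule_ge0 ?lee_fin ?normc_ge0//; exact: pow_norm_ge0.
rewrite -ge0_integralZl//; last 4 first.
- exact: measurable_pdisc.
- by apply: measurable_funTS; apply: emeasurable_sum => j; apply: measurable_funeM; exact: mT.
- by move=> s _; apply: sume_ge0 => j _; rewrite mule_ge0 ?lee_fin ?normc_ge0//; exact: pow_norm_ge0.
- by rewrite lee_fin powR_ge0.
apply: ge0_le_integral => //.
- exact: measurable_pdisc.
- by move=> s _; exact: pow_norm_ge0.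
- apply: measurable_funTS; apply: (measurableT_comp (measurable_pow_norm p c')).
  exact: measurable_tpolar.
- apply: measurable_funTS; apply: measurable_funeM; apply: emeasurable_sum => j.
  by apply: measurable_funeM; exact: mT.
move=> s _; have [h1 h2] := c'E s.
rewrite pow_normE// h2.
under [in leRHS]eq_bigr do rewrite /= pw -EFinM.
rewrite sumEFin -EFinM lee_fin.
apply: le_trans (jensen_powR (index_enum 'I_M) p1 _ _); last 2 first.
- by move=> j; exact: normc_ge0.
- by move=> j; exact: normc_ge0.
apply: ge0_ler_powR; [exact: ltW|by rewrite nnegrE normc_ge0| |].
  by rewrite nnegrE; apply: sumr_ge0 => j _; rewrite mulr_ge0// normc_ge0.
apply: le_trans (normc_sum _ _ _) _; apply: ler_sum => j _.
by rewrite Normc.normcM.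
Qed.

Lemma limn_einf_le (u : nat -> \bar R) (C : \bar R) :
  (forall n, u n <= C)%E -> (limn_einf u <= C)%E.
Proof.
move=> uC; rewrite limn_einf_lim; apply: lime_le; first exact: is_cvg_einfs.
near=> n; apply: le_trans (uC n); apply: ereal_inf_lbound; exists n => //=.
Unshelve. all: by end_near. Qed.

(** The domination by [B * nc (c al)] lets Tannery's theorem give convergence at each point of the
    torus; Fatou's lemma carries the bound to the limit. *)
Lemma torus_mean_fatou c c' (c_ : nat -> mindex N -> R[i]) x (B : R) (C : \bar R) :
  (forall i, 0 <= tnth x i) -> rsummable c x -> 0 <= B ->
  (forall n al, nc (c_ n al) <= B * nc (c al)) ->
  (forall al, nc (c_ n al - c' al) @[n --> \oo] --> (0 : R)) ->
  (forall n, torus_mean (pow_norm p (c_ n)) x <= C)%E ->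
  (torus_mean (pow_norm p c') x <= C)%E.
Proof.
move=> x0 sx B0 mB lim_c' c_C.
have tE s : tnorm (tpolar x s) = x by exact: tnorm_tpolar.
have bB : bounded_sums (fun al => B * (nc (c al) * rmonomial al x)).
  have [D CD] := sx; exists (B * D) => A; rewrite -mulr_sumr.
  by apply: ler_wpM2l => //; exact: CD.
have le_c_ s n al : nc (term (c_ n) (tpolar x s) al) <= B * (nc (c al) * rmonomial al x).
  rewrite /term Normc.normcM normc_monomial tE mulrA.
  by apply: ler_wpM2r; [exact: rmonomial_ge0|exact: mB].
have tan s : csummable (term c' (tpolar x s)) /\
    nc (csum (term (c_ n) (tpolar x s))) @[n --> \oo] --> nc (csum (term c' (tpolar x s))).
  apply: (csum_tannery _ bB) => // [al|al].
    by rewrite !mulr_ge0 ?normc_ge0 ?rmonomial_ge0.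
  rewrite (_ : (fun n => _) = (fun n => nc (c_ n al - c' al) * nc (monomial al (cvec (tpolar x s))))); last first.
    by apply/funext => n; rewrite -Normc.normcM mulrBl.
  have h := cvgMr_tmp (b := nc (monomial al (cvec (tpolar x s)))) (lim_c' al).
  by rewrite mul0r in h; exact: h.
have sn s n : csummable (term (c_ n) (tpolar x s)) by exact: (csummable_le bB).
rewrite [X in (X <= _)%E](_ : _ =
    \int[lamN]_(s in @pdisc R N) limn_einf (fun n => pow_norm p (c_ n) (tpolar x s)))%E; last first.
  apply: eq_integral => s _; have [h1 h2] := tan s.
  rewrite pow_normE//.
  have h : pow_norm p (c_ n) (tpolar x s) @[n --> \oo] -->
      (nc (csum (term c' (tpolar x s))) `^ p)%:E.
    under eq_fun => n do rewrite pow_normE//.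
    apply: cvg_EFin; first by near=> n.
    by apply: cvg_powR => // n; exact: normc_ge0.
  rewrite is_cvg_limn_einfE; last by apply/cvg_ex; eexists; exact: h.
  by apply/esym/cvg_lim.
apply: le_trans (fatou _ _ _ _) _.
- exact: measurable_pdisc.
- move=> n; apply: measurable_funTS; apply: (measurableT_comp (measurable_pow_norm p (c_ n))).
  exact: measurable_tpolar.
- by move=> n s _; exact: pow_norm_ge0.
exact: limn_einf_le.
Unshelve. all: by end_near. Qed.

(** A discrete convolution inequality: the multiplier is a limit of Fourier transforms of measures
    on the circle, with masses [k_ n j] at the points w^j and total variation at most [B]. *)
Lemma torus_mean_multiplier c c' x (M_ : nat -> nat) (w_ : nat -> R[i])
    (k_ : nat -> nat -> R[i]) (B : R) :
  (forall i, 0 <= tnth x i) -> rsummable c x -> (forall n, nc (w_ n) = 1) ->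
  (forall n, \sum_(j < M_ n) nc (k_ n j) <= B) ->
  (forall al, nc ((\sum_(j < M_ n) k_ n j * w_ n ^+ (j * sdeg S al)) * c al - c' al)
     @[n --> \oo] --> (0 : R)) ->
  (torus_mean (pow_norm p c') x <= (B `^ p)%:E * torus_mean (pow_norm p c) x)%E.
Proof.
move=> x0 sx w1 kB lim_c'.
have B0 : 0 <= B.
  by apply: le_trans (kB 0%N); apply: sumr_ge0 => j _; exact: normc_ge0.
apply: (torus_mean_fatou x0 sx B0 _ lim_c') => [n al|n].
  rewrite Normc.normcM; apply: ler_wpM2r; first exact: normc_ge0.
  apply: le_trans (kB n); apply: le_trans (normc_sum _ _ _) _.
  by apply: ler_sum => j _; rewrite Normc.normcM normcX w1 expr1n mulr1.
exact: torus_mean_roots_average.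
Qed.

End roots_average.

End multipliers.

(** * Discrete Poisson and Cauchy kernels *)

Section roots_of_unity.
Context (R : realType).
Local Notation nc := (@Normc.normc R).

(** Orders that are powers of 2 make primitivity immediate: the order of a 2^n-th root of -1 divides
    2^(n + 1) but not 2^n. *)
Lemma root_of_unity_exists (n : nat) : exists w : R[i],
  [/\ nc w = 1, w ^+ (2 ^ n.+1) = 1 &
   forall a b, (a < 2 ^ n.+1)%N -> (b < 2 ^ n.+1)%N -> w ^+ a = w ^+ b -> a = b].
Proof.
pose w : R[i] := (2 ^ n).-root (-1); exists w.
have wN : w ^+ (2 ^ n) = -1 by rewrite rootCK// expn_gt0.
have w1 : w ^+ (2 ^ n.+1) = 1 by rewrite expnS mulnC exprM wN sqrrN expr1n.
have pw : (2 ^ n.+1).-primitive_root w.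
  have [m pm /(dvdn_pfactor _ _ (isT : prime 2))[k kn mE]] :=
    prim_order_exists (expn_gt0 2 n.+1) w1.
  move: kn; rewrite leq_eqVlt ltnS => /predU1P[<-|kn]; first by rewrite -mE.
  have : w ^+ (2 ^ n) == 1.
    by rewrite -(prim_order_dvd pm) mE dvdn_exp2l.
  by rewrite wN eq_sym -addr_eq0 (_ : 1 + 1 = 2%:R)// pnatr_eq0.
split => //.
  have : nc w ^+ (2 ^ n) == 1 by rewrite -normcX wN normcN Normc.normc1.
  by rewrite pexpr_eq1 ?expn_gt0 ?normc_ge0// => /eqP.
move=> a b an bn /eqP; rewrite (eq_prim_root_expr pw).
by rewrite !modn_small// => /eqP.
Qed.

Section kernels.
Variables (n : nat) (w : R[i]) (s : R).
(** Partial sums of [K] terms are sampled at [M] = 2 K nodes. Then all exponents to be compared, at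
    most i + d or i + i' + 1 with indices below [K], stay below [M], and orthogonality is free of
    aliasing. *)
Let K := (2 ^ n)%N.
Let M := (2 ^ n.+1)%N.
Hypothesis w1 : nc w = 1.
Hypothesis wM : w ^+ M = 1.
Hypothesis w_inj : forall a b, (a < M)%N -> (b < M)%N -> w ^+ a = w ^+ b -> a = b.
Hypothesis s0 : 0 <= s.
Hypothesis s1 : s < 1.

Let MK : M = (K + K)%N. Proof. by rewrite /M expnS mul2n addnn. Qed.
Let K0 : (0 < K)%N. Proof. by rewrite expn_gt0. Qed.

Let v := w^-1.
Let w0 : w != 0.
Proof. by apply/eqP => w0; move: w1; rewrite w0 Normc.normc0 => /esym/eqP; rewrite oner_eq0. Qed.

Let vE : v = w^*%C.
Proof.
rewrite /v invc_norm (_ : `|w| = 1) ?expr1n ?invr1 ?mul1r//.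
by rewrite normc_def; move: w1; case: (w) => a b /= ->.
Qed.

Lemma orthogonality a b : (a < M)%N -> (b < M)%N ->
  \sum_(j < M) w ^+ (j * a) * v ^+ (j * b) = (M * (a == b))%:R.
Proof.
move=> aM bM; pose q := w ^+ a * v ^+ b.
have -> : \sum_(j < M) w ^+ (j * a) * v ^+ (j * b) = \sum_(j < M) q ^+ j.
  by apply: eq_bigr => j _; rewrite /q exprMn -!exprM ![(j * _)%N]mulnC.
have [ab|ab] := eqVneq a b.
  rewrite muln1 /q -ab -exprMn mulfV// expr1n.
  by under eq_bigr do rewrite expr1n; rewrite sumr_const card_ord.
have q1 : q != 1.
  apply: contra ab; rewrite /q /v exprVn => /eqP h; apply/eqP/w_inj => //.
  by rewrite -[LHS](mulfVK (expf_neq0 b w0)) h mul1r.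
apply: (mulfI (_ : q - 1 != 0)); first by rewrite subr_eq0.
rewrite -subrX1 muln0 mulr0 /q exprMn -!exprM ![(_ * M)%N]mulnC !exprM wM.
by rewrite exprVn wM invr1 !expr1n mulr1 subrr.
Qed.

Let sc (i : nat) : R[i] := (s ^+ i)%:C%C.
Let A (j : nat) := \sum_(i < K) sc i * w ^+ (j * i).
Let A' (j : nat) := \sum_(i < K) sc i * v ^+ (j * i).

Let A'E j : A' j = (A j)^*%C.
Proof.
rewrite /A' /A raddf_sum; apply: eq_bigr => i _.
rewrite [RHS](rmorphM (@conjc R)) (rmorphXn (@conjc R)) vE.
by congr (_ * _); exact/esym/conjc_real.
Qed.

Let ncA' j : nc (A' j) = nc (A j).
Proof. by rewrite A'E; case: (A j) => a b /=; rewrite sqrrN. Qed.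

Let AA' j : A j * A' j = (nc (A j) ^+ 2)%:C%C.
Proof.
rewrite A'E; case: (A j) => a b /=.
rewrite sqr_sqrtr ?addr_ge0 ?sqr_ge0//.
by rewrite /GRing.mul/= !expr2; congr Complex; ring.
Qed.

Let parseval : \sum_(j < M) nc (A j) ^+ 2 = M%:R * \sum_(i < K) (s ^+ 2) ^+ i.
Proof.
apply: (@complexI R); rewrite (rmorph_sum (real_complex R)).
under eq_bigr do rewrite /= -AA' /A /A' big_distrlr/=.
rewrite exchange_big/= rmorphM rmorph_sum mulr_sumr/=; apply: eq_bigr => i _.
rewrite exchange_big/=.
have iM : (i < M)%N by rewrite MK (leq_trans (ltn_ord i))// leq_addr.
rewrite (bigD1 i)//= [X in _ + X]big1 ?addr0; last first.
  move=> i' ii'; have i'M : (i' < M)%N by rewrite MK (leq_trans (ltn_ord i'))// leq_addr.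
  under eq_bigr do rewrite mulrACA; rewrite -mulr_sumr orthogonality//.
  by rewrite (_ : (i == i' :> nat) = false) ?muln0 ?mulr0// eq_sym; exact: negbTE.
under eq_bigr do rewrite mulrACA; rewrite -mulr_sumr orthogonality// eqxx muln1.
by rewrite mulrC rmorph_nat /sc -rmorphM/= -exprD addnn -mul2n exprM.
Qed.

Let geom : (1 - s ^+ 2) * \sum_(i < K) (s ^+ 2) ^+ i <= 1.
Proof.
rewrite -opprB mulNr -subrX1 opprB gerBl.
by rewrite exprn_ge0// sqr_ge0.
Qed.

Let s2 : 0 < 1 - s ^+ 2.
Proof. by rewrite subr_gt0 expr_lt1. Qed.

Let Mn0 : (M%:R : R[i]) != 0.
Proof. by rewrite pnatr_eq0 -lt0n expn_gt0. Qed.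

Let MR0 : 0 < (M%:R : R).
Proof. by rewrite ltr0n expn_gt0. Qed.

(* With P(u) the partial sum of sum (s u)^i, these are (1 - s^2) |P|^2, which has
   mean at most 1, and P^2, on the [M]-th roots of unity. *)
Definition poisson_kernel (r j : nat) : R[i] :=
  M%:R^-1 * (1 - s ^+ 2)%:C%C * (A j * A' j) * v ^+ (j * r).

Definition cauchy_kernel (j : nat) : R[i] := M%:R^-1 * (A' j * A' j) * v ^+ j.

Let ncv j : nc (v ^+ j) = 1.
Proof. by rewrite normcX Normc.normcV w1 invr1 expr1n. Qed.

Lemma poisson_kernel_norm r : \sum_(j < M) nc (poisson_kernel r j) <= 1.
Proof.
under eq_bigr do rewrite /poisson_kernel !Normc.normcM ncA' ncv mulr1 -expr2
  Normc.normcV normc_nat normc_real gtr0_norm//.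
rewrite -mulr_sumr parseval.
rewrite (_ : _ * _ = (1 - s ^+ 2) * \sum_(i < K) (s ^+ 2) ^+ i); first exact: geom.
by field; rewrite gt_eqF.
Qed.

Lemma cauchy_kernel_norm : \sum_(j < M) nc (cauchy_kernel j) <= (1 - s ^+ 2)^-1.
Proof.
under eq_bigr do rewrite /cauchy_kernel !Normc.normcM ncA' ncv mulr1 -expr2
  Normc.normcV normc_nat.
rewrite -mulr_sumr parseval mulKf ?gt_eqF//.
by rewrite -[leRHS]mul1r ler_pdivlMr// mulrC; exact: geom.
Qed.

(** Averaging over the nodes keeps, by orthogonality, just the pairs (i, i') whose exponents of w
    and of v = w^-1 agree. *)
Let kernel_expand (F : nat -> R[i]) (a b : nat -> nat -> nat) :
  (forall j, F j = \sum_(i < K) \sum_(i' < K)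
     sc i * sc i' * (w ^+ (j * a i i') * v ^+ (j * b i i'))) ->
  (forall i i', (i < K)%N -> (i' < K)%N -> (a i i' < M)%N /\ (b i i' < M)%N) ->
  M%:R^-1 * \sum_(j < M) F j =
  (\sum_(i < K) \sum_(i' < K) s ^+ (i + i') * (a i i' == b i i')%:R)%:C%C.
Proof.
move=> FE ab; apply: (mulfI Mn0); rewrite mulrA mulfV// mul1r.
under eq_bigr do rewrite FE.
rewrite exchange_big (rmorph_sum (real_complex R)) mulr_sumr/=; apply: eq_bigr => i _.
rewrite exchange_big (rmorph_sum (real_complex R)) mulr_sumr/=; apply: eq_bigr => i' _.
have [aM bM] := ab _ _ (ltn_ord i) (ltn_ord i').
rewrite -mulr_sumr orthogonality//.
by rewrite natrM rmorphM/= rmorph_nat exprD rmorphM/= mulrCA.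
Qed.

(** With e = d - r the surviving pairs are i' = i + e, i < K - e, and the geometric sum of s^(2 i +
    e) times 1 - s^2 is s^e up to the truncation term, which vanishes as n grows. *)
Lemma poisson_kernel_coef r d : (r <= 1)%N -> (r <= d)%N -> (d < K)%N ->
  \sum_(j < M) poisson_kernel r j * w ^+ (j * d) =
  (s ^+ (d - r) * (1 - s ^+ (2 * (K - (d - r)))))%:C%C.
Proof.
move=> r1 rd dK; set e := (d - r)%N; have eK : (e <= K)%N by rewrite (leq_trans (leq_subr _ _))// ltnW.
transitivity ((1 - s ^+ 2)%:C%C * (M%:R^-1 * \sum_(j < M) (A j * A' j * v ^+ (j * r) * w ^+ (j * d)))).
  by rewrite !mulr_sumr; apply: eq_bigr => j _; rewrite /poisson_kernel; ring.
rewrite (@kernel_expand (fun j => A j * A' j * v ^+ (j * r) * w ^+ (j * d))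
    (fun i _ => i + d)%N (fun _ i' => i' + r)%N); last 2 first.
- move=> j; rewrite big_distrlr/= mulr_suml mulr_suml; apply: eq_bigr => i _.
  rewrite mulr_suml mulr_suml; apply: eq_bigr => i' _.
  by rewrite !mulnDr !exprD; ring.
- move=> i i' iK i'K; rewrite MK -!addSn !leq_add// ?(leq_trans r1)//; exact: ltnW.
rewrite -rmorphM/=; congr (_%:C%C).
have -> : \sum_(i < K) \sum_(i' < K) s ^+ (i + i') * ((i + d)%N == (i' + r)%N)%:R =
    \sum_(i < K | (i < K - e)%N) s ^+ e * (s ^+ 2) ^+ i.
  rewrite [RHS]big_mkcond; apply: eq_bigr => i _.
  have E (i' : 'I_K) : ((i + d)%N == (i' + r)%N) = ((i' : nat) == (i + e)%N).
    by rewrite /e eq_sym -[RHS](eqn_add2r r) -addnA subnK.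
  rewrite ltn_subRL [(e + i)%N]addnC; case: ifPn => [ie|ie].
    rewrite (bigD1 (Ordinal ie))//= -[(i + e + r)%N]addnA subnK// eqxx mulr1 big1 ?addr0; last first.
      move=> i' /negbTE ii'; rewrite E (_ : ((i' : nat) == _) = (i' == Ordinal ie))// ii'.
      by rewrite mulr0.
    by rewrite -exprM -exprD; congr (_ ^+ _); rewrite addnA addnn mul2n addnC.
  rewrite big1// => i' _; rewrite E; case: eqP => [i'E|]; last by rewrite mulr0.
  by rewrite -i'E ltn_ord in ie.
rewrite -(big_ord_widen K (fun i => s ^+ e * (s ^+ 2) ^+ i)) ?leq_subr//.
rewrite -mulr_sumr mulrCA; congr (_ * _).
by rewrite -opprB mulNr -subrX1 opprB exprM.
Qed.

(** Exactly d pairs satisfy i + i' + 1 = d, each contributing s^(d - 1). All of them have indices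
    below [K], so there is no truncation term. *)
Lemma cauchy_kernel_coef d : (d < K)%N ->
  \sum_(j < M) cauchy_kernel j * w ^+ (j * d) = (d%:R * s ^+ d.-1)%:C%C.
Proof.
move=> dK; transitivity (M%:R^-1 * \sum_(j < M) (A' j * A' j * v ^+ j * w ^+ (j * d))).
  by rewrite mulr_sumr; apply: eq_bigr => j _; rewrite /cauchy_kernel !mulrA.
rewrite (@kernel_expand (fun j => A' j * A' j * v ^+ j * w ^+ (j * d))
    (fun _ _ => d) (fun i i' => (i + i').+1)); last 2 first.
- move=> j; rewrite big_distrlr/= mulr_suml mulr_suml; apply: eq_bigr => i _.
  rewrite mulr_suml mulr_suml; apply: eq_bigr => i' _.
  rewrite mulnS mulnDr !exprD.
  move: (sc i) (sc i') (w ^+ (j * d)) (v ^+ j) (v ^+ (j * i)) (v ^+ (j * i')) => ? ? ? ? ? ?.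
  by ring.
- move=> i i' iK i'K; split; first by rewrite MK (leq_trans dK)// leq_addr.
  by rewrite MK -addSn -addnS leq_add.
congr (_%:C%C).
transitivity (\sum_(i < K | (i < d)%N) s ^+ d.-1).
  rewrite [RHS]big_mkcond; apply: eq_bigr => i _; case: ifPn => [id|].
    have i'K : (d.-1 - i < K)%N.
      by rewrite (leq_ltn_trans (leq_subr _ _))// (leq_ltn_trans (leq_pred _)).
    have d0 : (0 < d)%N by exact: leq_ltn_trans id.
    have idP : (i <= d.-1)%N by rewrite -ltnS prednK.
    rewrite (bigD1 (Ordinal i'K))//= subnKC// prednK// eqxx mulr1 big1 ?addr0// => i' ii'.
    rewrite (_ : (d == _) = false) ?mulr0//; apply/eqP => dE.
    move/eqP: ii'; apply; apply/val_inj => /=.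
    by rewrite dE/= addKn.
  rewrite -leqNgt => di; rewrite big1// => i' _.
  by rewrite (_ : (d == _) = false) ?mulr0//; apply/eqP => dE; move: di; rewrite dE ltnNge leq_addr.
have dK' : (d <= K)%N by exact: ltnW.
rewrite -(@big_ord_widen _ _ _ d K (fun=> s ^+ d.-1) dK').
by rewrite sumr_const card_ord mulr_natl.
Qed.

End kernels.
End roots_of_unity.

Section torus_estimates.
Context (R : realType) (N : nat) (p : R) (p1 : 1 <= p).
Local Notation nc := (@Normc.normc R).
Implicit Types (c : mindex N -> R[i]) (x : N.-tuple R) (S : pred 'I_N) (s : R).

(** The case r = 1 is for series with no term of degree 0 in [S]: one power of s is saved, as if a
    variable had been divided out before the dilation. For such series the truncated subtraction in
    the exponent is a true one wherever it matters. *)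
Lemma torus_mean_shifted_contraction S (r : nat) c x s :
  0 <= s <= 1 -> (r <= 1)%N -> (forall al, (sdeg S al < r)%N -> c al = 0) ->
  (forall i, 0 <= tnth x i) -> rsummable c x ->
  (torus_mean (pow_norm p (fun al => (s ^+ (sdeg S al - r))%:C%C * c al)%R) x <=
   torus_mean (pow_norm p c) x)%E.
Proof.
move=> /andP[s0]; rewrite le_eqVlt => /predU1P[->|s1] r1 cr x0 sx.
  rewrite (_ : (fun al => _) = c)//.
  by apply/funext => al; rewrite expr1n mul1r.
have [w wP] := boolp.choice (@root_of_unity_exists R).
have := @torus_mean_multiplier R N p p1 S c
  (fun al => (s ^+ (sdeg S al - r))%:C%C * c al) x (fun n => 2 ^ n.+1)%N w
  (fun n => @poisson_kernel R n (w n) s r) 1 x0 sx (fun n => and3_rec (fun a _ _ => a) (wP n)).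
rewrite powR1 mul1e; apply.
  by move=> n; have [? ? ?] := wP n; exact: poisson_kernel_norm.
move=> al; set d := sdeg S al.
have [dr|rd] := ltnP d r.
  rewrite cr//; under eq_fun do rewrite !mulr0 subr0 Normc.normc0.
  exact: cvg_cst.
apply/cvgrPdist_le => e e0.
have /cvgrPdist_le/(_ (e / (nc (c al) + 1))) : s ^+ n @[n --> \oo] --> (0 : R).
  by apply: cvg_expr; rewrite ger0_norm.
have c1 : 0 < nc (c al) + 1 by rewrite ltr_wpDl ?normc_ge0.
move=> /(_ (divr_gt0 e0 c1)) [n0 _ H].
exists (maxn n0 d) => // n /=; rewrite geq_max => /andP[n0n dn].
have dK : (d < 2 ^ n)%N by rewrite (leq_ltn_trans dn)// ltn_expl.
have [? ? ?] := wP n; rewrite poisson_kernel_coef// -mulrBl -rmorphB/=.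
rewrite sub0r normrN ger0_norm ?normc_ge0// Normc.normcM normc_real.
rewrite mulrBr mulr1 addrAC subrr sub0r normrN -exprD ger0_norm ?exprn_ge0//.
apply: (@le_trans _ _ (e / (nc (c al) + 1) * (nc (c al) + 1))); last by rewrite divfK// gt_eqF.
apply: ler_pM; rewrite ?exprn_ge0 ?normc_ge0//; last by rewrite lerDl.
have := H n n0n; rewrite /= sub0r normrN ger0_norm ?exprn_ge0//; apply: le_trans.
(* The exponent (d - r) + 2 (K - (d - r)) with K = 2^n is at least K, hence at least n. *)
apply: ler_wiXn2l => //; first exact: ltW.
have eK : (d - r <= 2 ^ n)%N by rewrite (leq_trans (leq_subr _ _))// ltnW.
rewrite mul2n -addnn addnA subnKC//.
exact: leq_trans (ltnW (ltn_expl n (isT : 1 < 2)%N)) (leq_addr _ _).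
Qed.

Lemma torus_mean_contraction S c x s : 0 <= s <= 1 ->
  (forall i, 0 <= tnth x i) -> rsummable c x ->
  (torus_mean (pow_norm p (fun al => (s ^+ sdeg S al)%:C%C * c al)%R) x <=
   torus_mean (pow_norm p c) x)%E.
Proof.
move=> s01 x0 sx; under eq_fun do rewrite -[sdeg S _]subn0.
exact: torus_mean_shifted_contraction.
Qed.

Lemma torus_mean_cauchy S c x s : 0 <= s < 1 ->
  (forall i, 0 <= tnth x i) -> rsummable c x ->
  (torus_mean (pow_norm p (fun al => ((sdeg S al)%:R * s ^+ (sdeg S al).-1)%:C%C * c al)%R) x <=
   (((1 - s ^+ 2)^-1) `^ p)%:E * torus_mean (pow_norm p c) x)%E.
Proof.
move=> /andP[s0 s1] x0 sx.
have [w wP] := boolp.choice (@root_of_unity_exists R).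
apply: (@torus_mean_multiplier R N p p1 S c _ x (fun n => 2 ^ n.+1)%N w
  (fun n => @cauchy_kernel R n (w n) s)) => //.
- by move=> n; have [] := wP n.
- by move=> n; have [? ? ?] := wP n; exact: cauchy_kernel_norm.
move=> al; set d := sdeg S al; apply/cvgrPdist_le => e e0.
exists d => // n /= dn; have dK : (d < 2 ^ n)%N by rewrite (leq_ltn_trans dn)// ltn_expl.
have [? ? ?] := wP n; rewrite cauchy_kernel_coef// subrr Normc.normc0 subrr normr0.
exact: ltW.
Qed.

End torus_estimates.

(** * Means as functions of one radius *)

Section radius_change.
Context (R : realType) (N : nat).
Local Notation nc := (@Normc.normc R).
Local Notation plane := (measurableTypeR R * measurableTypeR R)%type.
Implicit Types (c : mindex N -> R[i]) (x : N.-tuple R) (k : 'I_N) (r : R).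

Lemma tnth_tset n d (T : measurableType d) (t : n.-tuple T) j y i :
  tnth (tset t j y) i = if i == j then y else tnth t i.
Proof. by rewrite tnth_mktuple. Qed.

Lemma tset_ge0 x k r : (forall i, 0 <= tnth x i) -> 0 <= r ->
  forall i, 0 <= tnth (tset x k r) i.
Proof. by move=> x0 r0 i; rewrite tnth_tset; case: ifP. Qed.

Lemma tsetK x k : tset x k (tnth x k) = x.
Proof. by apply: eq_from_tnth => i; rewrite tnth_tset; case: eqP => // ->. Qed.

Lemma tset_tset x k r r' : tset (tset x k r) k r' = tset x k r'.
Proof. by apply: eq_from_tnth => i; rewrite !tnth_tset; case: (i == k). Qed.

Definition rmonomial' k (al : mindex N) x : R := \prod_(i | i != k) tnth x i ^+ al i.

Lemma rmonomial_tset al x k r :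
  rmonomial al (tset x k r) = r ^+ al k * rmonomial' k al x.
Proof.
rewrite /rmonomial (bigD1 k)//= tnth_tset eqxx; congr (_ * _).
by apply: eq_bigr => i /negbTE ik; rewrite tnth_tset ik.
Qed.

Lemma rmonomial'_ge0 k al x : (forall i, 0 <= tnth x i) -> 0 <= rmonomial' k al x.
Proof. by move=> x0; apply: prodr_ge0 => i _; exact: exprn_ge0. Qed.

Lemma pow_norm_eq p c c' (t t' : N.-tuple plane) : term c t = term c' t' ->
  pow_norm p c t = pow_norm p c' t'.
Proof. by move=> E; rewrite /pow_norm E. Qed.

(** The k-th radius enters the mean through the products c_al r^(al_k) alone, so a change of that
    radius is a multiplier of the coefficients, to which the kernel estimates apply. *)
Lemma torus_mean_tset p c c' x k r r' :
  (forall al, c al * (r ^+ al k)%:C%C = c' al * (r' ^+ al k)%:C%C) ->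
  torus_mean (pow_norm p c) (tset x k r) = torus_mean (pow_norm p c') (tset x k r').
Proof.
move=> cc'; apply: eq_integral => s _; apply: pow_norm_eq; apply/funext => al.
have mE a : monomial al (cvec (tpolar (tset x k a) s)) =
    (a ^+ al k)%:C%C * \prod_i (if i == k then Complex (phase (tnth s i)).1 (phase (tnth s i)).2
       else Complex (tnth x i * (phase (tnth s i)).1) (tnth x i * (phase (tnth s i)).2)) ^+ al i.
  rewrite /monomial (bigD1 k)//= [in RHS](bigD1 k)//= eqxx mulrA; congr (_ * _).
    rewrite !mxE !tnth_mktuple eqxx/= (rmorphXn (real_complex R)) -exprMn; congr (_ ^+ _).
    by rewrite /GRing.mul/= !mul0r subr0 addr0.
  by apply: eq_bigr => i /negbTE ik; rewrite !mxE !tnth_mktuple ik.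
by rewrite /term !mE !mulrA cc'.
Qed.

Lemma torus_mean_scale p c x (z : R[i]) : 0 < p -> (forall i, 0 <= tnth x i) ->
  rsummable c x ->
  torus_mean (pow_norm p (fun al => z * c al)) x =
  ((nc z `^ p)%:E * torus_mean (pow_norm p c) x)%E.
Proof.
move=> p0 x0 sx; rewrite /torus_mean -ge0_integralZl//; first last.
- by rewrite lee_fin powR_ge0.
- by move=> s _; exact: pow_norm_ge0.
- apply: measurable_funTS; apply: (measurableT_comp (measurable_pow_norm p c)).
  exact: measurable_tpolar.
- exact: measurable_pdisc.
apply: eq_integral => s _.
have h : csummable (term c (tpolar x s)) by apply: csummable_term; rewrite tnorm_tpolar.
have E : term (fun al => z * c al) (tpolar x s) = fun al => z * term c (tpolar x s) al.
  by apply/funext => al; rewrite /term mulrA.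
have hz : csummable (term (fun al => z * c al) (tpolar x s)).
  by rewrite E; exact: csummableZ.
by rewrite !pow_normE// E csumZ// Normc.normcM powRM ?normc_ge0// EFinM.
Qed.

Lemma rsummable_le c c' x B : (forall i, 0 <= tnth x i) -> 0 <= B ->
  (forall al, nc (c' al) <= B * nc (c al)) ->
  rsummable c x -> rsummable c' x.
Proof.
move=> x0 B0 cB [C CB]; exists (B * C) => A.
apply: (@le_trans _ _ (B * \sum_(i <- A) nc (c i) * rmonomial i x)).
  rewrite mulr_sumr; apply: ler_sum => al _; rewrite mulrA.
  by apply: ler_wpM2r; [exact: rmonomial_ge0|exact: cB].
by apply: ler_wpM2l => //; exact: CB.
Qed.

Lemma sdeg1 k (al : mindex N) : sdeg (pred1 k) al = al k.
Proof. by rewrite /sdeg big_pred1_eq. Qed.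

(** Each of the l terms 1, s, ..., s^(l - 1) of the geometric sum is at least s^l. *)
Lemma natmul_expr_le (s : R) l : 0 <= s < 1 -> l%:R * s ^+ l <= (1 - s)^-1.
Proof.
move=> /andP[s0 s1]; have s1' : 0 < 1 - s by rewrite subr_gt0.
apply: (@le_trans _ _ (\sum_(i < l) s ^+ i)).
  rewrite mulr_natl -[l in _ *+ l]card_ord -sumr_const; apply: ler_sum => i _.
  by apply: ler_wiXn2l; [exact: s0|exact: ltW|exact/ltnW/ltn_ord].
rewrite -[leRHS]mul1r ler_pdivlMr// mulrC -opprB mulNr -subrX1 opprB gerBl.
exact: exprn_ge0.
Qed.

Definition dcoef k c : mindex N -> R[i] := fun al => (al k)%:R * c al.

Lemma rsummable_dcoef c x k r r' : (forall i, 0 <= tnth x i) -> 0 <= r < r' ->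
  rsummable c (tset x k r') -> rsummable (dcoef k c) (tset x k r).
Proof.
move=> x0 /andP[r0 rr'] [C CB]; have r'0 : 0 < r' := le_lt_trans r0 rr'.
have s01 : 0 <= r / r' < 1 by rewrite divr_ge0 ?(ltW r'0)//= ltr_pdivrMr// mul1r.
exists ((1 - r / r')^-1 * C) => A.
apply: (@le_trans _ _ ((1 - r / r')^-1 * \sum_(i <- A) nc (c i) * rmonomial i (tset x k r'))).
  rewrite mulr_sumr; apply: ler_sum => al _; rewrite /dcoef Normc.normcM normc_nat.
  have rE : r ^+ al k = (r / r') ^+ al k * r' ^+ al k by rewrite -exprMn divfK// gt_eqF.
  rewrite !rmonomial_tset rE.
  have := natmul_expr_le (al k) s01.
  have h0 : 0 <= nc (c al) * (r' ^+ al k * rmonomial' k al x).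
    by rewrite !mulr_ge0 ?normc_ge0 ?rmonomial'_ge0 ?exprn_ge0// ltW.
  move=> /(ler_wpM2r h0); apply: le_trans; rewrite le_eqVlt; apply/orP; left; apply/eqP; ring.
by apply: ler_wpM2l => //; rewrite invr_ge0 subr_ge0 ltW//; case/andP: s01.
Qed.

Section radial_estimates.
Variables (p : R) (p1 : 1 <= p) (k : 'I_N).
Let p0 : 0 < p. Proof. by move: p1; lra. Qed.

Definition radial_mean c x r : \bar R := torus_mean (pow_norm p c) (tset x k r).

(* The mean of the derivative in the k-th variable; 0 at [r = 0], as 0^-1 = 0. *)
Definition radial_dmean c x r : \bar R :=
  ((r^-1 `^ p)%:E * radial_mean (dcoef k c) x r)%E.

Lemma radial_mean_ge0 c x r : (0 <= radial_mean c x r)%E.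
Proof. by apply: torus_mean_ge0 => t; exact: pow_norm_ge0. Qed.

Lemma radial_dmean_ge0 c x r : (0 <= radial_dmean c x r)%E.
Proof. by rewrite mule_ge0 ?radial_mean_ge0// lee_fin powR_ge0. Qed.

Let ratio r r' : 0 < r' -> r' * (r / r') = r.
Proof. by move=> r'0; rewrite mulrC divfK// gt_eqF. Qed.

Lemma le_radial_mean c x r r' : (forall i, 0 <= tnth x i) -> 0 <= r <= r' ->
  rsummable c (tset x k r') -> (radial_mean c x r <= radial_mean c x r')%E.
Proof.
move=> x0 /andP[r0]; rewrite le_eqVlt => /predU1P[->//|rr'] sc.
have r'0 : 0 < r' := le_lt_trans r0 rr'.
have s01 : 0 <= r / r' <= 1.
  by rewrite divr_ge0 ?(ltW r'0)//= ler_pdivrMr// mul1r ltW.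
have := torus_mean_contraction p1 (pred1 k) s01 (tset_ge0 k x0 (ltW r'0)) sc.
apply: le_trans; rewrite le_eqVlt; apply/orP; left; apply/eqP.
apply: torus_mean_tset => al; rewrite sdeg1 mulrAC mulrC -rmorphM/= -exprMn.
by rewrite mulrC divfK ?gt_eqF// mulrC.
Qed.

Let powR_rescale r r' (T : \bar R) : 0 < r -> 0 < r' ->
  ((r^-1 `^ p)%:E * ((nc (r / r')%:C%C `^ p)%:E * T) = (r'^-1 `^ p)%:E * T)%E.
Proof.
move=> r0 r'0; rewrite normc_real ger0_norm ?divr_ge0 ?ltW// muleA -EFinM.
rewrite -powRM ?invr_ge0 ?divr_ge0 ?ltW//.
by congr ((_ `^ p)%:E * _)%E; field; rewrite !gt_eqF.
Qed.

Let powR_combine (u v w : R) (T : \bar R) : 0 <= u -> 0 <= v -> u * v <= w ->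
  (0 <= T -> (u `^ p)%:E * ((v `^ p)%:E * T) <= (w `^ p)%:E * T)%E.
Proof.
move=> u0 v0 uvw T0; rewrite muleA -EFinM -powRM//; apply: lee_wpmul2r => //.
rewrite lee_fin; apply: ge0_ler_powR; rewrite ?nnegrE ?mulr_ge0 ?(ltW p0)//.
by apply: le_trans uvw; rewrite mulr_ge0.
Qed.

Let diff_ratio_sq r r' : r' != 0 -> r' * (1 - (r / r') ^+ 2) = (r' - r) * (1 + r / r').
Proof. by move=> r'0; field. Qed.

(** The series with coefficients al_k c_al is divisible by the k-th variable, so the contraction
    applies with shift 1; the saved factor r / r' is what the division by r^p in [radial_dmean]
    calls for. *)
Lemma le_radial_dmean c x r r' : (forall i, 0 <= tnth x i) -> 0 < r <= r' ->
  rsummable (dcoef k c) (tset x k r') -> (radial_dmean c x r <= radial_dmean c x r')%E.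
Proof.
move=> x0 /andP[r0 rr'] sc.
have r'0 : 0 < r' := lt_le_trans r0 rr'.
have s01 : 0 <= r / r' <= 1.
  by rewrite divr_ge0 ?(ltW r'0) ?(ltW r0)//= ler_pdivrMr// mul1r.
have dz al : (sdeg (pred1 k) al < 1)%N -> dcoef k c al = 0.
  by rewrite sdeg1 ltnS leqn0 /dcoef => /eqP ->; rewrite mul0r.
have := torus_mean_shifted_contraction p1 s01 (leqnn 1) dz (tset_ge0 k x0 (ltW r'0)) sc.
rewrite /radial_dmean => h.
have sc' : rsummable (fun al => ((r / r') ^+ (sdeg (pred1 k) al - 1))%:C%C * dcoef k c al) (tset x k r').
  apply: (rsummable_le (B := 1)) sc => //; first exact: tset_ge0 (ltW r'0).
  move=> al; rewrite Normc.normcM normc_real; apply: ler_wpM2r; first exact: normc_ge0.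
  by case/andP: s01 => ? ?; rewrite ger0_norm ?exprn_ge0// exprn_ile1.
have : ((r'^-1 `^ p)%:E * torus_mean (pow_norm p (fun al => ((r / r') ^+ (sdeg (pred1 k) al - 1))%:C%C * dcoef k c al)%R) (tset x k r') <=
   (r'^-1 `^ p)%:E * radial_mean (dcoef k c) x r')%E.
  by apply: lee_wpmul2l => //; rewrite lee_fin powR_ge0.
apply: le_trans; rewrite le_eqVlt; apply/orP; left; apply/eqP.
have E : radial_mean (dcoef k c) x r =
    torus_mean (pow_norm p (fun al => (r / r')%:C%C * (((r / r') ^+ (sdeg (pred1 k) al - 1))%:C%C * dcoef k c al))%R) (tset x k r').
  apply: torus_mean_tset => al; rewrite sdeg1 mulrA -rmorphM/= -exprS.
  case E : (al k) => [|l]; first by rewrite /dcoef E mul0r mulr0 !mul0r.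
  have -> : r ^+ l.+1 = (r / r') ^+ l.+1 * r' ^+ l.+1.
    by rewrite -exprMn divfK// gt_eqF.
  by rewrite subn1/= rmorphM/= mulrA [dcoef k c al * _]mulrC.
rewrite (etrans E (torus_mean_scale (r / r')%:C%C p0 (tset_ge0 k x0 (ltW r'0)) sc')).
exact: powR_rescale.
Qed.

(** The Cauchy kernel at s = r / r' gives the constant 1 / (r' (1 - s^2)), and r' (1 - s^2) = (r' -
    r) (1 + s) is at least r' - r. *)
Lemma radial_dmean_cauchy c x r r' : (forall i, 0 <= tnth x i) -> 0 < r < r' ->
  rsummable c (tset x k r') ->
  (radial_dmean c x r <= ((r' - r)^-1 `^ p)%:E * radial_mean c x r')%E.
Proof.
move=> x0 /andP[r0 rr'] sc.
have r'0 : 0 < r' := lt_trans r0 rr'.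
have s01 : 0 <= r / r' < 1.
  by rewrite divr_ge0 ?(ltW r'0) ?(ltW r0)//= ltr_pdivrMr// mul1r.
have B0 : 0 <= (1 - (r / r'))^-1 * (r' / r).
  apply: mulr_ge0; last by rewrite divr_ge0// ltW.
  by rewrite invr_ge0 subr_ge0; case/andP: s01 => _ /ltW.
have s2 : 0 < 1 - (r / r') ^+ 2.
  by case/andP: s01 => ? ?; rewrite subr_gt0 expr_lt1.
have := torus_mean_cauchy p1 (pred1 k) s01 (tset_ge0 k x0 (ltW r'0)) sc.
pose c1 := fun al : mindex N => ((sdeg (pred1 k) al)%:R * (r / r') ^+ (sdeg (pred1 k) al).-1)%:C%C * c al.
rewrite -/c1 => h.
have sc1 : rsummable c1 (tset x k r').
  have := sc; apply: (rsummable_le (B := (1 - (r / r'))^-1 * (r' / r))).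
  - exact: tset_ge0 (ltW r'0).
  - exact: B0.
  move=> al; rewrite Normc.normcM normc_real; apply: ler_wpM2r; first exact: normc_ge0.
  rewrite sdeg1 ger0_norm ?mulr_ge0 ?exprn_ge0//; last by case/andP: s01.
  case E : (al k) => [|l]; first by rewrite mul0r; exact: B0.
  have := natmul_expr_le l.+1 s01; rewrite exprS => h2.
  have rr1 : r' / r * (r / r') = 1 by field; rewrite !gt_eqF.
  rewrite -(@ler_pM2r _ (r / r')) ?divr_gt0//.
  by rewrite -[leRHS]mulrA rr1 mulr1 -mulrA [_ ^+ l * _]mulrC.
have E : radial_mean (dcoef k c) x r =
    torus_mean (pow_norm p (fun al => (r / r')%:C%C * c1 al)) (tset x k r').
  apply: torus_mean_tset => al; rewrite /c1 sdeg1 /dcoef.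
  case E : (al k) => [|l]; first by rewrite !mul0r mulr0 !mul0r.
  have -> : (l.+1%:R * (r / r') ^+ l.+1.-1)%:C%C = l.+1%:R * ((r / r') ^+ l)%:C%C.
    by rewrite rmorphM rmorph_nat.
  have -> : r ^+ l.+1 = (r / r') * ((r / r') ^+ l * r' ^+ l.+1).
    by rewrite mulrA -exprS -exprMn divfK// gt_eqF.
  by rewrite !rmorphM/=; ring.
have -> : radial_dmean c x r = ((r'^-1 `^ p)%:E * torus_mean (pow_norm p c1) (tset x k r'))%E.
  rewrite /radial_dmean.
  rewrite (etrans E (torus_mean_scale (r / r')%:C%C p0 (tset_ge0 k x0 (ltW r'0)) sc1)).
  exact: powR_rescale.
apply: le_trans (lee_wpmul2l _ h) _; first by rewrite lee_fin powR_ge0.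
clear h E sc1.
apply: (@powR_combine _ _ _ (radial_mean c x r')).
- by rewrite invr_ge0 ltW.
- by rewrite invr_ge0 ltW.
- have d0 : 0 < r' - r by rewrite subr_gt0.
  have -> : r'^-1 * (1 - (r / r') ^+ 2)^-1 = (r' * (1 - (r / r') ^+ 2))^-1.
    by rewrite invfM.
  rewrite lef_pV2; [|by rewrite posrE mulr_gt0|by rewrite posrE].
  rewrite diff_ratio_sq ?gt_eqF//.
  by rewrite ler_peMr ?(ltW d0)// lerDl; case/andP: s01.
- exact: radial_mean_ge0.
Qed.

End radial_estimates.

End radius_change.

Section averaged_coefficients.
Context (R : realType) (N : nat) (p : R) (p1 : 1 <= p).
Local Notation nc := (@Normc.normc R).
Local Notation lamN := (lebesgue_cvec R N).
Implicit Types (c : mindex N -> R[i]) (x : N.-tuple R) (k : 'I_N).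
Let p0 : 0 < p. Proof. by move: p1; lra. Qed.

(* Jensen's inequality for the weights [u j * v j] and the values [c_ j / v j]. *)
Lemma torus_mean_jensen (I : Type) (r : seq I) (u v : I -> R) (c_ : I -> mindex N -> R[i]) x :
  (forall i, 0 <= tnth x i) -> (forall j, 0 <= u j) -> (forall j, 0 < v j) ->
  (forall j, rsummable (c_ j) x) ->
  (torus_mean (pow_norm p (fun al => \sum_(j <- r) (u j)%:C%C * c_ j al)%R) x <=
   ((\sum_(j <- r) u j * v j) `^ (p - 1))%:E *
     \sum_(j <- r) ((u j * v j `^ (1 - p))%:E * torus_mean (pow_norm p (c_ j)) x))%E.
Proof.
move=> x0 u0 v0 sx; set A := \sum_(j <- r) _.
have tE s : tnorm (tpolar x s) = x by exact: tnorm_tpolar.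
have mT c : measurable_fun setT (fun s => pow_norm p c (tpolar x s)).
  by apply: (measurableT_comp (measurable_pow_norm p c)); exact: measurable_tpolar.
have uv0 j : (0%E <= (u j * v j `^ (1 - p))%:E)%E by rewrite lee_fin mulr_ge0 ?powR_ge0.
rewrite /torus_mean.
under eq_bigr => j _.
  rewrite -ge0_integralZl//; last 3 first.
  - exact: measurable_pdisc.
  - by apply: measurable_funTS; exact: mT.
  - by move=> s _; exact: pow_norm_ge0.
  over.
rewrite -ge0_integral_sum//; last 3 first.
- exact: measurable_pdisc.
- by move=> j; apply: measurable_funTS; apply: measurable_funeM; exact: mT.
- by move=> j s _; rewrite mule_ge0//; exact: pow_norm_ge0.
rewrite -ge0_integralZl//; last 4 first.
- exact: measurable_pdisc.
- by apply: measurable_funTS; apply: emeasurable_sum => j; apply: measurable_funeM; exact: mT.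
- by move=> s _; apply: sume_ge0 => j _; rewrite mule_ge0//; exact: pow_norm_ge0.
- by rewrite lee_fin powR_ge0.
apply: ge0_le_integral => //.
- exact: measurable_pdisc.
- by move=> s _; exact: pow_norm_ge0.
- by apply: measurable_funTS; exact: mT.
- apply: measurable_funTS; apply: measurable_funeM; apply: emeasurable_sum => j.
  by apply: measurable_funeM; exact: mT.
move=> s _.
have cs j : csummable (term (c_ j) (tpolar x s)) by apply: csummable_term; rewrite tE.
have [h1 h2] := csum_sum r (fun j => (u j)%:C%C) cs.
have E : term (fun al => \sum_(j <- r) (u j)%:C%C * c_ j al) (tpolar x s) =
    (fun al => \sum_(j <- r) (u j)%:C%C * term (c_ j) (tpolar x s) al).
  by apply/funext => al; rewrite /term mulr_suml; apply: eq_bigr => j _; rewrite mulrA.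
rewrite pow_normE ?E// h2.
under [in leRHS]eq_bigr do rewrite pow_normE// -EFinM.
rewrite sumEFin -EFinM lee_fin.
have uE j z : nc ((u j)%:C%C * z) = u j * v j * (nc z / v j).
  by rewrite Normc.normcM normc_real ger0_norm//; field; rewrite gt_eqF.
have pE j (y : R) : 0 <= y -> u j * v j * (y / v j) `^ p = u j * v j `^ (1 - p) * y `^ p.
  move=> y0; rewrite powRM ?invr_ge0 ?(ltW (v0 j))//.
  rewrite (_ : v j `^ (1 - p) = v j * (v j)^-1 `^ p); first by ring.
  rewrite powRB; last by apply/implyP => _; rewrite gt_eqF.
  by rewrite powRr1 ?(ltW (v0 j))// -(powR_inv1 (ltW (v0 j))) -powRrM mulN1r powRN.
apply: le_trans (_ : (\sum_(j <- r) u j * v j * (nc (csum (term (c_ j) (tpolar x s))) / v j)) `^ p <= _).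
  apply: ge0_ler_powR; [exact: ltW|by rewrite nnegrE normc_ge0| |].
    by rewrite nnegrE; apply: sumr_ge0 => j _; rewrite -uE normc_ge0.
  by apply: le_trans (normc_sum _ _ _) _; apply: ler_sum => j _; rewrite uE.
apply: le_trans (jensen_powR r p1 _ _) _.
- by move=> j; rewrite mulr_ge0// ltW.
- by move=> j; rewrite divr_ge0 ?normc_ge0// ltW.
apply: ler_wpM2l; first exact: powR_ge0.
by apply: ler_sum => j _; rewrite pE// normc_ge0.
Qed.

(** The term n (i + 1)^(n - 1) lies between the increments of the n-th power on [i, i + 1] and on
    [i + 1, i + 2]; both telescope. *)
Lemma riemann_sum_le (n L : nat) : (0 < n)%N ->
  (L%:R / L.+1%:R) ^+ n / n%:R <=
  (L.+1%:R^-1 : R) * \sum_(i < L) (i.+1%:R / L.+1%:R) ^+ n.-1 <= (n%:R^-1 : R).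
Proof.
case: n => // n _ /=.
have n0 : 0 < n.+1%:R :> R by rewrite ltr0n.
have step (i : nat) : i.+1%:R ^+ n.+1 - i%:R ^+ n.+1 <= n.+1%:R * i.+1%:R ^+ n :> R.
  rewrite subrXX -natrB// subSnn mul1r mulr_natl -[n.+1 in leRHS]card_ord -sumr_const.
  apply: ler_sum => j _.
  have jn : (j <= n)%N by rewrite -ltnS.
  rewrite [X in _ <= _ ^+ X](esym (subnK jn)) exprD /=; apply: ler_wpM2l => //.
  by apply: lerXn2r; rewrite ?nnegrE ?ler0n// ler_nat.
have step' (i : nat) : n.+1%:R * i.+1%:R ^+ n <= i.+2%:R ^+ n.+1 - i.+1%:R ^+ n.+1 :> R.
  rewrite subrXX -natrB// subSnn mul1r mulr_natl -[n.+1 in leLHS]card_ord -sumr_const.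
  apply: ler_sum => j _.
  have jn : (j <= n)%N by rewrite -ltnS.
  rewrite [X in _ ^+ X <= _](esym (subnK jn)) exprD /=; apply: ler_wpM2r => //.
  by apply: lerXn2r; rewrite ?nnegrE ?ler0n// ler_nat.
have L1 : 0 < L.+1%:R :> R by rewrite ltr0n.
have -> : L.+1%:R^-1 * \sum_(i < L) (i.+1%:R / L.+1%:R) ^+ n =
    (L.+1%:R ^+ n.+1)^-1 * \sum_(i < L) i.+1%:R ^+ n :> R.
  rewrite exprS invfM -mulrA; congr (_ * _); rewrite mulr_sumr; apply: eq_bigr => i _.
  by rewrite exprMn mulrC exprVn.
have tel (F : nat -> R) : \sum_(i < L) (F i.+1 - F i) = F L - F 0%N.
  by rewrite -(big_mkord xpredT (fun i => F i.+1 - F i)) telescope_sumr.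
have := tel (fun i => i%:R ^+ n.+1); rewrite expr0n subr0 => t1.
have := tel (fun i => i.+1%:R ^+ n.+1); rewrite expr1n => t2.
have P : 0 < (L.+1%:R ^+ n.+1 : R) by rewrite exprn_gt0.
apply/andP; split.
  rewrite ler_pdivrMr// exprMn exprVn mulrC -mulrA; apply: ler_wpM2l.
    by rewrite invr_ge0 ltW.
  by rewrite -t1 mulrC mulr_sumr; apply: ler_sum => i _; exact: step.
rewrite -(@ler_pM2l _ (L.+1%:R ^+ n.+1))// mulrA divff ?gt_eqF// mul1r ler_pdivlMr//.
apply: (@le_trans _ _ (L.+1%:R ^+ n.+1 - 1)); last by rewrite gerBl.
by rewrite -t2 mulrC mulr_sumr; apply: ler_sum => i _; exact: step'.
Qed.

Lemma cvg_riemann_sum (n : nat) : (0 < n)%N ->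
  (L.+1%:R^-1 : R) * (\sum_(i < L) (i.+1%:R / L.+1%:R) ^+ n.-1) @[L --> \oo] --> (n%:R^-1 : R).
Proof.
move=> n0.
apply: (squeeze_cvgr (f := fun L => (L%:R / L.+1%:R) ^+ n / n%:R) (h := fun=> n%:R^-1)).
- by near=> L; exact: riemann_sum_le.
- have h : (L%:R / L.+1%:R : R) @[L --> \oo] --> (1 : R).
    rewrite (_ : (fun L => _) = (fun L : nat => 1 - L.+1%:R^-1)); last first.
      apply/funext => L; have L1 : L.+1%:R != 0 :> R by rewrite pnatr_eq0.
      by rewrite -natr1 in L1 *; field.
    rewrite -[X in _ --> X]subr0; apply: cvgB; first exact: cvg_cst.
    exact: cvg_harmonic.
  have := cvg_comp _ _ h (@exprn_continuous R n 1); rewrite expr1n => h2.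
  by have h3 := cvgMr_tmp (b := n%:R^-1) h2; rewrite mul1r in h3; exact: h3.
- exact: cvg_cst.
Unshelve. all: by end_near. Qed.

End averaged_coefficients.

Section riemann_lower_sum.
Context (R : realType).
Local Notation mu := (@lebesgue_measure R).

(** Each node is the left end of its interval, where a nondecreasing function is smallest. The [L]
    nodes of mesh 1 / (L + 1) avoid the ends 0 and 1, as monotonicity is known inside ]0, 1[
    only. *)
Lemma riemann_lower_sum_le (phi : R -> \bar R) (L : nat) :
  measurable_fun setT phi -> (forall t, 0 <= phi t)%E ->
  (forall s t, 0 < s -> s <= t -> t < 1 -> (phi s <= phi t)%E) ->
  (\sum_(i < L) (L.+1%:R^-1)%:E * phi (i.+1%:R / L.+1%:R)%R <=
   \int[mu]_(t in `]0%R, 1%R[) phi t)%E.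
Proof.
move=> mphi phi0 ndphi.
pose s (n : nat) : R := n.+1%:R / L.+1%:R.
have L1 : 0 < L.+1%:R :> R by rewrite ltr0n.
have s0 n : 0 < s n by rewrite divr_gt0 ?ltr0n.
have sS n : s n.+1 - s n = L.+1%:R^-1.
  by rewrite /s -mulrBl -natrB// subSnn mul1r.
have sSlt n : s n < s n.+1 by rewrite -subr_gt0 sS invr_gt0.
have s_le n : s 0%N <= s n by elim: n => // n /le_trans; apply; exact: ltW.
have H n : (n <= L)%N -> (\sum_(i < n) (L.+1%:R^-1)%:E * phi (s i) <=
    \int[mu]_(t in `[s 0%N, s n[) phi t)%E.
  elim: n => [_|n ih nL]; first by rewrite big_ord0 integral_ge0.
  rewrite big_ord_recr/=.
  have -> : `[s 0%N, s n.+1[%classic = `[s 0%N, s n[%classic `|` `[s n, s n.+1[%classic.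
    by rewrite (@itv_bndbnd_setU _ _ _ (BLeft (s n)))// bnd_simp// ltW.
  rewrite ge0_integral_setU//=.
  - apply: leeD; first exact: ih (ltnW nL).
    apply: (@le_trans _ _ (\int[mu]_(t in `[s n, s n.+1[) (cst (phi (s n)) t))%E).
      by rewrite integral_cst//= lebesgue_measure_itv/= lte_fin sSlt -EFinD sS muleC.
    apply: ge0_le_integral => //=.
      by apply: measurable_funTS.
    move=> t; rewrite in_itv/= => /andP[sn tn]; apply: ndphi => //.
    apply: lt_le_trans tn _; rewrite /s ler_pdivrMr// mul1r ler_nat.
    by rewrite ltnS.
  - by apply: measurable_funTS.
  - apply/disj_setPS => t [] /=; rewrite !in_itv/= => /andP[_ h1] /andP[h2 _].
    by have := lt_le_trans h1 h2; rewrite ltxx.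
apply: le_trans (H L (leqnn L)) _.
apply: ge0_subset_integral => //=; first exact: measurable_funTS.
move=> t /=; rewrite !in_itv/= => /andP[h1 h2]; rewrite (lt_le_trans (s0 0%N) h1)/=.
by apply: lt_le_trans h2 _; rewrite /s divff// gt_eqF.
Qed.

End riemann_lower_sum.

(** * The multiplier along one radius *)

Section radial_multiplier.
Context (R : realType) (N : nat) (p : R) (p1 : 1 <= p) (k : 'I_N).
Local Notation nc := (@Normc.normc R).
Local Notation mu := (@lebesgue_measure R).
Implicit Types (c : mindex N -> R[i]) (x : N.-tuple R) (r t : R).
Let p0 : 0 < p. Proof. by move: p1; lra. Qed.

Definition gcoef c : mindex N -> R[i] := fun al =>
  if mdeg al == 0%N then 0 else (al k)%:R / (mdeg al)%:R * c al.

Lemma mdeg_sdeg (al : mindex N) : mdeg al = (al k + sdeg (predC1 k) al)%N.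
Proof. by rewrite /mdeg (bigD1 k). Qed.

Lemma normc_gcoef c al : nc (gcoef c al) <= nc (c al).
Proof.
rewrite /gcoef; case: eqP => [_|/eqP d0]; first by rewrite Normc.normc0 normc_ge0.
rewrite Normc.normcM -[leRHS]mul1r; apply: ler_wpM2r; first exact: normc_ge0.
have -> : (al k)%:R / (mdeg al)%:R = ((al k)%:R / (mdeg al)%:R : R)%:C%C :> R[i].
  by rewrite rmorphM fmorphV !rmorph_nat.
rewrite normc_real ger0_norm ?divr_ge0//.
by rewrite ler_pdivrMr ?ltr0n ?lt0n// mul1r ler_nat mdeg_sdeg leq_addr.
Qed.

Let powR_rescale r t (T : \bar R) : 0 < r -> 0 < t ->
  ((r `^ p)%:E * (((t * r)^-1 `^ p)%:E * ((nc t%:C%C `^ p)%:E * T)) = T)%E.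
Proof.
move=> r0 t0; rewrite normc_real gtr0_norm// !muleA -!EFinM.
rewrite -!powRM ?mulr_ge0 ?invr_ge0 ?mulr_ge0 ?ltW//.
by rewrite (_ : r * _ * _ = 1) ?powR1 ?mul1e//; field; rewrite !gt_eqF.
Qed.

(** If al_k > 0, then |al| - 1 is al_k - 1 plus the degree in the other variables. The dilation by t
    in the other variables is a contraction and is dropped; what remains is the derivative in the
    k-th variable at radius t r. So the other radii stay fixed, and one-dimensional estimates
    suffice. *)
Lemma torus_mean_dilation c x r t : (forall i, 0 <= tnth x i) -> 0 < r -> 0 < t < 1 ->
  rsummable c (tset x k r) ->
  (torus_mean (pow_norm p (fun al => (t ^+ (mdeg al).-1)%:C%C * dcoef k c al)%R) (tset x k r) <=
   (r `^ p)%:E * radial_dmean p k c x (t * r))%E.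
Proof.
move=> x0 r0 /andP[t0 t1] sc.
pose c' := fun al : mindex N => (t ^+ (al k).-1)%:C%C * dcoef k c al.
have y0 : forall i, 0 <= tnth (tset x k r) i := tset_ge0 k x0 (ltW r0).
have B0 : 0 <= (1 - t)^-1 / t by rewrite !divr_ge0 ?invr_ge0 ?subr_ge0// ltW.
have sc' : rsummable c' (tset x k r).
  have := sc; apply: (rsummable_le y0 B0) => al.
  rewrite /c' /dcoef mulrA Normc.normcM; apply: ler_wpM2r; first exact: normc_ge0.
  rewrite Normc.normcM normc_nat normc_real ger0_norm ?exprn_ge0 ?(ltW t0)//.
  case: (al k) => [|l]; first by rewrite mulr0.
  rewrite ler_pdivlMr//= mulrAC -exprSr mulrC; apply: natmul_expr_le.
  by rewrite t1 ltW.
have E1 : (fun al => (t ^+ (mdeg al).-1)%:C%C * dcoef k c al) =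
    (fun al => (t ^+ sdeg (predC1 k) al)%:C%C * c' al).
  apply/funext => al; rewrite /c' mulrA -rmorphM/= -exprD mdeg_sdeg /dcoef.
  case: (al k) => [|l]; first by rewrite !mul0r !mulr0.
  by rewrite addSn/= addnC.
have t01 : 0 <= t <= 1 by rewrite !ltW.
have h := torus_mean_contraction p1 (predC1 k) t01 y0 sc'.
rewrite E1; apply: le_trans h _.
have E2 : radial_mean p k (dcoef k c) x (t * r) =
    torus_mean (pow_norm p (fun al => t%:C%C * c' al)) (tset x k r).
  apply: torus_mean_tset => al; rewrite /c' /dcoef mulrA -rmorphM/= exprMn.
  case: (al k) => [|l]; first by rewrite !mul0r mulr0 mul0r.
  by rewrite -exprS rmorphM/=; ring.
rewrite /radial_dmean (etrans E2 (torus_mean_scale t%:C%C p0 y0 sc')).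
by rewrite powR_rescale.
Qed.

(* Riemann sums of al_k t^(|al| - 1) at the points (i + 1) / (L + 1), then Fatou. *)
Lemma radial_mean_gcoef_le c x r (v : R -> R) (Bv : R) (phi : R -> \bar R) :
  (forall i, 0 <= tnth x i) -> 0 < r -> rsummable c (tset x k r) ->
  (forall t, 0 < t < 1 -> 0 < v t) -> 0 <= Bv ->
  (forall L : nat, \sum_(i < L) L.+1%:R^-1 * v (i.+1%:R / L.+1%:R) <= Bv) ->
  measurable_fun setT phi -> (forall t, 0 <= phi t)%E ->
  (forall s t, 0 < s -> s <= t -> t < 1 -> (phi s <= phi t)%E) ->
  (forall t, 0 < t < 1 ->
    ((v t `^ (1 - p))%:E * ((r `^ p)%:E * radial_dmean p k c x (t * r)) <= phi t)%E) ->
  (radial_mean p k (gcoef c) x r <=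
   (Bv `^ (p - 1))%:E * \int[mu]_(t in `]0%R, 1%R[) phi t)%E.
Proof.
move=> x0 r0 sc v0 Bv0 vB mphi phi0 ndphi dphi.
have y0 : forall i, 0 <= tnth (tset x k r) i := tset_ge0 k x0 (ltW r0).
pose s (L i : nat) : R := i.+1%:R / L.+1%:R.
pose G (t : R) : mindex N -> R[i] := fun al => (t ^+ (mdeg al).-1)%:C%C * dcoef k c al.
pose E (L : nat) : mindex N -> R[i] := fun al => \sum_(i < L) (L.+1%:R^-1)%:C%C * G (s L i) al.
pose S (L n : nat) : R := L.+1%:R^-1 * \sum_(i < L) (i.+1%:R / L.+1%:R) ^+ n.-1.
have EE L al : E L al = (S L (mdeg al) * (al k)%:R)%:C%C * c al.
  rewrite /E /S /G /dcoef mulr_sumr mulr_suml rmorph_sum/= mulr_suml.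
  by apply: eq_bigr => i _; rewrite !rmorphM/= rmorph_nat !mulrA.
have S0 L n : 0 <= S L n.
  by rewrite mulr_ge0 ?invr_ge0//; apply: sumr_ge0 => i _; rewrite exprn_ge0 ?divr_ge0.
apply: (torus_mean_fatou p1 y0 sc ler01 (c_ := E)).
- move=> L al; rewrite EE Normc.normcM; apply: ler_wpM2r; first exact: normc_ge0.
  rewrite normc_real (ger0_norm (mulr_ge0 (S0 L _) (ler0n _ _))).
  have [->|al0] := eqVneq (al k) 0%N; first by rewrite mulr0.
  have d0 : (0 < mdeg al)%N by rewrite mdeg_sdeg addn_gt0 lt0n al0.
  have /andP[_ h] := @riemann_sum_le R _ L d0.
  apply: (@le_trans _ _ ((mdeg al)%:R^-1 * (al k)%:R)); first exact: ler_wpM2r.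
  by rewrite mulrC ler_pdivrMr ?ltr0n// mul1r ler_nat mdeg_sdeg leq_addr.
- move=> al.
  have [d0|d0] := posnP (mdeg al).
    have ak : al k = 0%N by move: d0; rewrite mdeg_sdeg; case: (al k).
    under eq_fun do rewrite EE ak mulr0 mul0r /gcoef d0 eqxx subr0 Normc.normc0.
    exact: cvg_cst.
  have gE : gcoef c al = ((mdeg al)%:R^-1 * (al k)%:R)%:C%C * c al.
    by rewrite /gcoef (gtn_eqF d0) rmorphM fmorphV !rmorph_nat [_^-1 * _]mulrC.
  rewrite (_ : (fun L => _) = (fun L => `|S L (mdeg al) - (mdeg al)%:R^-1| * ((al k)%:R * nc (c al)))); last first.
    apply/funext => L; rewrite EE gE -mulrBl -rmorphB/= -mulrBl Normc.normcM normc_real.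
    by rewrite normrM (ger0_norm (ler0n _ _)) mulrA.
  have h1 : S L (mdeg al) - (mdeg al)%:R^-1 @[L --> \oo] --> (0 : R).
    rewrite -(subrr (mdeg al)%:R^-1); apply: cvgB; last exact: cvg_cst.
    exact: cvg_riemann_sum.
  have h2 : `|S L (mdeg al) - (mdeg al)%:R^-1| @[L --> \oo] --> (0 : R).
    by rewrite -[X in _ --> X](@normr0 _ R); exact: cvg_norm h1.
  have h3 := cvgMr_tmp (b := (al k)%:R * nc (c al)) h2; rewrite mul0r in h3; exact: h3.
move=> L; have s01 (i : 'I_L) : 0 < s L i < 1.
  by rewrite divr_gt0 ?ltr0n//= ltr_pdivrMr ?ltr0n// mul1r ltr_nat ltnS ltn_ord.
have sG (i : 'I_L) : rsummable (G (s L i)) (tset x k r).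
  have := s01 i; move: (s L i) => t /andP[t0 t1].
  have B0 : 0 <= (1 - t)^-1 / t by rewrite !divr_ge0 ?invr_ge0 ?subr_ge0// ltW.
  have := sc; apply: (rsummable_le y0 B0) => al.
  rewrite /G /dcoef mulrA Normc.normcM; apply: ler_wpM2r; first exact: normc_ge0.
  rewrite Normc.normcM normc_nat normc_real ger0_norm ?exprn_ge0 ?(ltW t0)//.
  have [->|al0] := eqVneq (al k) 0%N; first by rewrite mulr0.
  have : (al k <= mdeg al)%N by rewrite mdeg_sdeg leq_addr.
  case: (mdeg al) => [|l]; first by rewrite leqn0 (negbTE al0).
  move=> alk; rewrite ler_pdivlMr//= mulrAC -exprSr mulrC.
  apply: (@le_trans _ _ (l.+1%:R * t ^+ l.+1)).
    by apply: ler_wpM2r; rewrite ?exprn_ge0 ?(ltW t0)// ler_nat.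
  by apply: natmul_expr_le; rewrite t1 ltW.
have L0 : 0 <= L.+1%:R^-1 :> R by rewrite invr_ge0.
(* The weight [v] of Jensen's inequality is left free: it will be constant for p = 1 and singular
   towards the boundary for p > 1. *)
apply: le_trans (torus_mean_jensen p1 (index_enum 'I_L) y0 (fun=> L0) (fun i : 'I_L => v0 (s L i) (s01 i)) sG) _.
apply: lee_pmul.
- by rewrite lee_fin powR_ge0.
- apply: sume_ge0 => i _; rewrite mule_ge0 ?lee_fin ?mulr_ge0 ?powR_ge0//.
  by apply: torus_mean_ge0 => t; exact: pow_norm_ge0.
- rewrite lee_fin; apply: ge0_ler_powR => //; rewrite ?nnegrE ?subr_ge0//.
    by apply: sumr_ge0 => i _; rewrite mulr_ge0// ltW// v0.
  exact: vB.
apply: le_trans (riemann_lower_sum_le L mphi phi0 ndphi).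
apply: lee_sum => i _; rewrite EFinM -muleA; apply: lee_wpmul2l; first by rewrite lee_fin.
apply: le_trans (dphi _ (s01 i)); apply: lee_wpmul2l; first by rewrite lee_fin powR_ge0.
exact: torus_mean_dilation.
Qed.

End radial_multiplier.

Section affine_interval.
Context (R : realType).
Local Notation mu := (@lebesgue_measure R).

Lemma ge0_integral_affine_itv (c d u v : R) (f : R -> \bar R) : 0 < c ->
  measurable_fun setT f -> (forall x, 0 <= f x)%E ->
  (\int[mu]_(x in `]u, v[) f (c * x + d)%R =
   c^-1%:E * \int[mu]_(y in `](c * u + d)%R, (c * v + d)%R[) f y)%E.
Proof.
move=> c0 mf f0; rewrite integral_mkcond [in RHS]integral_mkcond.
rewrite -(ge0_integral_affine d c0); last first.
- by move=> x; rewrite patchE; case: ifPn.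
- by apply: emeasurable_patch.
apply: eq_integral => x _; rewrite !patchE; congr (if _ then _ else _).
by rewrite !mem_setE !in_itv/= !ltrD2r !ltr_pM2l.
Qed.

Lemma ge0_integral_unit_dilation (K r : R) (H : R -> \bar R) : 0 <= K -> 0 < r ->
  measurable_fun setT H -> (forall x, 0 <= H x)%E ->
  (\int[mu]_(t in `]0%R, 1%R[) (K%:E * H (t * r)%R) =
   (K / r)%:E * \int[mu]_(s in `]0%R, r[) H s)%E.
Proof.
move=> K0 r0 mH H0; rewrite ge0_integralZl//; last first.
  apply: measurable_funTS; apply: (measurableT_comp mH).
  exact: mulrr_measurable.
have := ge0_integral_affine_itv 0 0 1 r0 mH H0.
rewrite mulr0 mulr1 !addr0 => E; rewrite EFinM -muleA -E.
by congr (_ * _)%E; apply: eq_integral => t _; rewrite addr0 mulrC.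
Qed.

End affine_interval.

(** * Hardy weights and the bounds for p > 1 and p = 1 *)

Section hardy_weight.
Context (R : realType).

Lemma ler_powRN (x y e : R) : 0 < x -> x <= y -> 0 <= e -> y `^ (- e) <= x `^ (- e).
Proof.
move=> x0 xy e0; have y0 := lt_le_trans x0 xy.
rewrite !powRN lef_pV2 ?posrE ?powR_gt0//.
by apply: ge0_ler_powR => //; rewrite nnegrE ltW.
Qed.

(** The tangent inequality of the convex function u^(-e), which follows from exp y >= 1 + y and ln y
    <= y - 1 at the ratio u' / u. *)
Lemma powR_tangent_neg (u u' e : R) : 0 < u' -> 0 < u -> 0 < e ->
  e * (u - u') * u `^ (- 1 - e) <= u' `^ (- e) - u `^ (- e).
Proof.
move=> u'0 u0 e0.
have ratio : 1 + e * (1 - u' / u) <= (u' / u) `^ (- e).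
  have s0 : 0 < u' / u by rewrite divr_gt0.
  rewrite /powR gt_eqF//; apply: le_trans (expR_ge1Dx _).
  rewrite lerD2l mulNr -mulrN; apply: ler_wpM2l; first exact: ltW.
  have := @le_ln1Dx R (u' / u - 1); rewrite ltrBrDr addNr => /(_ s0).
  by rewrite addrC subrK; move: (ln _) => l; lra.
have -> : u' `^ (- e) = (u' / u) `^ (- e) * u `^ (- e).
  by rewrite -powRM ?divr_ge0 ?ltW// divfK// gt_eqF.
have -> : u `^ (- 1 - e) = u^-1 * u `^ (- e).
  rewrite powRD; last by apply/implyP => _; rewrite gt_eqF.
  by rewrite powR_inv1// ltW.
have := ler_wpM2r (powR_ge0 u (- e)) ratio; move: ((u' / u) `^ _) (u `^ _) => Y X h.
have -> : e * (u - u') * (u^-1 * X) = (1 + e * (1 - u' / u)) * X - X.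
  by field; rewrite gt_eqF.
by rewrite lerD2r.
Qed.

(* [q (1 - t q)^(- 1 - e)] is the derivative of [e^-1 (1 - t q)^(- e)], whose
   increments telescope. *)
Lemma riemann_sum_hardy_weight (q e : R) (L : nat) : 0 < q < 1 -> 0 < e ->
  \sum_(i < L) L.+1%:R^-1 * (q * (1 - i.+1%:R / L.+1%:R * q) `^ (- 1 - e)) <=
  e^-1 * (1 - q) `^ (- e).
Proof.
move=> /andP[q0 q1] e0; pose s (i : nat) : R := i.+1%:R / L.+1%:R.
pose F (i : nat) : R := (1 - s i * q) `^ (- e).
have L1 : 0 < L.+1%:R :> R by rewrite ltr0n.
have sq (i : nat) : (i <= L)%N -> 0 < 1 - s i * q.
  move=> iL; rewrite subr_gt0; apply: le_lt_trans q1.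
  by rewrite ger_pMl// /s ler_pdivrMr// mul1r ler_nat.
have step (i : 'I_L) : L.+1%:R^-1 * (q * (1 - s i * q) `^ (- 1 - e)) <=
    e^-1 * (F i.+1 - F i).
  have h := powR_tangent_neg (sq i.+1 (ltn_ord i)) (sq i (ltnW (ltn_ord i))) e0.
  rewrite [leRHS]mulrC ler_pdivlMr//; apply: le_trans h; rewrite le_eqVlt; apply/orP; left.
  apply/eqP; move: (_ `^ _) => X; rewrite /s -[i.+2%:R]natr1; field.
  by rewrite gt_eqF.
apply: le_trans (ler_sum _ (fun i _ => step i)) _.
rewrite -mulr_sumr; apply: ler_wpM2l; first by rewrite invr_ge0 ltW.
rewrite -(big_mkord xpredT (fun i => F i.+1 - F i)) telescope_sumr//.
have -> : (1 - q) `^ (- e) = F L by rewrite /F /s divff ?gt_eqF// mul1r.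
by rewrite gerBl powR_ge0.
Qed.

End hardy_weight.

Section radial_multiplier_bounds.
Context (R : realType) (N : nat) (k : 'I_N).
Local Notation mu := (@lebesgue_measure R).
Implicit Types (c : mindex N -> R[i]) (x : N.-tuple R) (p r : R).

Lemma measurable_radial_mean p c x : measurable_fun setT (radial_mean p k c x).
Proof.
apply: measurableT_comp.
  apply: measurable_torus_mean; first exact: measurable_pow_norm.
  by move=> t; exact: pow_norm_ge0.
by apply: measurable_tset.
Qed.

Lemma measurable_radial_dmean p c x : measurable_fun setT (radial_dmean p k c x).
Proof.
apply: emeasurable_funM; last exact: measurable_radial_mean.
apply/measurable_EFinP; rewrite (_ : (fun s : R => _) = @powR R ^~ (- p)).
  exact: measurable_powR.
apply/funext => s; have [s0|s0] := leP 0 s.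
  by rewrite -(powR_inv1 s0) -powRrM mulN1r.
by rewrite !lt0_powR1// invr_lt0.
Qed.

(** With a constant Jensen weight, and as [radial_dmean] increases, the Riemann sums are below the
    integral in t, and s = t r is substituted. *)
Lemma radial_mean1_gcoef_le c x r : (forall i, 0 <= tnth x i) -> 0 < r ->
  rsummable c (tset x k r) ->
  (radial_mean 1 k (gcoef k c) x r <= \int[mu]_(s in `]0%R, r[) radial_dmean 1 k c x s)%E.
Proof.
move=> x0 r0 sc.
have mD := measurable_radial_dmean 1 c x.
have := @radial_mean_gcoef_le R N 1 (lexx 1) k c x r (fun=> 1) 1
  (fun t => r%:E * radial_dmean 1 k c x (t * r))%E x0 r0 sc.
rewrite subrr powRr0 mul1e.
rewrite (ge0_integral_unit_dilation (ltW r0) r0 mD (radial_dmean_ge0 _ _ _ _)).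
rewrite divff ?gt_eqF// mul1e; apply.
- by [].
- by [].
- move=> L; rewrite sumr_const card_ord mulr1 -[leLHS]mulr_natr mulrC.
  by rewrite ler_pdivrMr ?ltr0n// mul1r ler_nat.
- apply: measurable_funeM; apply: (measurableT_comp mD).
  exact: mulrr_measurable.
- by move=> t; rewrite mule_ge0 ?radial_dmean_ge0// lee_fin ltW.
- move=> s t s0 st t1; apply: lee_wpmul2l; first by rewrite lee_fin ltW.
  apply: le_radial_dmean => //.
    by rewrite mulr_gt0//= ler_pM2r.
  apply: rsummable_dcoef sc => //.
  by rewrite gtr_pMl// t1 mulr_ge0 ?(ltW r0)// (le_trans (ltW s0)).
- by move=> t _; rewrite mul1e powRr1// ltW.
Qed.

(** With e = 1 / (2 (p - 1)) the exponent (- 1 - e) (1 - p) is p - 1/2. The weight thus reduces the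
    factor u^(-p) of the Cauchy estimate to the integrable u^(-1/2). *)
Lemma hardy_weight_power p (u rm r : R) : 1 < p -> 0 < u -> 0 < rm -> 0 < r ->
  (r / rm * u `^ (- 1 - (2 * (p - 1))^-1)) `^ (1 - p) * (r `^ p * (rm * u / 2)^-1 `^ p) =
  2 `^ p * (r / rm) * rm `^ 2^-1 * (rm * u) `^ (- 2^-1).
Proof.
move=> p1 u0 rm0 r0; have p10 : p - 1 != 0 by rewrite subr_eq0 gt_eqF.
have q0 : 0 < r / rm by rewrite divr_gt0.
have -> : r `^ p * (rm * u / 2)^-1 `^ p = 2 `^ p * (r / rm) `^ p * u `^ (- p).
  have -> : u `^ (- p) = u^-1 `^ p.
    by rewrite -(powR_inv1 (ltW u0)) -powRrM mulN1r.
  rewrite -!powRM ?mulr_ge0 ?invr_ge0 ?divr_ge0 ?mulr_ge0 ?(ltW u0) ?(ltW rm0) ?(ltW r0)//.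
  by congr (_ `^ p); field; rewrite !gt_eqF.
rewrite powRM ?powR_ge0 ?(ltW q0)// -powRrM.
have -> : (- 1 - (2 * (p - 1))^-1) * (1 - p) = p - 2^-1.
  by field.
have -> : (r / rm) `^ (1 - p) * u `^ (p - 2^-1) * (2 `^ p * (r / rm) `^ p * u `^ (- p)) =
    2 `^ p * ((r / rm) `^ (1 - p) * (r / rm) `^ p) * (u `^ (p - 2^-1) * u `^ (- p)) by ring.
rewrite -!powRD; try (by apply/implyP => _; rewrite gt_eqF).
rewrite subrK powRr1 ?(ltW q0)// powRM ?(ltW u0) ?(ltW rm0)//.
rewrite (_ : p - 2^-1 - p = - 2^-1); last by ring.
have : rm `^ 2^-1 * rm `^ (- 2^-1) = 1 by rewrite powRN divff// gt_eqF// powR_gt0.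
move: (r / rm) (2 `^ p) (u `^ _) (rm `^ _) (rm `^ _) => A B C D E h.
by rewrite -[LHS]mulr1 -h; ring.
Qed.

(** The weight is q (1 - t q)^(- 1 - e) with q = r / rm, so that 1 - t q is the relative distance of
    t r to the boundary. Its total mass, raised to the power p - 1, yields (2 (p - 1))^(p - 1) and
    the outer (rm - r)^(-1/2), as e (p - 1) = 1/2; the factor 2^p stems from the midpoint. *)
Lemma radial_mean_gcoef_hardy p c x r rm : 1 < p -> (forall i, 0 <= tnth x i) ->
  0 < r < rm -> (forall s, 0 <= s < rm -> rsummable c (tset x k s)) ->
  (radial_mean p k (gcoef k c) x r <=
   (2 `^ p * (2 * (p - 1)) `^ (p - 1) * (rm - r) `^ (- 2^-1))%:E *
   \int[mu]_(s in `]0%R, r[)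
     (((rm - s) `^ (- 2^-1))%:E * radial_mean p k c x ((s + rm) / 2)))%E.
Proof.
move=> p1 x0 /andP[r0 rrm] sc.
have rm0 : 0 < rm := lt_trans r0 rrm.
pose q := r / rm; have q0 : 0 < q by rewrite divr_gt0.
have q1 : q < 1 by rewrite /q ltr_pdivrMr// mul1r.
pose e := (2 * (p - 1))^-1; have e0 : 0 < e by rewrite invr_gt0 mulr_gt0// subr_gt0.
have ei0 : 0 <= e^-1 by rewrite invr_ge0 ltW.
have pe : e * (p - 1) = 2^-1 by rewrite /e invfM divfK// subr_eq0 gt_eqF.
have tq t : 0 < t < 1 -> 0 < 1 - t * q.
  by move=> /andP[t0 t1]; rewrite subr_gt0; apply: lt_trans q1; rewrite gtr_pMl.
pose M s := radial_mean p k c x ((s + rm) / 2).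
have M0 s : (0 <= M s)%E by exact: radial_mean_ge0.
have mM : measurable_fun setT M.
  apply: (measurableT_comp (measurable_radial_mean p c x)).
  by apply: measurable_funM => //; exact: measurable_funD.
pose H s : \bar R := (((rm - s) `^ (- 2^-1))%:E * M s)%E.
have H0 s : (0 <= H s)%E by rewrite mule_ge0// lee_fin powR_ge0.
have mH : measurable_fun setT H.
  apply: emeasurable_funM => //; apply/measurable_EFinP.
  by apply: (measurableT_comp (measurable_powR _)); exact: measurable_funB.
pose K : R := 2 `^ p * q * rm `^ 2^-1.
have K0 : 0 <= K.
  by apply: mulr_ge0; [apply: mulr_ge0; [exact: powR_ge0|exact: ltW]|exact: powR_ge0].
have HM t s : 0 < s -> s <= t -> t < 1 -> (H (s * r)%R <= H (t * r)%R)%E.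
  move=> s0 st t1; clear K K0; have t0 := lt_le_trans s0 st.
  have trm : t * r < rm by apply: lt_trans rrm; rewrite gtr_pMl.
  have sr : s * r <= t * r by rewrite ler_pM2r.
  have sr0 : 0 <= (s * r + rm) / 2 by rewrite divr_ge0// addr_ge0 ?mulr_ge0 ?ltW.
  have tr0 : 0 <= (t * r + rm) / 2 < rm.
    rewrite divr_ge0 ?addr_ge0 ?mulr_ge0 ?(ltW t0) ?(ltW r0) ?(ltW rm0)//=.
    by rewrite ltr_pdivrMr// mulr_natr mulr2n ltrD2r.
  have st' : 0 <= (s * r + rm) / 2 <= (t * r + rm) / 2.
    by rewrite sr0 ler_pM2r ?invr_gt0// lerD2r.
  have w1 : (rm - s * r) `^ (- 2^-1) <= (rm - t * r) `^ (- 2^-1).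
    by apply: ler_powRN; rewrite ?subr_gt0 ?lerD2l ?lerN2 ?invr_ge0.
  have w2 := le_radial_mean (ltW p1) x0 st' (sc _ tr0).
  apply: lee_pmul; [by rewrite lee_fin powR_ge0|exact: M0| |exact: w2].
  by rewrite lee_fin.
have [phi phiE] : exists phi, phi = fun t => (K%:E * H (t * r)%R)%E by eexists.
have EI : (\int[mu]_(t in `]0%R, 1%R[) phi t =
    (K * r^-1)%:E * \int[mu]_(s in `]0%R, r[) H s)%E.
  by rewrite phiE; exact: ge0_integral_unit_dilation K0 r0 mH H0.
have CE : 2 `^ p * (2 * (p - 1)) `^ (p - 1) * (rm - r) `^ (- 2^-1) =
    (e^-1 * (1 - q) `^ (- e)) `^ (p - 1) * (K * r^-1).
  rewrite [in RHS]powRM ?powR_ge0 ?ei0// -powRrM mulNr pe {1}/e invrK.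
  have -> : rm - r = rm * (1 - q) by rewrite /q; field; rewrite gt_eqF.
  rewrite (@powRM _ rm) ?(ltW rm0) ?subr_ge0 ?(ltW q1)// /K.
  have qE : q * rm `^ 2^-1 * r^-1 = rm `^ (- 2^-1).
    have -> : - 2^-1 = 2^-1 - 1 :> R by field.
    rewrite powRB; last by apply/implyP => _; rewrite gt_eqF.
    by rewrite powRr1 ?(ltW rm0)// /q; field; rewrite !gt_eqF.
  rewrite -qE; move: (_ `^ _) (_ `^ (p - 1)) ((1 - q) `^ _) (rm `^ _) => W X Y Z.
  by ring.
have CI (I : \bar R) : ((2 `^ p * (2 * (p - 1)) `^ (p - 1) * (rm - r) `^ (- 2^-1))%:E * I =
    ((e^-1 * (1 - q) `^ (- e)) `^ (p - 1))%:E * ((K * r^-1)%:E * I))%E.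
  by rewrite CE EFinM muleA.
rewrite CI -EI.
apply: (@radial_mean_gcoef_le R N p (ltW p1) k c x r
  (fun t => q * (1 - t * q) `^ (- 1 - e)) (e^-1 * (1 - q) `^ (- e)) phi x0 r0 (sc _ _)).
- by rewrite (ltW r0).
- by move=> t /tq h; rewrite mulr_gt0// powR_gt0.
- by rewrite mulr_ge0 ?powR_ge0// invr_ge0 ltW.
- by move=> L; apply: riemann_sum_hardy_weight; rewrite ?q0.
- rewrite phiE; apply: measurable_funeM; apply: (measurableT_comp mH).
  exact: mulrr_measurable.
- by move=> t; rewrite phiE mule_ge0// lee_fin.
- move=> s t s0 st t1; rewrite phiE; apply: lee_wpmul2l; last exact: HM.
  by rewrite lee_fin.
- rewrite phiE => t t01; have /andP[t0 t1] := t01.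
  have trm : t * r < rm by apply: lt_trans rrm; rewrite gtr_pMl.
  have tr0 : 0 < t * r by rewrite mulr_gt0.
  have Y0 : 0 < rm - t * r by rewrite subr_gt0.
  have u0 := tq t t01.
  have tr' : 0 < t * r < (t * r + rm) / 2.
    by rewrite tr0 ltr_pdivlMr// mulr_natr mulr2n ltrD2l.
  have tr'0 : 0 <= (t * r + rm) / 2 < rm.
    by rewrite divr_ge0 ?addr_ge0 ?(ltW tr0) ?(ltW rm0)//= ltr_pdivrMr// mulr_natr mulr2n ltrD2r.
  (* The larger radius is the midpoint of t r and rm: it remains in the domain, and its distance to
     t r is half the distance to the boundary. *)
  have A := @radial_dmean_cauchy R N p (ltW p1) k c x (t * r) ((t * r + rm) / 2) x0 tr' (sc _ tr'0).
  have YE : rm * (1 - t * q) = rm - t * r by rewrite /q; field; rewrite gt_eqF.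
  have Y2 : (t * r + rm) / 2 - t * r = rm * (1 - t * q) / 2 by rewrite YE; field.
  rewrite Y2 in A; have W := hardy_weight_power p1 u0 rm0 r0; rewrite -/q -/e -/K YE in W A.
  have WM (T : \bar R) : (K%:E * (((rm - t * r) `^ (- 2^-1))%:E * T) =
      ((q * (1 - t * q) `^ (- 1 - e)) `^ (1 - p))%:E * ((r `^ p)%:E * ((((rm - t * r) / 2)^-1 `^ p)%:E * T)))%E.
    by rewrite !muleA -!EFinM -W mulrA.
  rewrite /H WM; apply: lee_wpmul2l; first by rewrite lee_fin powR_ge0.
  by apply: lee_wpmul2l; [rewrite lee_fin powR_ge0|exact: A].
Qed.

End radial_multiplier_bounds.

(** * One-dimensional estimates *)

Section one_dimensional.
Context (R : realType).
Local Notation mu := (@lebesgue_measure R).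

Lemma measurable_subr_powR (l b : R) : measurable_fun setT (fun r : R => (l - r) `^ b).
Proof. by apply: (measurableT_comp (measurable_powR b)); exact: measurable_funB. Qed.

Lemma measurable_subr_powRE (l b : R) (D : set R) :
  measurable_fun D (fun r : R => ((l - r) `^ b)%:E).
Proof. by apply/measurable_EFinP; apply: measurable_funTS; exact: measurable_subr_powR. Qed.

(* For b < 0, the integrals J_n over ]0, 1 - 2^-n[ satisfy J_(n+1) <= D + q J_n with q < 1. *)
Let unit_integral_powR (b : R) : -1 < b ->
  exists2 C, 0 < C & (\int[mu]_(t in `]0%R, 1%R[) ((1 - t) `^ b)%:E <= C%:E)%E.
Proof.
move=> b1; have [b0|b0] := leP 0 b.
  exists 1 => //; apply: le_trans (_ : \int[mu]_(t in `]0%R, 1%R[) (cst 1%:E t) <= _)%E.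
    apply: ge0_le_integral => //=.
    - by move=> t _; rewrite lee_fin powR_ge0.
    - exact: measurable_subr_powRE.
    move=> t; rewrite in_itv/= => /andP[t0 t1]; rewrite lee_fin.
    apply: (@le_trans _ _ (1 `^ b)); last by rewrite powR1.
    apply: ge0_ler_powR => //; rewrite ?nnegrE ?subr_ge0 ?(ltW t1)//.
    by rewrite gerBl ltW.
  by rewrite integral_cst//= lebesgue_measure_itv/= lte_fin ltr01 oppr0 adde0 mule1.
(* The substitution t -> (t + 1) / 2 sends ]0, a n[ onto ]1/2, a (n + 1)[ and multiplies the
   integral by q = 2^(- 1 - b), which is less than 1 because b > -1; [D] bounds the integrand on ]0,
   1/2]. *)
pose q : R := 2^-1 * 2^-1 `^ b; pose D : R := 2^-1 `^ b.
have q0 : 0 < q by rewrite mulr_gt0 ?invr_gt0 ?powR_gt0 ?invr_gt0.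
have q1 : q < 1.
  rewrite /q -[X in X * _](@powRr1 _ 2^-1) ?invr_ge0// -powRD; last first.
    by apply/implyP => _; rewrite invr_eq0.
  apply: (@lt_le_trans _ _ (1 `^ (1 + b))); last by rewrite powR1.
  apply: gt0_ltr_powR; rewrite ?nnegrE ?invr_ge0//.
    by move: b1; lra.
  by rewrite invf_lt1// ltr1n.
pose a n : R := 1 - 2^-1 ^+ n.
have aS n : a n.+1 = 2^-1 * a n + 2^-1 by rewrite /a exprS; field.
have a1 n : a n < 1 by rewrite /a gtrBl exprn_gt0 ?invr_gt0.
have a0 n : 0 <= a n by rewrite /a subr_ge0 exprn_ile1 ?invr_ge0 ?invf_le1 ?ler1n.
have C0 : 0 < D / (1 - q) by rewrite divr_gt0 ?powR_gt0 ?invr_gt0 ?subr_gt0.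
have J n : (\int[mu]_(t in `]0%R, a n[) ((1 - t) `^ b)%:E <= (D / (1 - q))%:E)%E.
  elim: n => [|n ih].
    rewrite /a expr0 subrr set_itv_ge ?bnd_simp ?ltxx// integral_set0.
    by rewrite lee_fin ltW.
  rewrite (_ : D / (1 - q) = D + q * (D / (1 - q))); last first.
    by field; rewrite subr_eq0 gt_eqF.
  have sub : (`]0%R, a n.+1[ `<=` `]0%R, 2^-1%R] `|` `]2^-1%R, a n.+1[)%classic.
    move=> t /=; rewrite !in_itv/= => /andP[t0 ta]; rewrite t0 ta/= andbT.
    by case: leP => _; [left|right].
  apply: (@le_trans _ _ (\int[mu]_(t in (`]0%R, 2^-1%R] `|` `]2^-1%R, a n.+1[)%classic)
      ((1 - t) `^ b)%:E)%E).
    apply: ge0_subset_integral => //=.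
    - exact: measurableU.
    - exact: measurable_subr_powRE.
    - by move=> t _; rewrite lee_fin powR_ge0.
  rewrite ge0_integral_setU//=; last first.
  - apply/disj_setPS => t [] /=; rewrite !in_itv/= => /andP[_ h1] /andP[h2 _].
    by have := lt_le_trans h2 h1; rewrite ltxx.
  - by move=> t _; rewrite lee_fin powR_ge0.
  - exact: measurable_subr_powRE.
  rewrite EFinD; apply: leeD.
    apply: le_trans (_ : \int[mu]_(t in `]0%R, 2^-1%R]) (cst D%:E t) <= _)%E.
      apply: ge0_le_integral => //=.
      - by move=> t _; rewrite lee_fin powR_ge0.
      - exact: measurable_subr_powRE.
      move=> t; rewrite in_itv/= => /andP[t0 t2]; rewrite lee_fin /D.
      have b0' : 0 <= - b by rewrite oppr_ge0 ltW.
      rewrite -[b]opprK; apply: ler_powRN => //.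
      by move: t2; lra.
    rewrite integral_cst//= lebesgue_measure_itv/=; case: ifPn => _; last first.
      by rewrite mule0 lee_fin powR_ge0.
    rewrite oppr0 adde0 -EFinM lee_fin ger_pMr ?powR_gt0 ?invr_gt0//.
    by rewrite invf_le1// ler1n.
  have := @ge0_integral_affine_itv R 2^-1 2^-1 0 (a n) (fun t => ((1 - t) `^ b)%:E).
  rewrite mulr0 add0r -aS invr_gt0 ltr0n invrK => /(_ isT _ _) E.
  have E2 : (\int[mu]_(y in `]2^-1%R, (a n.+1)[) ((1 - y) `^ b)%:E =
     q%:E * \int[mu]_(t in `]0%R, a n[) ((1 - t) `^ b)%:E)%E.
    have -> : (\int[mu]_(y in `]2^-1%R, (a n.+1)[) ((1 - y) `^ b)%:E =
      2^-1%:E * (2%:E * \int[mu]_(y in `]2^-1%R, (a n.+1)[) ((1 - y) `^ b)%:E))%E.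
      by rewrite muleA -EFinM mulVf ?mul1e// pnatr_eq0.
    rewrite -E; [|exact: measurable_subr_powRE|by move=> t; rewrite lee_fin powR_ge0].
    rewrite EFinM -muleA; congr (_ * _)%E.
    rewrite -ge0_integralZl//; last 2 first.
    - exact: measurable_subr_powRE.
    - by move=> t _; rewrite lee_fin powR_ge0.
    apply: eq_integral => t; rewrite mem_setE in_itv/= => /andP[t0 ta].
    have t1 : t < 1 := lt_trans ta (a1 n).
    rewrite -EFinM -powRM ?invr_ge0 ?subr_ge0 ?(ltW t1)//; by congr (_ `^ _)%:E; field.
  by rewrite E2 (EFinM q); apply: lee_wpmul2l => //; rewrite lee_fin ltW.
exists (D / (1 - q)) => //.
have UE : `]0%R, 1%R[%classic = \bigcup_n (`]0%R, a n[)%classic.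
  apply/seteqP; split => t /=; last first.
    move=> [n _] /=; rewrite !in_itv/= => /andP[-> /=] ta; exact: lt_trans ta (a1 n).
  rewrite in_itv/= => /andP[t0 t1].
  have /cvgrPdist_lt/(_ (1 - t)) : (2^-1 : R) ^+ n @[n --> \oo] --> (0 : R).
    by apply: cvg_expr; rewrite ger0_norm ?invr_ge0// invf_lt1// ltr1n.
  rewrite subr_gt0 => /(_ t1)[n _ /(_ n (leqnn n))]/=.
  rewrite sub0r normrN ger0_norm ?exprn_ge0 ?invr_ge0// => h.
  by exists n => //=; rewrite in_itv/= t0/= /a; move: h; lra.
rewrite UE.
have h : (\int[mu]_(t in `]0%R, a n[) ((1 - t) `^ b)%:E @[n --> \oo] -->
    \int[mu]_(t in \bigcup_n (`]0%R, a n[)%classic) ((1 - t) `^ b)%:E)%E.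
  apply: ge0_nondecreasing_set_cvg_integral => //=.
  - apply/nondecreasing_seqP => n; rewrite subsetEset => t /=; rewrite !in_itv/=.
    move=> /andP[-> /=] ta; apply: lt_le_trans ta _; rewrite aS.
    by have := a1 n; lra.
  - by move=> n; exact: measurable_subr_powRE.
  - by move=> n t _; rewrite lee_fin powR_ge0.
rewrite -(cvg_lim _ h)//; apply: lime_le; first by apply/cvg_ex; eexists; exact: h.
by near=> n; exact: J.
Unshelve. all: by end_near. Qed.

Lemma integral_powR_le (b : R) : -1 < b ->
  exists2 C, 0 < C & forall s l, s < l ->
    (\int[mu]_(r in `]s, l[) ((l - r) `^ b)%:E <= (C * (l - s) `^ (b + 1))%:E)%E.
Proof.
move=> b1; have [C C0 HC] := unit_integral_powR b1; exists C => // s l sl.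
have d0 : 0 < l - s by rewrite subr_gt0.
have f0 (r : R) : (0%:E <= ((l - r) `^ b)%:E)%E by rewrite lee_fin powR_ge0.
have := ge0_integral_affine_itv s 0 1 d0 (measurable_subr_powRE l b (D := setT)) f0.
rewrite mulr0 add0r mulr1 subrK => E.
have E2 : (\int[mu]_(x in `]0%R, 1%R[) ((l - ((l - s) * x + s)) `^ b)%:E =
    ((l - s) `^ b)%:E * \int[mu]_(x in `]0%R, 1%R[) ((1 - x) `^ b)%:E)%E.
  rewrite -ge0_integralZl//; last 2 first.
  - exact: measurable_subr_powRE.
  - by move=> t _; rewrite lee_fin powR_ge0.
  apply: eq_integral => t; rewrite mem_setE in_itv/= => /andP[t0 t1].
  rewrite -EFinM -powRM ?subr_ge0 ?(ltW t1) ?(ltW sl)//; congr (_ `^ _)%:E; ring.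
have {E2}E : (\int[mu]_(y in `]s, l[) ((l - y) `^ b)%:E =
    (l - s)%:E * (((l - s) `^ b)%:E * \int[mu]_(x in `]0%R, 1%R[) ((1 - x) `^ b)%:E))%E.
  by rewrite -E2 E muleA -EFinM divff ?mul1e// gt_eqF.
rewrite E muleA -EFinM mulrC [X in (_ <= X)%E]EFinM muleC.
have -> : (l - s) `^ (b + 1) = (l - s) `^ b * (l - s).
  rewrite powRD ?powRr1// ?(ltW d0)//; apply/implyP => _; by rewrite gt_eqF.
rewrite muleC [X in (_ <= X)%E]muleC; apply: lee_wpmul2l => //.
by rewrite lee_fin mulr_ge0 ?powR_ge0// ltW.
Qed.

Lemma ge0_integral_swap (f : R -> R -> \bar R) :
  measurable_fun setT (fun q : measurableTypeR R * measurableTypeR R => f q.1 q.2) ->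
  (forall r s, 0 <= f r s)%E ->
  (\int[mu]_r \int[mu]_s f r s = \int[mu]_s \int[mu]_r f r s)%E.
Proof.
move=> mf f0.
by have [<- ->] := plane_tonelliE mf (fun q => f0 q.1 q.2).
Qed.

Lemma ge0_integral_swap_cond (T : R -> R -> bool) (w D : R -> \bar R) :
  measurable_fun setT (fun q : measurableTypeR R * measurableTypeR R => T q.1 q.2) ->
  measurable_fun setT w -> measurable_fun setT D ->
  (forall r, 0 <= w r)%E -> (forall r, 0 <= D r)%E ->
  (\int[mu]_r (w r * \int[mu]_(s in [set s | T r s]) D s) =
   \int[mu]_s (D s * \int[mu]_(r in [set r | T r s]) w r))%E.
Proof.
move=> mT mw mD w0 D0.
pose f r s : \bar R := (if T r s then w r * D s else 0)%E.
have mT1 r : measurable_fun setT (T r : measurableTypeR R -> bool).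
  exact: (measurableT_comp mT (measurable_pair1 r)).
have mT2 s : measurable_fun setT (T ^~ s : measurableTypeR R -> bool).
  exact: (measurableT_comp mT (measurable_pair2 s)).
have f0 r s : (0 <= f r s)%E by rewrite /f; case: ifP => // _; rewrite mule_ge0.
have mf : measurable_fun setT (fun q : measurableTypeR R * measurableTypeR R => f q.1 q.2).
  apply: measurable_fun_ifT => //.
  apply: emeasurable_funM.
    exact: (measurableT_comp mw measurable_fst).
  exact: (measurableT_comp mD measurable_snd).
transitivity (\int[mu]_r \int[mu]_s f r s)%E.
  apply: eq_integral => r _; rewrite integral_mkcond -ge0_integralZl//; last 2 first.
  - apply/(measurable_restrictT _ _).1; last exact: measurable_funTS.
    by rewrite -[X in measurable X]setTI; exact: mT1.
  - by move=> s _; rewrite patchE; case: ifP.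
  apply: eq_integral => s _; rewrite patchE /f.
  by case: (boolP (T r s)) => Trs; [rewrite mem_set|rewrite memNset ?mule0//; exact/negP].
rewrite ge0_integral_swap//; apply: eq_integral => s _.
rewrite [in RHS]integral_mkcond -ge0_integralZl//; last 2 first.
- apply/(measurable_restrictT _ _).1; last exact: measurable_funTS.
  by rewrite -[X in measurable X]setTI; exact: mT2.
- by move=> r _; rewrite patchE; case: ifP.
apply: eq_integral => r _; rewrite patchE /f.
by case: (boolP (T r s)) => Trs; [rewrite mem_set// muleC|rewrite memNset ?mule0//; exact/negP].
Qed.

Lemma ge0_integral_swap_triangle (l : R) (w D : R -> \bar R) :
  measurable_fun setT w -> measurable_fun setT D ->
  (forall r, 0 <= w r)%E -> (forall r, 0 <= D r)%E ->
  (\int[mu]_(r in `]0%R, l[) (w r * \int[mu]_(s in `]0%R, r[) D s) =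
   \int[mu]_(s in `]0%R, l[) (D s * \int[mu]_(r in `]s, l[) w r))%E.
Proof.
move=> mw mD w0 D0; rewrite integral_mkcond [in RHS]integral_mkcond.
have mT : measurable_fun setT (fun q : measurableTypeR R * measurableTypeR R =>
    [&& 0 < q.2, q.2 < q.1 & q.1 < l]).
  apply: measurable_and; first exact: measurable_fun_ltr.
  apply: measurable_and; exact: measurable_fun_ltr.
have := @ge0_integral_swap_cond (fun r s => [&& 0 < s, s < r & r < l]) w D mT mw mD w0 D0.
have e0 (f : R -> \bar R) (P : R -> bool) : P =1 xpred0 ->
    (\int[mu]_(s in [set s | P s]) f s = 0)%E.
  by move=> P0; rewrite (_ : [set s | P s] = set0) ?integral_set0//; apply/seteqP; split => s //=; rewrite P0.
move=> E; transitivity (\int[mu]_r (w r * \int[mu]_(s in [set s | [&& (0 < s)%R, (s < r)%R & (r < l)%R]]) D s))%E.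
  apply: eq_integral => r _; rewrite patchE mem_setE in_itv/=; case: ifPn => [/andP[r0 rl]|rl].
    congr (_ * _)%E; congr integral; apply/seteqP; split => s /=; rewrite in_itv/= rl andbT//.
  rewrite e0 ?mule0// => s; apply/negbTE; apply: contra rl => /and3P[s0 sr ->].
  by rewrite (lt_trans s0 sr).
rewrite E; apply: eq_integral => s _; rewrite patchE mem_setE in_itv/=; case: ifPn => [/andP[s0 sl]|sl].
  congr (_ * _)%E; congr integral; apply/seteqP; split => r /=; rewrite in_itv/= s0//.
rewrite e0 ?mule0// => r; apply/negbTE; apply: contra sl => /and3P[-> sr rl].
by rewrite (lt_trans sr rl).
Qed.

(** Layer cake formula: F s, possibly infinite, is the length of the set of y with 0 < y < F s; then
    Tonelli. *)
Lemma ge0_integral_superlevel (F K : R -> \bar R) :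
  measurable_fun setT F -> measurable_fun setT K ->
  (forall s, 0 <= F s)%E -> (forall s, 0 <= K s)%E ->
  (\int[mu]_s (K s * F s) =
   \int[mu]_(y in `]0%R, +oo[) \int[mu]_(s in [set s | (y%:E < F s)%E]) K s)%E.
Proof.
move=> mF mK F0 K0.
have mT : measurable_fun setT (fun q : measurableTypeR R * measurableTypeR R =>
    (0 < q.2)%R && (q.2%:E < F q.1)%E).
  apply: measurable_and; first exact: measurable_fun_ltr.
  apply: measurable_fun_lte.
    by apply/measurable_EFinP; exact: measurable_snd.
  exact: (measurableT_comp mF measurable_fst).
have := @ge0_integral_swap_cond (fun s y => (0 < y)%R && (y%:E < F s)%E) K (cst 1%E) mT mK
  (measurable_cst _) K0 (fun=> lee01).
have E s : (\int[mu]_(y in [set y | (0 < y)%R && (y%:E < F s)%E]) (cst 1 y) = F s)%E.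
  have := F0 s; case: (F s) => [v v0|_|//].
    rewrite (_ : [set y | _] = `]0%R, v[%classic); last first.
      by apply/seteqP; split => y /=; rewrite in_itv/= lte_fin.
    rewrite integral_cst//= mul1e lebesgue_measure_itv/= lte_fin; case: ltP => [_|]; first by rewrite oppr0 adde0.
    by move: v0; rewrite lee_fin => v0 v0'; congr (_%:E); apply/le_anti; rewrite v0.
  rewrite (_ : [set y | _] = `]0%R, +oo[%classic); last first.
    by apply/seteqP; split => y /=; rewrite in_itv/= andbT ltry ?andbT.
  by rewrite integral_cst//= mul1e lebesgue_measure_itv/= ltry.
under eq_integral do rewrite E; move=> ->.
rewrite [in RHS]integral_mkcond; apply: eq_integral => y _; rewrite patchE mem_setE in_itv/= andbT mul1e.
case: ifPn => // y0.
by rewrite (_ : [set s | _] = set0) ?integral_set0//; apply/seteqP; split => s.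
Qed.

End one_dimensional.

Section gap.
Context (R : realType).
Implicit Types (a x b y l : R).

(** With y = b / x this compares 1 - y^a to 1 - y on [0, 1]. Bernoulli's inequality gives one side,
    for the exponent a if a >= 1 and for 1 / a at y^a otherwise; the other side is the order between
    y^a and y. *)
Lemma powR_gap a x b : 0 < a -> 0 <= b -> b < x ->
  Num.min 1 a * (x `^ (a - 1) * (x - b)) <= x `^ a - b `^ a <=
  Num.max 1 a * (x `^ (a - 1) * (x - b)).
Proof.
move=> a0 b0 bx; have x0 : 0 < x := le_lt_trans b0 bx.
pose y := b / x; have y0 : 0 <= y by rewrite divr_ge0 ?(ltW x0).
have y1 : y <= 1 by rewrite /y ler_pdivrMr// mul1r ltW.
have -> : x `^ (a - 1) * (x - b) = x `^ a * (1 - y).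
  by rewrite -(mulr_powRB1 (ltW x0) a0) /y; move: (_ `^ _) => P; field; rewrite gt_eqF.
have -> : b `^ a = x `^ a * y `^ a.
  by rewrite -powRM ?(ltW x0)// /y mulrC divfK// gt_eqF.
have -> : x `^ a - x `^ a * y `^ a = x `^ a * (1 - y `^ a) by rewrite mulrBr mulr1.
rewrite ![_ * (x `^ a * _)]mulrCA.
have P0 : 0 <= x `^ a by exact: powR_ge0.
have ya1 : y `^ a <= 1.
  by apply: (@le_trans _ _ (1 `^ a)); [apply: ge0_ler_powR; rewrite ?nnegrE ?(ltW a0)|rewrite powR1].
have [a1|a1] := leP 1 a.
  have t := powR_tangent a1 y0 ler01; rewrite !powR1 mulr1 in t.
  have u : y `^ a <= y.
    have [->|yn0] := eqVneq y 0; first by rewrite powR0 ?gt_eqF.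
    by apply: ge1r_powR => //; rewrite y1 lt_neqAle eq_sym yn0 y0.
  by apply/andP; split; apply: ler_wpM2l => //; move: t u; lra.
have ai1 : 1 <= a^-1 by rewrite invf_ge1// ltW.
have t := powR_tangent ai1 (powR_ge0 y a) ler01.
rewrite !powR1 mulr1 -powRrM divff ?gt_eqF// powRr1// in t.
have u : y <= y `^ a.
  have [->|yn0] := eqVneq y 0; first by rewrite powR_ge0.
  by apply: ger1_powR; rewrite ?(ltW a1)// y1 lt_neqAle eq_sym yn0 y0.
have {}t : y `^ a - 1 <= a * (y - 1).
  by rewrite -ler_pdivrMl// mulrC mulrC; move: t; lra.
by apply/andP; split; apply: ler_wpM2l => //; move: t u; lra.
Qed.

(* Unlike [powR], which is 1 at negative reals. *)
Definition cut_powR l y : R := if 0 < y then y `^ l else 0.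

Lemma cut_powR_ge0 l y : 0 <= cut_powR l y.
Proof. by rewrite /cut_powR; case: ifP => // _; exact: powR_ge0. Qed.

Lemma cut_powR_pos l y : 0 < y -> cut_powR l y = y `^ l.
Proof. by rewrite /cut_powR => ->. Qed.

Lemma cut_powR_npos l y : y <= 0 -> cut_powR l y = 0.
Proof. by rewrite /cut_powR leNgt => /negbTE ->. Qed.

Lemma measurable_cut_powR l : measurable_fun setT (cut_powR l).
Proof.
by apply: measurable_fun_ifT => //; exact: measurable_fun_ltr.
Qed.

Lemma le_cut_powR l y z : 0 <= l -> y <= z -> cut_powR l y <= cut_powR l z.
Proof.
move=> l0 yz; rewrite /cut_powR; case: ifPn => y0; last by case: ifP => // _; rewrite powR_ge0.
rewrite (lt_le_trans y0 yz); apply: ge0_ler_powR; rewrite ?nnegrE ?(ltW y0)//.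
exact: le_trans (ltW y0) yz.
Qed.

Definition pos_part y : R := Num.max 0 y.

(* The function h of the paper along one radius r: [A] is 1 - |z'|^2 and the
   exponent is [a] if r is one of the |z_i|; [A] is (1 - |z|^2)^a and the exponent is
   1 if it is one of the |w_j|; [B] is |w|^2 or |w'|^2. The section of the domain is
   r^2 < A - B^(1 / a). *)
Definition height a A B r : R := pos_part (A - r ^+ 2) `^ a - B.

Lemma measurable_height a A B : measurable_fun setT (height a A B).
Proof.
apply: measurable_funB => //; apply: (measurableT_comp (measurable_powR a)).
by apply: measurable_maxr => //; exact: measurable_funB.
Qed.

Lemma height_gt0 a A B r : 0 < a -> 0 <= B ->
  (0 < height a A B r) = (r ^+ 2 < A - B `^ a^-1).
Proof.
move=> a0 B0; rewrite /height /pos_part subr_gt0 ltrBrDr -ltrBrDl.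
have BE : B = (B `^ a^-1) `^ a by rewrite -powRrM mulVf ?gt_eqF// powRr1.
have [h|h] := leP (A - r ^+ 2) 0.
  rewrite powR0 ?gt_eqF// ltNge B0/=; apply/esym/negbTE; rewrite -leNgt.
  by apply: le_trans h (powR_ge0 _ _).
rewrite {1}BE; apply/idP/idP => H; last first.
  by apply: gt0_ltr_powR; rewrite // nnegrE ?powR_ge0 ?(ltW h).
rewrite ltNge; apply/negP => H2.
have : (A - r ^+ 2) `^ a <= (B `^ a^-1) `^ a.
  by apply: ge0_ler_powR; rewrite ?nnegrE ?powR_ge0 ?(ltW a0) ?(ltW h).
by rewrite leNgt H.
Qed.

Lemma heightE a A B r : 0 < a -> 0 <= B -> r ^+ 2 < A - B `^ a^-1 ->
  height a A B r = (A - r ^+ 2) `^ a - (B `^ a^-1) `^ a.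
Proof.
move=> a0 B0 h; rewrite /height /pos_part max_r; last first.
  by move: h (powR_ge0 B a^-1); lra.
by rewrite -powRrM mulVf ?gt_eqF// powRr1.
Qed.

Lemma le_height a A B r s : 0 < a -> 0 <= r -> r <= s -> height a A B s <= height a A B r.
Proof.
move=> a0 r0 rs; rewrite lerD2r; apply: ge0_ler_powR.
- exact: ltW.
- by rewrite nnegrE le_max lexx.
- by rewrite nnegrE le_max lexx.
rewrite /pos_part ge_max !le_max lexx/= lerD2l lerN2.
by rewrite (lerXn2r 2) ?orbT// nnegrE// (le_trans r0).
Qed.

(** The difference A - r^2 - B^(1 / a) equals (rm - r) (rm + r) and is divided by at most 4 on
    passing to the midpoint. By [powR_gap] heights are comparable to this difference times x^(a -
    1), x = A - r^2, which accounts for the remaining factor 4^a and for the ratio of the two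
    constants of the gap. *)
Lemma height_midpoint a : 0 < a -> exists2 C, 0 < C &
  forall A B rm r, 0 <= B -> 0 < rm -> rm ^+ 2 = A - B `^ a^-1 -> 0 <= r < rm ->
  0 < height a A B ((r + rm) / 2) /\ height a A B r <= C * height a A B ((r + rm) / 2).
Proof.
move=> a0; pose m := Num.min 1 a; pose M := Num.max 1 a.
have m0 : 0 < m by rewrite lt_min ltr01.
have M0 : 0 < M by rewrite lt_max ltr01.
exists (M / m * 4 * 4 `^ a); first by rewrite !mulr_gt0 ?invr_gt0 ?powR_gt0.
move=> A B rm r B0 rm0 rmE /andP[r0 rrm]; set b := B `^ a^-1 in rmE *.
have b0 : 0 <= b by exact: powR_ge0.
have r'0 : 0 <= (r + rm) / 2 by move: r0 rm0; lra.
have r'rm : (r + rm) / 2 < rm by move: rrm; lra.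
have sq s : 0 <= s -> s < rm -> s ^+ 2 < A - b.
  by move=> s0 srm; rewrite -rmE ltrXn2r// ?nnegrE// ltW.
have h1 := sq _ r0 rrm; have h2 := sq _ r'0 r'rm.
rewrite height_gt0// h2; split => //.
rewrite !heightE// -/b.
set r' := (r + rm) / 2 in r'0 r'rm h2 *.
set X := A - r ^+ 2; set X' := A - r' ^+ 2.
have Xb : b < X by rewrite /X; move: h1; lra.
have X'b : b < X' by rewrite /X'; move: h2; lra.
have XX' : X - b <= 4 * (X' - b).
  have -> : X - b = (rm - r) * (rm + r) by rewrite /X -subr_sqr rmE; ring.
  have -> : X' - b = (rm - r) / 2 * (rm + r').
    have -> : (rm - r) / 2 = rm - r' by rewrite /r'; field.
    by rewrite -subr_sqr rmE /X'; ring.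
  have -> : 4 * ((rm - r) / 2 * (rm + r')) = (rm - r) * (2 * (rm + r')) by field.
  apply: ler_wpM2l; first by rewrite subr_ge0 ltW.
  by rewrite /r'; move: r0 rm0 rrm; lra.
have X'X : X' <= X.
  rewrite lerD2l lerN2 (lerXn2r 2) ?nnegrE//; rewrite /r'; move: rrm; lra.
have X0 : 0 < X := le_lt_trans b0 Xb.
have X'0 : 0 < X' := le_lt_trans b0 X'b.
have Xp : X `^ (a - 1) <= 4 `^ a * X' `^ (a - 1).
  have [a1|a1] := leP 1 a.
    apply: (@le_trans _ _ ((4 * X') `^ (a - 1))).
      apply: ge0_ler_powR.
      - by rewrite subr_ge0.
      - exact: ltW X0.
      - by rewrite nnegrE mulr_ge0// ltW.
      - by move: XX' b0; lra.
    rewrite powRM ?(ltW X'0)//; apply: ler_wpM2r; first exact: powR_ge0.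
    by apply: ler_powR; rewrite ?ler1n//; lra.
  apply: (@le_trans _ _ (X' `^ (a - 1))).
    rewrite (_ : a - 1 = - (1 - a)); last by ring.
    by apply: ler_powRN => //; rewrite subr_ge0 ltW.
  rewrite ler_peMl ?powR_ge0//; apply: (@le_trans _ _ (4 `^ 0)); first by rewrite powRr0.
  by apply: ler_powR; rewrite ?ler1n// ltW.
have /andP[_ g1] := powR_gap a0 b0 Xb; have /andP[g2 _] := powR_gap a0 b0 X'b.
rewrite -/M in g1; rewrite -/m in g2.
apply: le_trans g1 _.
apply: (@le_trans _ _ (M * (4 `^ a * X' `^ (a - 1) * (4 * (X' - b))))).
  apply: ler_wpM2l; first exact: ltW.
  by apply: ler_pM => //; rewrite ?powR_ge0// subr_ge0 ltW.
have -> : M * (4 `^ a * X' `^ (a - 1) * (4 * (X' - b))) =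
    M / m * 4 * 4 `^ a * (m * (X' `^ (a - 1) * (X' - b))).
  by move: (4 `^ a) (X' `^ _) => P Q; field; rewrite gt_eqF.
by apply: ler_wpM2l g2; rewrite !mulr_ge0 ?invr_ge0 ?powR_ge0 ?(ltW m0) ?(ltW M0).
Qed.

Lemma height_powR_midpoint a l : 0 < a -> exists2 C, 0 < C &
  forall A B rm r, 0 <= B -> 0 < rm -> rm ^+ 2 = A - B `^ a^-1 -> 0 <= r < rm ->
  cut_powR l (height a A B r) <= C * cut_powR l (height a A B ((r + rm) / 2)).
Proof.
move=> a0; have [C C0 H] := height_midpoint a0.
(* C^l is the factor for l >= 0; for l < 0 the factor 1 is enough, because the height decreases. The
   sum covers both signs. *)
exists (1 + C `^ l); first by rewrite ltr_pwDl ?powR_ge0.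
move=> A B rm r B0 rm0 rmE rr; have [h1 h2] := H A B rm r B0 rm0 rmE rr.
have /andP[r0 rrm] := rr.
have h3 : height a A B ((r + rm) / 2) <= height a A B r.
  by apply: le_height => //; move: rrm; lra.
have h4 := lt_le_trans h1 h3; rewrite !cut_powR_pos// mulrDl mul1r.
have [l0|l0] := leP 0 l.
  apply: ler_wpDl; first exact: powR_ge0.
  by rewrite -powRM ?(ltW C0) ?(ltW h1)//; apply: ge0_ler_powR;
    rewrite ?nnegrE ?mulr_ge0 ?(ltW C0) ?(ltW h1) ?(ltW h4).
apply: ler_wpDr; first by rewrite mulr_ge0 ?powR_ge0.
by rewrite -[l]opprK; apply: ler_powRN => //; rewrite oppr_ge0 ltW.
Qed.

End gap.

(** * Comparison of weights through their tails *)

Section tails.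
Context (R : realType).
Local Notation mu := (@lebesgue_measure R).

Lemma integral_subset_zero (D E : set R) (f : R -> \bar R) : E `<=` D ->
  (forall x, D x -> ~ E x -> f x = 0%E) -> (\int[mu]_(x in D) f x = \int[mu]_(x in E) f x)%E.
Proof.
move=> ED f0; rewrite integral_mkcond [in RHS]integral_mkcond.
apply: eq_integral => x _; rewrite !patchE.
have [Ex|Ex] := pselect (E x); first by rewrite !mem_set//; exact: ED.
rewrite (memNset Ex); case: ifPn => // Dx; apply: f0 => //; exact: set_mem.
Qed.

Lemma measurable_integral_cond (T : R -> R -> bool) (K : R -> \bar R) :
  measurable_fun setT (fun q : measurableTypeR R * measurableTypeR R => T q.1 q.2) ->
  measurable_fun setT K -> (forall s, 0 <= K s)%E ->
  measurable_fun setT (fun y : R => \int[mu]_(s in [set s | T y s]) K s)%E.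
Proof.
move=> mT mK K0.
pose f (q : measurableTypeR R * measurableTypeR R) : \bar R :=
  (if T q.1 q.2 then K q.2 else 0)%E.
have mf : measurable_fun setT f.
  apply: measurable_fun_ifT => //; exact: (measurableT_comp mK measurable_snd).
have f0 q : (0 <= f q)%E by rewrite /f; case: ifP.
rewrite (_ : (fun y => _) = fun y => \int[mu]_s f (y, s))%E.
  exact: measurable_fun_fubini_tonelli_F.
apply/funext => y; rewrite integral_mkcond; apply: eq_integral => s _.
rewrite patchE /f/=; case: (boolP (T y s)) => h; first by rewrite mem_set.
by rewrite memNset//; exact/negP.
Qed.

Lemma measurable_integral_superlevel (F K : R -> \bar R) :
  measurable_fun setT F -> measurable_fun setT K -> (forall s, 0 <= K s)%E ->
  measurable_fun setT (fun y : R => \int[mu]_(s in [set s | (y%:E < F s)%E]) K s)%E.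
Proof.
move=> mF mK K0; apply: (measurable_integral_cond (T := fun y s => (y%:E < F s)%E)) => //.
apply: measurable_fun_lte; last exact: (measurableT_comp mF measurable_snd).
by apply/measurable_EFinP; exact: measurable_fst.
Qed.

(* Layer cake: the superlevel sets of [F] are half-lines. *)
Lemma le_integral_nondecreasing (C : R) (F K V : R -> \bar R) : 0 <= C ->
  measurable_fun setT F -> measurable_fun setT K -> measurable_fun setT V ->
  (forall s, 0 <= F s)%E -> (forall s, 0 <= K s)%E -> (forall s, 0 <= V s)%E ->
  (forall s t, 0 < s -> s <= t -> (F s <= F t)%E) ->
  (forall s, 0 <= s -> (\int[mu]_(t in `]s, +oo[) K t <= C%:E * \int[mu]_(t in `]s, +oo[) V t)%E) ->
  (\int[mu]_(s in `]0%R, +oo[) (K s * F s) <= C%:E * \int[mu]_(s in `]0%R, +oo[) (V s * F s))%E.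
Proof.
move=> C0 mF mK mV F0 K0 V0 ndF tail.
pose K' := K \_ (`]0%R, +oo[%classic : set R); pose V' := V \_ (`]0%R, +oo[%classic : set R).
have m_cut (G : R -> \bar R) : measurable_fun setT G -> measurable_fun setT (G \_ (`]0%R, +oo[%classic : set R)).
  by move=> mG; exact: emeasurable_patch.
have p_cut (G : R -> \bar R) : (forall s, 0 <= G s)%E -> forall s, (0 <= (G \_ (`]0%R, +oo[%classic : set R)) s)%E.
  by move=> G0 s; rewrite patchE; case: ifP.
have e_cut (G : R -> \bar R) : (\int[mu]_(s in `]0%R, +oo[) (G s * F s) = \int[mu]_s ((G \_ (`]0%R, +oo[%classic : set R)) s * F s))%E.
  rewrite integral_mkcond; apply: eq_integral => s _; rewrite !patchE.
  by case: ifP => // _; rewrite mul0e.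
rewrite !e_cut (ge0_integral_superlevel mF (m_cut _ mK) F0 (p_cut _ K0)).
rewrite (ge0_integral_superlevel mF (m_cut _ mV) F0 (p_cut _ V0)).
have sublevel y : measurable [set s | (y%:E < F s)%E].
  rewrite -[X in measurable X]setTI; apply: measurable_lte => //.
have mI (G : R -> \bar R) : measurable_fun setT G -> (forall s, 0 <= G s)%E ->
    measurable_fun (`]0%R, +oo[%classic : set R) (fun y : R => \int[mu]_(s in [set s | (y%:E < F s)%E]) (G \_ (`]0%R, +oo[%classic : set R)) s)%E.
  move=> mG G0; apply: measurable_funTS; apply: measurable_integral_superlevel => //.
    exact: m_cut.
  exact: p_cut.
rewrite -ge0_integralZl//; [|exact: mI|by move=> y _; apply: integral_ge0 => s _; exact: p_cut].
apply: ge0_le_integral => //.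
- by move=> y _; apply: integral_ge0 => s _; exact: p_cut.
- exact: mI.
- by apply: measurable_funeM; exact: mI.
move=> y _.
have cutE (G : R -> \bar R) : (\int[mu]_(s in [set s | (y%:E < F s)%E]) (G \_ (`]0%R, +oo[%classic : set R)) s =
    \int[mu]_(s in [set s | (0 < s)%R /\ (y%:E < F s)%E]) G s)%E.
  rewrite integral_mkcond [in RHS]integral_mkcond; apply: eq_integral => s _; rewrite !patchE.
  case: (boolP (0 < s)) => s0; last first.
    rewrite [s \in `]0%R, +oo[%classic]memNset ?if_same ?memNset//=.
    - by move=> [h]; rewrite h in s0.
    - by rewrite in_itv/= andbT; apply/negP.
  rewrite [s \in `]0%R, +oo[%classic]mem_set/=; last by rewrite in_itv/= s0.
  case: (boolP (y%:E < F s)%E) => Fs; first by rewrite !mem_set.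
  by rewrite !memNset//=; [move=> [_]|]; exact/negP.
rewrite !cutE; set A := [set s | _].
have mA : measurable A.
  rewrite (_ : A = `]0%R, +oo[%classic `&` [set s | (y%:E < F s)%E]); last first.
    by apply/seteqP; split => s /=; rewrite in_itv/= andbT.
  exact: measurableI.
have [[t0 At0]|A0] := pselect (A !=set0); last first.
  have -> : A = set0 by apply/seteqP; split => s // As; apply: A0; exists s.
  by rewrite !integral_set0 mule0.
have hA : has_inf A by split; [exists t0|exists 0 => s [s0 _]; exact: ltW].
(* As [F] is nondecreasing, [A] is the half-line from [sg], up to the endpoint, which is a null
   set. *)
pose sg := inf A.
have sg0 : 0 <= sg by apply: lb_le_inf; [exists t0|move=> s [s0 _]; exact: ltW].
have subA : (`]sg, +oo[ `<=` A)%classic.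
  move=> s /=; rewrite in_itv/= andbT => sgs.
  have d0 : 0 < s - sg by rewrite subr_gt0.
  have [t [t0' Ft]] := inf_adherent d0 hA; rewrite addrC subrK => ts.
  have s0 : 0 < s := le_lt_trans sg0 sgs.
  by split => //; apply: lt_le_trans Ft (ndF _ _ _ _) => //; exact: ltW.
have Asub : (A `<=` `[sg, +oo[)%classic.
  move=> s As /=; rewrite in_itv/= andbT; apply: ge_inf => //; by case: hA.
apply: (@le_trans _ _ (\int[mu]_(s in `[sg, +oo[) K s)%E).
  by apply: ge0_subset_integral => //; exact: measurable_funTS.
rewrite -integral_itv_obnd_cbnd; last exact: measurable_funTS.
apply: le_trans (tail _ sg0) _; apply: lee_wpmul2l; first by rewrite lee_fin.
by apply: ge0_subset_integral => //; exact: measurable_funTS.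
Qed.

Lemma measurable_cut_sq (l S : R) :
  measurable_fun setT (fun s : R => (`|s| * cut_powR l (S - s ^+ 2))%:E).
Proof.
apply/measurable_EFinP; apply: measurable_funM; first by apply: continuous_measurable_fun; exact: norm_continuous.
by apply: (measurableT_comp (measurable_cut_powR l)); exact: measurable_funB.
Qed.

(** S - t^2 factors as (L - t) (L + t), where L + t stays between L and 2 L; only the first factor
    is singular, and [integral_powR_le] handles it. *)
Lemma integral_cut_powR_le (l : R) : -1 < l -> exists2 C, 0 < C &
  forall S s, 0 <= s -> (\int[mu]_(t in `]s, +oo[) (`|t| * cut_powR l (S - t ^+ 2))%:E <=
    (C * cut_powR (l + 1) (S - s ^+ 2))%:E)%E.
Proof.
move=> l1; have [C C0 HC] := integral_powR_le l1.
(* (L + t)^l is at most 2^l L^l if l >= 0 and at most L^l otherwise. *)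
pose K : R := 1 + 2 `^ l; have K0 : 0 < K by rewrite ltr_pwDl ?powR_ge0.
exists (K * C); first exact: mulr_gt0.
move=> S s s0; have [sS|sS] := ltP (s ^+ 2) S; last first.
  rewrite (cut_powR_npos (l + 1)) ?subr_le0// mulr0 integral0_eq// => t.
  rewrite /= in_itv/= andbT => st; rewrite cut_powR_npos ?mulr0// subr_le0.
  by apply: le_trans sS _; rewrite lerXn2r// ?nnegrE// ?(le_trans s0)// ltW.
have S0 : 0 < S by apply: le_lt_trans sS; exact: sqr_ge0.
pose L := Num.sqrt S; have L0 : 0 < L by rewrite sqrtr_gt0.
have LE : S = L ^+ 2 by rewrite sqr_sqrtr// ltW.
have sL : s < L by rewrite -(@ltr_pXn2r _ 2) ?nnegrE ?(ltW L0)// -LE.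
rewrite (@integral_subset_zero _ `]s, L[%classic); first last.
- move=> t /=; rewrite !in_itv/= andbT => st; rewrite st/= => /negP; rewrite -leNgt => Lt.
  rewrite cut_powR_npos ?mulr0// subr_le0 LE lerXn2r// ?nnegrE ?(ltW L0)//.
  exact: le_trans (ltW L0) Lt.
- by move=> t /=; rewrite !in_itv/= andbT => /andP[].
pose D := K * L `^ (l + 1); have D0 : 0 <= D by rewrite mulr_ge0 ?powR_ge0 ?(ltW K0).
apply: (@le_trans _ _ (\int[mu]_(t in `]s, L[) (D%:E * ((L - t) `^ l)%:E))%E).
  apply: ge0_le_integral => //=.
  - by move=> t _; rewrite lee_fin mulr_ge0 ?cut_powR_ge0.
  - by apply: measurable_funTS; exact: measurable_cut_sq.
  - by apply: measurable_funeM; exact: measurable_subr_powRE.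
  move=> t; rewrite in_itv/= => /andP[st tL].
  have t0 : 0 <= t := le_trans s0 (ltW st).
  have Lt0 : 0 < L - t by rewrite subr_gt0.
  have Lt1 : 0 < L + t by rewrite ltr_wpDr.
  rewrite -EFinM lee_fin ger0_norm// cut_powR_pos; last first.
    by rewrite LE subr_sqr mulr_gt0.
  rewrite LE subr_sqr powRM ?(ltW Lt0) ?(ltW Lt1)// mulrCA mulrC; apply: ler_wpM2r; first exact: powR_ge0.
  rewrite /D powRD; last by apply/implyP => _; rewrite gt_eqF.
  rewrite powRr1 ?(ltW L0)// mulrA mulrC; apply: ler_pM => //; rewrite ?powR_ge0 ?(ltW tL)//.
  rewrite /K mulrDl mul1r; have [l0|l0] := leP 0 l.
    apply: ler_wpDl; first exact: powR_ge0.
    rewrite -powRM ?(ltW L0)//; apply: ge0_ler_powR => //; rewrite ?nnegrE ?(ltW Lt1) ?mulr_ge0 ?(ltW L0)//.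
    by move: tL; lra.
  apply: ler_wpDr; first by rewrite mulr_ge0 ?powR_ge0.
  by rewrite -[l]opprK; apply: ler_powRN; rewrite ?oppr_ge0 ?(ltW l0) ?lerDl.
rewrite ge0_integralZl//; first last.
- by move=> t _; rewrite lee_fin powR_ge0.
- exact: measurable_subr_powRE.
apply: le_trans (lee_wpmul2l _ (HC _ _ sL)) _; first by rewrite lee_fin.
rewrite -EFinM lee_fin /D cut_powR_pos ?subr_gt0//.
have -> : K * L `^ (l + 1) * (C * (L - s) `^ (l + 1)) = K * C * (L * (L - s)) `^ (l + 1).
  by rewrite powRM ?(ltW L0) ?subr_ge0 ?(ltW sL)//; ring.
apply: ler_wpM2l; first by rewrite mulr_ge0 ?(ltW K0) ?(ltW C0).
have l10 : 0 <= l + 1 by move: l1; lra.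
have Ls0 : 0 <= L - s by rewrite subr_ge0 ltW.
apply: ge0_ler_powR => //; rewrite ?nnegrE ?mulr_ge0 ?(ltW L0)//; first by rewrite subr_ge0 ltW.
by rewrite LE subr_sqr mulrC; apply: ler_wpM2l => //; rewrite lerDl.
Qed.

(** Let b be the radius where S - t^2 has dropped to half of S - s^2, and g the midpoint of s and b.
    On ]g, b[ the integrand is at least g ((S - s^2) / 2)^l, and g (b - g) = (b^2 - s^2) / 4 = (S -
    s^2) / 8. *)
Lemma le_integral_cut_powR (l : R) : 0 <= l -> exists2 C, 0 < C &
  forall S s, 0 <= s -> ((C * cut_powR (l + 1) (S - s ^+ 2))%:E <=
    \int[mu]_(t in `]s, +oo[) (`|t| * cut_powR l (S - t ^+ 2))%:E)%E.
Proof.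
move=> l0; pose C : R := 8^-1 * 2^-1 `^ l; have C0 : 0 < C by rewrite mulr_gt0 ?powR_gt0.
exists C => // S s s0.
have [sS|sS] := ltP (s ^+ 2) S; last first.
  rewrite cut_powR_npos ?subr_le0// mulr0; apply: integral_ge0 => t _.
  by rewrite lee_fin mulr_ge0 ?cut_powR_ge0.
have d0 : 0 < S - s ^+ 2 by rewrite subr_gt0.
pose b := Num.sqrt ((s ^+ 2 + S) / 2).
have bE : b ^+ 2 = (s ^+ 2 + S) / 2.
  by rewrite sqr_sqrtr// divr_ge0// addr_ge0 ?sqr_ge0// (le_trans _ (ltW sS))// sqr_ge0.
have b0 : 0 <= b by exact: sqrtr_ge0.
have sb : s < b by rewrite -(@ltr_pXn2r _ 2) ?nnegrE// bE; move: sS; lra.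
pose g := (s + b) / 2.
have sg : s < g by rewrite /g; move: sb; lra.
have gb : g < b by rewrite /g; move: sb; lra.
have g0 : 0 <= g by rewrite /g; move: s0 b0; lra.
pose v := g * ((S - s ^+ 2) / 2) `^ l.
apply: (@le_trans _ _ (\int[mu]_(t in `]g, b[) (cst v%:E t))%E).
  rewrite integral_cst//= lebesgue_measure_itv/= lte_fin gb -EFinB -EFinM lee_fin.
  rewrite /v cut_powR_pos// powRM ?(ltW d0) ?invr_ge0// powRD; last first.
    by apply/implyP => _; rewrite gt_eqF.
  rewrite powRr1 ?(ltW d0)//.
  have gE : g * (b - g) = (S - s ^+ 2) / 8.
    have -> : g * (b - g) = (b ^+ 2 - s ^+ 2) / 4 by rewrite /g; field.
    by rewrite bE; field.
  rewrite /C le_eqVlt; apply/orP; left; apply/eqP.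
  move: ((S - s ^+ 2) `^ l) (2^-1 `^ l) => Q P.
  have -> : g * (Q * P) * (b - g) = g * (b - g) * (Q * P) by ring.
  by rewrite gE; field.
apply: (@le_trans _ _ (\int[mu]_(t in `]g, b[) (`|t| * cut_powR l (S - t ^+ 2))%:E)%E).
  apply: ge0_le_integral => //=.
  - by move=> t _; rewrite lee_fin mulr_ge0 ?powR_ge0.
  - by apply: measurable_funTS; exact: measurable_cut_sq.
  move=> t; rewrite in_itv/= => /andP[gt tb].
  have t0 : 0 <= t := le_trans g0 (ltW gt).
  have tb2 : t ^+ 2 <= b ^+ 2 by rewrite lerXn2r// ?nnegrE// ltW.
  rewrite lee_fin ger0_norm// cut_powR_pos; last by move: tb2 d0; rewrite bE; lra.
  apply: ler_pM => //; rewrite ?powR_ge0// ?(ltW gt)//.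
  apply: ge0_ler_powR => //; rewrite ?nnegrE; move: tb2 d0; rewrite bE; lra.
apply: ge0_subset_integral => //=.
- by apply: measurable_funTS; exact: measurable_cut_sq.
- by move=> t _; rewrite lee_fin mulr_ge0 ?cut_powR_ge0.
by move=> t /=; rewrite !in_itv/= andbT => /andP[gt _]; exact: lt_trans gt.
Qed.

End tails.

(** * Sections of the domain in one radius *)

Section sections.
Context (R : realType).
Local Notation mu := (@lebesgue_measure R).
Implicit Types (a l A B : R) (D G M : R -> \bar R).

Lemma measurable_midpoint (rm : R) : measurable_fun setT (fun s : R => (s + rm) / 2).
Proof. by apply: measurable_funM => //; exact: measurable_funD. Qed.

Lemma integral_midpoint_le (rm : R) (f : R -> \bar R) : 0 < rm ->
  measurable_fun setT f -> (forall r, 0 <= f r)%E ->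
  (\int[mu]_(s in `]0%R, rm[) f ((s + rm) / 2)%R <= 2%:E * \int[mu]_(s in `]0%R, rm[) f s)%E.
Proof.
move=> rm0 mf f0.
have h2 : 0 < 2^-1 :> R by [].
have := ge0_integral_affine_itv (rm / 2) 0 rm h2 mf f0.
rewrite mulr0 add0r invrK => E.
have -> : (fun s => f ((s + rm) / 2)%R) = (fun s => f (2^-1 * s + rm / 2)%R).
  by apply/funext => s; congr f; field.
rewrite E; apply: lee_wpmul2l => //; apply: ge0_subset_integral => //=.
  exact: measurable_funTS.
move=> s /=; rewrite !in_itv/= => /andP[h1 h3]; apply/andP; split; first by move: h1 rm0; lra.
by move: h3; lra.
Qed.

Lemma integral_midpoint_leM (K rm : R) (f : R -> \bar R) : 0 <= K -> 0 < rm ->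
  measurable_fun setT f -> (forall r, 0 <= f r)%E ->
  (\int[mu]_(s in `]0%R, rm[) (K%:E * f ((s + rm) / 2)%R) <=
   (K * 2)%:E * \int[mu]_(s in `]0%R, rm[) f s)%E.
Proof.
move=> K0 rm0 mf f0; rewrite ge0_integralZl//; last first.
  by apply: measurable_funTS; exact: measurableT_comp mf (measurable_midpoint rm).
rewrite EFinM -muleA; apply: lee_wpmul2l; first by rewrite lee_fin.
exact: integral_midpoint_le.
Qed.

Lemma lee_mul2r (u v w z : R) (X : \bar R) : (0 <= X)%E -> u * v <= w * z ->
  (u%:E * (v%:E * X) <= w%:E * (z%:E * X))%E.
Proof.
by move=> X0 uvwz; rewrite !muleA -!EFinM; apply: lee_wpmul2r => //; rewrite lee_fin.
Qed.

(** The weight with the polar Jacobian. The absolute value keeps it nonnegative on the whole line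
    and changes nothing on ]0, +oo[. *)
Definition section_weight l a A B (r : R) : R := `|r| * cut_powR l (height a A B r).

Lemma section_weight_ge0 l a A B r : 0 <= section_weight l a A B r.
Proof. by rewrite mulr_ge0 ?cut_powR_ge0. Qed.

Lemma measurable_section_weight l a A B : measurable_fun setT (section_weight l a A B).
Proof.
apply: measurable_funM; first by apply: continuous_measurable_fun; exact: norm_continuous.
exact: measurableT_comp (measurable_cut_powR l) (measurable_height a A B).
Qed.

Lemma measurable_section_weightM l a A B G : measurable_fun setT G ->
  measurable_fun setT (fun r : R => ((section_weight l a A B r)%:E * G r)%E).
Proof.
move=> mG; apply: emeasurable_funM => //; apply/measurable_EFinP.
exact: measurable_section_weight.
Qed.

Lemma radius_exists a A B : 0 < a -> 0 <= B ->
  A - B `^ a^-1 <= 0 \/ exists2 rm : R, 0 < rm & rm ^+ 2 = A - B `^ a^-1.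
Proof.
move=> a0 B0; have [h|h] := leP (A - B `^ a^-1) 0; first by left.
by right; exists (Num.sqrt (A - B `^ a^-1)); rewrite ?sqrtr_gt0// sqr_sqrtr// ltW.
Qed.

Lemma section_cut a A B (rm : R) (f : R -> \bar R) : 0 < a -> 0 <= B ->
  0 < rm -> rm ^+ 2 = A - B `^ a^-1 ->
  (forall r, height a A B r <= 0 -> f r = 0%E) ->
  (\int[mu]_(r in `]0%R, +oo[) f r = \int[mu]_(r in `]0%R, rm[) f r)%E.
Proof.
move=> a0 B0 rm0 rmE f0; apply: integral_subset_zero.
  by move=> r /=; rewrite !in_itv/= andbT => /andP[].
move=> r /=; rewrite !in_itv/= andbT => -> /= /negP; rewrite -leNgt => rmr.
apply: f0; rewrite leNgt height_gt0// -rmE -leNgt lerXn2r// ?nnegrE ?(ltW rm0)//.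
exact: le_trans (ltW rm0) rmr.
Qed.

Lemma section_empty a A B (f : R -> \bar R) : 0 < a -> 0 <= B -> A - B `^ a^-1 <= 0 ->
  (forall r, height a A B r <= 0 -> f r = 0%E) ->
  (\int[mu]_(r in `]0%R, +oo[) f r = 0)%E.
Proof.
move=> a0 B0 h f0; apply: integral0_eq => r _; apply: f0.
by rewrite leNgt height_gt0// -leNgt (le_trans h)// sqr_ge0.
Qed.

Lemma section_weight_cut l a A B r : height a A B r <= 0 -> section_weight l a A B r = 0.
Proof. by move=> h; rewrite /section_weight cut_powR_npos// mulr0. Qed.

Lemma section_radius_le a A B (rm r : R) : 0 < a -> 0 <= B -> 0 < rm ->
  rm ^+ 2 = A - B `^ a^-1 -> 0 <= r < rm -> 0 < height a A B r.
Proof.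
move=> a0 B0 rm0 rmE /andP[r0 rrm].
by rewrite height_gt0// -rmE ltrXn2r// ?nnegrE// ltW.
Qed.

(** The midpoint is at least rm / 2, so its Jacobian controls rm, whereas the Jacobian at s may be
    arbitrarily small. *)
Lemma section_weight_midpoint a l : 0 < a -> exists2 C, 0 < C &
  forall A B (rm s : R), 0 <= B -> 0 < rm -> rm ^+ 2 = A - B `^ a^-1 -> 0 <= s < rm ->
  rm * cut_powR l (height a A B s) <= C * section_weight l a A B ((s + rm) / 2).
Proof.
move=> a0; have [C C0 HC] := height_powR_midpoint l a0; exists (2 * C); first exact: mulr_gt0.
move=> A B rm s B0 rm0 rmE srm; have /andP[s0 _] := srm.
apply: (@le_trans _ _ (rm * (C * cut_powR l (height a A B ((s + rm) / 2))))).
  by apply: ler_wpM2l; [exact: ltW|exact: HC].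
have s' : 0 <= (s + rm) / 2 by move: s0 rm0; lra.
rewrite /section_weight ger0_norm//.
move: (cut_powR _ _) (cut_powR_ge0 l (height a A B ((s + rm) / 2))) => Q Q0.
rewrite (_ : rm * (C * Q) = C * Q * rm); last by ring.
rewrite (_ : 2 * C * ((s + rm) / 2 * Q) = C * Q * (s + rm)); last by field.
by apply: ler_wpM2l; [rewrite mulr_ge0// ltW|rewrite lerDr].
Qed.

(** After Tonelli on s < r < rm, the weight at r is at most rm h(s)^l, which is where l >= 0 enters.
    The powers of rm - s then cancel exactly, and the remaining rm h(s)^l is moved to the midpoint,
    which is the argument of [M]; the substitution of the midpoint costs a factor 2. *)
Lemma integral_section_hardy a l (Cp : R) : 0 < a -> 0 <= l -> 0 < Cp ->
  exists2 C, 0 < C & forall A B G M, 0 <= B ->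
  measurable_fun setT G -> measurable_fun setT M ->
  (forall r, 0 <= G r)%E -> (forall r, 0 <= M r)%E ->
  (forall rm r, 0 < r < rm -> rm ^+ 2 = A - B `^ a^-1 ->
    (G r <= (Cp * (rm - r) `^ (- 2^-1))%:E *
       \int[mu]_(s in `]0%R, r[) (((rm - s) `^ (- 2^-1))%:E * M ((s + rm) / 2)%R))%E) ->
  (\int[mu]_(r in `]0%R, +oo[) ((section_weight l a A B r)%:E * G r) <=
   C%:E * \int[mu]_(r in `]0%R, +oo[) ((section_weight l a A B r)%:E * M r))%E.
Proof.
move=> a0 l0 Cp0.
have h1 : -1 < - 2^-1 :> R by lra.
have [CJ CJ0 HJ] := integral_powR_le h1.
have [Cm Cm0 Hm] := section_weight_midpoint l a0.
exists (Cm * Cp * CJ * 2); first by rewrite !mulr_gt0.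
move=> A B G M B0 mG mM G0 M0 HG.
have cutW X r : height a A B r <= 0 -> ((section_weight l a A B r)%:E * X = 0 :> \bar R)%E.
  by move=> h; rewrite section_weight_cut// mul0e.
have [h|[rm rm0 rmE]] := radius_exists A a0 B0.
  rewrite (section_empty a0 B0 h (fun r => cutW (G r) r)).
  rewrite (section_empty a0 B0 h (fun r => cutW (M r) r)).
  by rewrite mule0.
rewrite (section_cut a0 B0 rm0 rmE (fun r => cutW (G r) r)).
rewrite (section_cut a0 B0 rm0 rmE (fun r => cutW (M r) r)).
pose W := section_weight l a A B; pose H r := cut_powR l (height a A B r).
have HmW : forall r, 0 <= r < rm -> rm * H r <= Cm * W ((r + rm) / 2) by move=> r; exact: Hm.
have WE r : W r = `|r| * H r by [].
have H0 r : 0 <= H r by exact: cut_powR_ge0.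
have ndH r s : 0 <= r -> r <= s -> H s <= H r.
  by move=> r0 rs; apply: le_cut_powR => //; exact: le_height.
have mW : measurable_fun setT W by exact: measurable_section_weight.
have W0 r : 0 <= W r by rewrite WE mulr_ge0.
rewrite -/W; move: W H HmW WE H0 ndH mW W0 {Hm cutW} => W H HmW WE H0 ndH mW W0.
pose w r : \bar R := (W r * (Cp * (rm - r) `^ (- 2^-1)))%:E.
pose D s : \bar R := (((rm - s) `^ (- 2^-1))%:E * M ((s + rm) / 2)%R)%E.
have mw : measurable_fun setT w.
  apply/measurable_EFinP; apply: measurable_funM => //; apply: measurable_funM => //.
  exact: measurable_subr_powR.
have mM' : measurable_fun setT (fun s : R => M ((s + rm) / 2)%R).
  exact: measurableT_comp mM (measurable_midpoint rm).
have mD : measurable_fun setT D by apply: emeasurable_funM => //; exact: measurable_subr_powRE.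
have w0 r : (0 <= w r)%E by rewrite lee_fin !mulr_ge0 ?powR_ge0// ltW.
have D0 s : (0 <= D s)%E by rewrite mule_ge0 ?lee_fin ?powR_ge0.
have mT1 : measurable_fun setT (fun q : measurableTypeR R * measurableTypeR R => q.2 \in `]0%R, q.1[).
  rewrite (_ : (fun q => _) = (fun q : measurableTypeR R * measurableTypeR R => (0 < q.2) && (q.2 < q.1))).
    by apply: measurable_and; exact: measurable_fun_ltr.
  by apply/funext => q; rewrite in_itv.
have mT2 : measurable_fun setT (fun q : measurableTypeR R * measurableTypeR R => q.2 \in `]q.1, rm[).
  rewrite (_ : (fun q => _) = (fun q : measurableTypeR R * measurableTypeR R => (q.1 < q.2) && (q.2 < rm))).
    by apply: measurable_and; exact: measurable_fun_ltr.
  by apply/funext => q; rewrite in_itv.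
have mID := measurable_integral_cond (T := fun r s => s \in `]0%R, r[) mT1 mD D0.
have mIw := measurable_integral_cond (T := fun s r => r \in `]s, rm[) mT2 mw w0.
have mWG (X : R -> \bar R) : measurable_fun setT X -> measurable_fun setT (fun r : R => (W r)%:E * X r)%E.
  by move=> mX; apply: emeasurable_funM => //; exact/measurable_EFinP.
apply: (@le_trans _ _ (\int[mu]_(r in `]0%R, rm[) (w r * \int[mu]_(s in `]0%R, r[) D s))%E).
  apply: ge0_le_integral => //=.
  - by move=> r _; rewrite mule_ge0// lee_fin.
  - by apply: measurable_funTS; exact: mWG.
  - by apply: measurable_funTS; apply: emeasurable_funM.
  move=> r; rewrite in_itv/= => rr; rewrite /w EFinM -muleA.
  by apply: lee_wpmul2l; [rewrite lee_fin|exact: HG].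
rewrite ge0_integral_swap_triangle//.
have mMW := mWG _ mM.
have f0 r : (0 <= (W r)%:E * M r)%E by rewrite mule_ge0// lee_fin.
have K0 : 0 <= Cm * Cp * CJ by rewrite !mulr_ge0// ltW.
have mf' : measurable_fun setT (fun s : R => (W ((s + rm) / 2))%:E * M ((s + rm) / 2)%R)%E.
  exact: measurableT_comp mMW (measurable_midpoint rm).
apply: (@le_trans _ _ (\int[mu]_(s in `]0%R, rm[) ((Cm * Cp * CJ)%:E *
    ((W ((s + rm) / 2))%:E * M ((s + rm) / 2)%R)))%E); last first.
  exact: (integral_midpoint_leM K0 rm0 mMW f0).
apply: ge0_le_integral => //=.
- by move=> s _; rewrite mule_ge0//; apply: integral_ge0.
- by apply: measurable_funTS; apply: emeasurable_funM.
- by apply: measurable_funTS; apply: measurable_funeM.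
move=> s; rewrite in_itv/= => /andP[s0 srm].
have s0' := ltW s0.
have c0 : 0 <= rm * H s * Cp by rewrite !mulr_ge0// ltW.
have Iw : (\int[mu]_(r in `]s, rm[) w r <= (rm * H s * Cp * (CJ * (rm - s) `^ (- 2^-1 + 1)))%:E)%E.
  apply: (@le_trans _ _ (\int[mu]_(r in `]s, rm[) ((rm * H s * Cp)%:E * ((rm - r) `^ (- 2^-1))%:E))%E).
    apply: ge0_le_integral => //=.
    - exact: measurable_funTS.
    - by apply: measurable_funeM; exact: measurable_subr_powRE.
    move=> r; rewrite in_itv/= => /andP[sr rrm]; rewrite -EFinM lee_fin mulrA.
    apply: ler_wpM2r; first exact: powR_ge0.
    apply: ler_wpM2r; first exact: ltW.
    have r0 : 0 <= r := le_trans s0' (ltW sr).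
    rewrite WE ger0_norm//; apply: ler_pM => //; first exact: ltW.
    by apply: ndH => //; exact: ltW.
  rewrite ge0_integralZl//; first last.
  - by move=> r _; rewrite lee_fin powR_ge0.
  - exact: measurable_subr_powRE.
  by rewrite (EFinM (rm * H s * Cp)); apply: lee_wpmul2l; [rewrite lee_fin|exact: HJ].
apply: le_trans (lee_wpmul2l (D0 s) Iw) _.
rewrite /D muleAC -EFinM [X in (_ <= X)%E]muleA -EFinM; apply: lee_wpmul2r => //; rewrite lee_fin.
have -> : (rm - s) `^ (- 2^-1) * (rm * H s * Cp * (CJ * (rm - s) `^ (- 2^-1 + 1))) =
    rm * H s * (Cp * CJ).
  have e : (rm - s) `^ (- 2^-1) * (rm - s) `^ (- 2^-1 + 1) = 1.
    rewrite -powRD; last by apply/implyP => _; rewrite subr_eq0 gt_eqF.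
    by rewrite (_ : - 2^-1 + (- 2^-1 + 1) = 0) ?powRr0//; field.
  move: (_ `^ (- 2^-1)) (_ `^ (- 2^-1 + 1)) e => P Q e.
  by rewrite -[RHS]mulr1 -e; ring.
apply: (@le_trans _ _ (Cm * W ((s + rm) / 2) * (Cp * CJ))).
  by apply: ler_wpM2r; [rewrite mulr_ge0// ltW|apply: HmW; rewrite s0'].
by rewrite le_eqVlt; apply/orP; left; apply/eqP; ring.
Qed.

Lemma measurable_integral_section l a A B :
  measurable_fun setT (fun s : R => \int[mu]_(r in `]s, +oo[) (section_weight l a A B r)%:E)%E.
Proof.
apply: (measurable_integral_cond (T := fun s r => r \in `]s, +oo[)).
- rewrite (_ : (fun q => _) = (fun q : measurableTypeR R * measurableTypeR R => q.1 < q.2)).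
    exact: measurable_fun_ltr.
  by apply/funext => q; rewrite in_itv/= andbT.
- by apply/measurable_EFinP; exact: measurable_section_weight.
- by move=> r; rewrite lee_fin section_weight_ge0.
Qed.

(** Tonelli on the triangle s < r < rm. The inner integral is then extended to +oo, where the weight
    vanishes, so that the result no longer mentions [rm], which varies with the section. *)
Lemma integral_section_swap a l A B G D : 0 < a -> 0 <= B ->
  measurable_fun setT G -> measurable_fun setT D ->
  (forall r, 0 <= G r)%E -> (forall r, 0 <= D r)%E ->
  (forall rm r, 0 < r < rm -> rm ^+ 2 = A - B `^ a^-1 ->
    (G r <= \int[mu]_(s in `]0%R, r[) D s)%E) ->
  (\int[mu]_(r in `]0%R, +oo[) ((section_weight l a A B r)%:E * G r) <=
   \int[mu]_(s in `]0%R, +oo[) (D s * \int[mu]_(r in `]s, +oo[) (section_weight l a A B r)%:E))%E.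
Proof.
move=> a0 B0 mG mD G0 D0 HG.
have mW := measurable_section_weight l a A B.
have W0 r : (0 <= (section_weight l a A B r)%:E)%E by rewrite lee_fin section_weight_ge0.
have cutW X r : height a A B r <= 0 -> ((section_weight l a A B r)%:E * X = 0 :> \bar R)%E.
  by move=> h; rewrite section_weight_cut// mul0e.
have R0 s : (0 <= D s * \int[mu]_(r in `]s, +oo[) (section_weight l a A B r)%:E)%E.
  by rewrite mule_ge0//; apply: integral_ge0.
have [h|[rm rm0 rmE]] := radius_exists A a0 B0.
  by rewrite (section_empty a0 B0 h (fun r => cutW (G r) r)); apply: integral_ge0.
rewrite (section_cut a0 B0 rm0 rmE (fun r => cutW (G r) r)).
have mT1 : measurable_fun setT (fun q : measurableTypeR R * measurableTypeR R => q.2 \in `]0%R, q.1[).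
  rewrite (_ : (fun q => _) = (fun q : measurableTypeR R * measurableTypeR R => (0 < q.2) && (q.2 < q.1))).
    by apply: measurable_and; exact: measurable_fun_ltr.
  by apply/funext => q; rewrite in_itv.
have mID := measurable_integral_cond (T := fun r s => s \in `]0%R, r[) mT1 mD D0.
have mWE : measurable_fun setT (fun r : R => (section_weight l a A B r)%:E) by exact/measurable_EFinP.
apply: (@le_trans _ _ (\int[mu]_(r in `]0%R, rm[) ((section_weight l a A B r)%:E * \int[mu]_(s in `]0%R, r[) D s))%E).
  apply: ge0_le_integral => //=.
  - by move=> r _; rewrite mule_ge0.
  - by apply: measurable_funTS; exact: measurable_section_weightM.
  - by apply: measurable_funTS; apply: emeasurable_funM.
  by move=> r; rewrite in_itv/= => rr; apply: lee_wpmul2l => //; exact: HG rmE.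
have mT2 : measurable_fun setT (fun q : measurableTypeR R * measurableTypeR R => q.2 \in `]q.1, rm[).
  rewrite (_ : (fun q => _) = (fun q : measurableTypeR R * measurableTypeR R => (q.1 < q.2) && (q.2 < rm))).
    by apply: measurable_and; exact: measurable_fun_ltr.
  by apply/funext => q; rewrite in_itv.
have mIw := measurable_integral_cond (T := fun s r => r \in `]s, rm[) mT2 mWE W0.
have mR := measurable_integral_section l a A B.
rewrite (ge0_integral_swap_triangle rm mWE mD W0 D0).
apply: (@le_trans _ _ (\int[mu]_(s in `]0%R, rm[) (D s * \int[mu]_(r in `]s, +oo[) (section_weight l a A B r)%:E))%E).
  apply: ge0_le_integral => //=.
  - by move=> s _; rewrite mule_ge0//; apply: integral_ge0.
  - by apply: measurable_funTS; apply: emeasurable_funM.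
  - by apply: measurable_funTS; apply: emeasurable_funM.
  move=> s _; apply: lee_wpmul2l => //; apply: ge0_subset_integral => //=.
    exact: measurable_funTS.
  by move=> r /=; rewrite !in_itv/= andbT => /andP[].
apply: ge0_subset_integral => //=.
  by apply: measurable_funTS; apply: emeasurable_funM.
by move=> r /=; rewrite !in_itv/= andbT => /andP[].
Qed.

(** By [powR_gap], x^(1 - a) h with x = A - s^2 is comparable to x - B^(1 / a) = (rm - s) (rm + s).
    The formula is thus h^l times, essentially, rm times the distance to the boundary. *)
Definition reduced_weight l a A B (s : R) : R :=
  pos_part (A - s ^+ 2) `^ (1 - a) * cut_powR (l + 1) (height a A B s).

Lemma reduced_weight_ge0 l a A B s : 0 <= reduced_weight l a A B s.
Proof. by rewrite mulr_ge0 ?powR_ge0 ?cut_powR_ge0. Qed.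

Lemma measurable_pos_part_sub_sq A : measurable_fun setT (fun s : R => pos_part (A - s ^+ 2)).
Proof. by apply: measurable_maxr => //; exact: measurable_funB. Qed.

Lemma measurable_reduced_weight l a A B : measurable_fun setT (reduced_weight l a A B).
Proof.
apply: measurable_funM.
  exact: measurableT_comp (measurable_powR _) (measurable_pos_part_sub_sq A).
exact: measurableT_comp (measurable_cut_powR _) (measurable_height a A B).
Qed.

Lemma integral_reduced_weight_le a l : 0 < a ->
  exists2 C, 0 < C & forall A B D M, 0 <= B ->
  measurable_fun setT D -> measurable_fun setT M ->
  (forall r, 0 <= D r)%E -> (forall r, 0 <= M r)%E ->
  (forall rm s, 0 < s < rm -> rm ^+ 2 = A - B `^ a^-1 ->
    (D s <= (2 / (rm - s))%:E * M ((s + rm) / 2)%R)%E) ->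
  (\int[mu]_(s in `]0%R, +oo[) ((reduced_weight l a A B s)%:E * D s) <=
   C%:E * \int[mu]_(r in `]0%R, +oo[) ((section_weight l a A B r)%:E * M r))%E.
Proof.
move=> a0; have [Cm Cm0 Hm] := section_weight_midpoint l a0.
pose Ma := Num.max 1 a; have Ma0 : 0 < Ma by rewrite lt_max ltr01.
exists (4 * Ma * Cm * 2); first by rewrite !mulr_gt0.
move=> A B D M B0 mD mM D0 M0 HD.
have cutV X r : height a A B r <= 0 -> ((reduced_weight l a A B r)%:E * X = 0 :> \bar R)%E.
  by move=> h; rewrite /reduced_weight cut_powR_npos// mulr0 mul0e.
have cutW X r : height a A B r <= 0 -> ((section_weight l a A B r)%:E * X = 0 :> \bar R)%E.
  by move=> h; rewrite section_weight_cut// mul0e.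
have W0 r : (0 <= (section_weight l a A B r)%:E)%E by rewrite lee_fin section_weight_ge0.
have [h|[rm rm0 rmE]] := radius_exists A a0 B0.
  rewrite (section_empty a0 B0 h (fun r => cutV (D r) r)).
  by rewrite mule_ge0 ?lee_fin ?mulr_ge0 ?(ltW Ma0) ?(ltW Cm0)//; apply: integral_ge0 => r _; rewrite mule_ge0.
rewrite (section_cut a0 B0 rm0 rmE (fun r => cutV (D r) r)).
rewrite (section_cut a0 B0 rm0 rmE (fun r => cutW (M r) r)).
have mMW := measurable_section_weightM l a A B mM.
have f0 r : (0 <= (section_weight l a A B r)%:E * M r)%E by rewrite mule_ge0.
have K0 : 0 <= 4 * Ma * Cm by rewrite !mulr_ge0// ltW.
have mf' : measurable_fun setT (fun s : R => (section_weight l a A B ((s + rm) / 2))%:E * M ((s + rm) / 2)%R)%E.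
  exact: measurableT_comp mMW (measurable_midpoint rm).
apply: (@le_trans _ _ (\int[mu]_(s in `]0%R, rm[) ((4 * Ma * Cm)%:E *
    ((section_weight l a A B ((s + rm) / 2))%:E * M ((s + rm) / 2)%R)))%E); last first.
  exact: (integral_midpoint_leM K0 rm0 mMW f0).
apply: ge0_le_integral => //=.
- by move=> s _; rewrite mule_ge0// lee_fin reduced_weight_ge0.
- apply: measurable_funTS; apply: emeasurable_funM => //; apply/measurable_EFinP.
  exact: measurable_reduced_weight.
- by apply: measurable_funTS; apply: measurable_funeM.
move=> s; rewrite in_itv/= => srm; have /andP[s0 sr] := srm.
have V0 : (0 <= (reduced_weight l a A B s)%:E)%E by rewrite lee_fin reduced_weight_ge0.
(* The distance rm - s contained in [reduced_weight] cancels the Cauchy factor 2 / (rm - s), and the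
   rest is moved to the midpoint. *)
suff key : reduced_weight l a A B s * (2 / (rm - s)) <=
    4 * Ma * Cm * section_weight l a A B ((s + rm) / 2).
  exact: le_trans (lee_wpmul2l V0 (HD _ _ srm rmE)) (lee_mul2r (M0 _) key).
clear HD mf' mMW f0 V0 W0 cutV cutW mD mM D0 M0.
have srm' : 0 <= s < rm by rewrite (ltW s0).
have H1 := Hm A B rm s B0 rm0 rmE srm'.
have hp := section_radius_le a0 B0 rm0 rmE srm'.
have sq : s ^+ 2 < A - B `^ a^-1 by rewrite -height_gt0.
apply: (@le_trans _ _ (4 * Ma * (rm * cut_powR l (height a A B s)))); last first.
  have M40 : 0 <= 4 * Ma by rewrite mulr_ge0// ltW.
  by apply: le_trans (ler_wpM2l M40 H1) _; rewrite mulrA.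
rewrite /reduced_weight (cut_powR_pos l hp) (cut_powR_pos (l + 1) hp).
rewrite (heightE a0 B0 sq) in hp *.
set b := B `^ a^-1 in rmE sq hp *; set X := A - s ^+ 2 in hp *.
have b0 : 0 <= b by exact: powR_ge0.
have bX : b < X by rewrite /X; move: sq; lra.
have X0 : 0 < X := le_lt_trans b0 bX.
have /andP[_ g] := powR_gap a0 b0 bX; rewrite -/Ma in g.
rewrite /pos_part (@max_r _ _ 0) ?(ltW X0)//.
move: (X `^ a - b `^ a) g hp => h g hp.
rewrite powRD ?powRr1 ?(ltW hp)//; last by apply/implyP => _; rewrite gt_eqF.
have Xh : X `^ (1 - a) * h <= Ma * (X - b).
  apply: le_trans (ler_wpM2l (powR_ge0 X (1 - a)) g) _.
  rewrite mulrCA; apply: ler_wpM2l; first exact: ltW.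
  rewrite mulrA -powRD; last by apply/implyP => _; rewrite gt_eqF.
  by rewrite (_ : 1 - a + (a - 1) = 0) ?powRr0 ?mul1r//; ring.
have XbE : X - b = (rm - s) * (rm + s) by rewrite /X -subr_sqr rmE; ring.
have d0 : 0 < rm - s by rewrite subr_gt0.
have P0 : 0 <= h `^ l * (2 / (rm - s)) by rewrite mulr_ge0 ?powR_ge0 ?divr_ge0 ?(ltW d0).
have -> : X `^ (1 - a) * (h `^ l * h) * (2 / (rm - s)) = X `^ (1 - a) * h * (h `^ l * (2 / (rm - s))) by ring.
apply: le_trans (ler_wpM2r P0 Xh) _.
have -> : Ma * (X - b) * (h `^ l * (2 / (rm - s))) = 2 * Ma * h `^ l * (rm + s).
  by rewrite XbE; field; rewrite gt_eqF.
have -> : 4 * Ma * (rm * h `^ l) = 2 * Ma * h `^ l * (rm + rm) by ring.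
apply: ler_wpM2l; first by rewrite !mulr_ge0 ?powR_ge0// ltW.
by rewrite lerD2l ltW.
Qed.

End sections.

Section section_tails.
Context (R : realType).
Local Notation mu := (@lebesgue_measure R).
Implicit Types (a l A B : R).

Lemma measurable_section_weightE l a A B (D : set R) :
  measurable_fun D (fun r : R => (section_weight l a A B r)%:E).
Proof.
apply: measurable_funTS; apply/measurable_EFinP; exact: measurable_section_weight.
Qed.

(** Where the positive part truncates, both arguments are nonpositive and [cut_powR] vanishes. *)
Lemma cut_height1 l A B r : 0 <= B -> cut_powR l (height 1 A B r) = cut_powR l (A - B - r ^+ 2).
Proof.
move=> B0; rewrite /height /pos_part.
have [h|h] := leP (A - r ^+ 2) 0.
  rewrite powR0 ?oner_eq0// sub0r !cut_powR_npos//; last by rewrite oppr_le0.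
  by move: h B0; lra.
by rewrite powRr1 ?(ltW h)//; congr cut_powR; ring.
Qed.

Lemma integral_section_weight1_le l : -1 < l -> exists2 C, 0 < C &
  forall A B s, 0 <= B -> 0 <= s ->
  (\int[mu]_(r in `]s, +oo[) (section_weight l 1 A B r)%:E <=
    (C * reduced_weight l 1 A B s)%:E)%E.
Proof.
move=> l1; have [C C0 HC] := integral_cut_powR_le l1; exists C => // A B s B0 s0.
rewrite /reduced_weight subrr powRr0 mul1r cut_height1//.
apply: le_trans (HC (A - B) s s0); rewrite le_eqVlt; apply/orP; left; apply/eqP.
by apply: eq_integral => r _; rewrite /section_weight cut_height1.
Qed.

Lemma height_add a A B t r : height a A (B + t ^+ 2) r = height a A B r - t ^+ 2.
Proof. by rewrite /height opprD addrA. Qed.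

Lemma integral_section_weight_le a l : 0 < a -> 0 <= l -> exists2 C, 0 < C &
  forall A B s, 0 <= B -> 0 <= s ->
  (\int[mu]_(r in `]s, +oo[) (section_weight l a A B r)%:E <=
    (C * reduced_weight l a A B s)%:E)%E.
Proof.
move=> a0 l0; pose m := Num.min 1 a; have m0 : 0 < m by rewrite lt_min ltr01.
exists m^-1; first by rewrite invr_gt0.
move=> A B s B0 s0.
have R0 : 0 <= m^-1 * reduced_weight l a A B s.
  by rewrite mulr_ge0 ?reduced_weight_ge0// invr_ge0 ltW.
have [h|h] := leP (height a A B s) 0.
  rewrite integral0_eq// => r; rewrite /= in_itv/= andbT => sr.
  by rewrite section_weight_cut//; apply: le_trans h; apply: le_height => //; exact: ltW.
have sq : s ^+ 2 < A - B `^ a^-1 by rewrite -height_gt0.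
have hE := heightE a0 B0 sq.
pose b := B `^ a^-1; have b0 : 0 <= b by exact: powR_ge0.
pose rm := Num.sqrt (A - b).
have d0 : 0 < A - b by apply: le_lt_trans sq; exact: sqr_ge0.
have rm0 : 0 < rm by rewrite sqrtr_gt0.
have rmE : rm ^+ 2 = A - b by rewrite sqr_sqrtr// ltW.
have srm : s < rm by rewrite -(@ltr_pXn2r _ 2) ?nnegrE ?(ltW rm0)// rmE.
rewrite (@integral_subset_zero _ _ `]s, rm[%classic); first last.
- move=> r /=; rewrite !in_itv/= andbT => sr; rewrite sr/= => /negP; rewrite -leNgt => rmr.
  rewrite section_weight_cut// leNgt height_gt0// -/b -rmE -leNgt lerXn2r// ?nnegrE ?(ltW rm0)//.
  exact: le_trans (ltW rm0) rmr.
- by move=> r /=; rewrite !in_itv/= andbT => /andP[].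
have [H [HE H0]] : exists H, H = cut_powR l (height a A B s) /\ 0 <= H.
  by exists (cut_powR l (height a A B s)); split=> //; exact: cut_powR_ge0.
clear R0.
apply: (@le_trans _ _ (\int[mu]_(r in `]s, rm[) (cst (rm * H)%:E r))%E).
  clear h hE sq d0 rmE srm; apply: ge0_le_integral => //=.
  - by move=> r _; rewrite lee_fin section_weight_ge0.
  - exact: measurable_section_weightE.
  move=> r; rewrite in_itv/= => /andP[sr rrm]; rewrite lee_fin /section_weight.
  have r0 : 0 <= r := le_trans s0 (ltW sr).
  rewrite ger0_norm//; apply: ler_pM; rewrite ?cut_powR_ge0 ?(ltW rrm)//.
  by rewrite HE; apply: le_cut_powR => //; apply: le_height => //; exact: ltW.
rewrite integral_cst//= lebesgue_measure_itv/= lte_fin srm -EFinB -EFinM lee_fin.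
set X := A - s ^+ 2; have bX : b < X by rewrite /X; move: sq; rewrite -/b; lra.
have X0 : 0 < X := le_lt_trans b0 bX.
have /andP[g _] := powR_gap a0 b0 bX; rewrite -/m in g.
rewrite -/b -/X in hE; rewrite -hE in g.
rewrite /reduced_weight HE !cut_powR_pos// /pos_part -/X (@max_r _ _ 0) ?(ltW X0)//.
move: (height a A B s) h g {hE H HE H0} => y y0 g.
rewrite powRD ?powRr1 ?(ltW y0)//; last by apply/implyP => _; rewrite gt_eqF.
have Xb : X - b <= m^-1 * (X `^ (1 - a) * y).
  rewrite -ler_pdivrMl ?invr_gt0// invrK.
  apply: le_trans (ler_wpM2l (powR_ge0 X (1 - a)) g).
  have e : X `^ (1 - a) * X `^ (a - 1) = 1.
    rewrite -powRD; last by apply/implyP => _; rewrite gt_eqF.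
    by rewrite (_ : 1 - a + (a - 1) = 0) ?powRr0//; ring.
  move: (X `^ (1 - a)) (X `^ (a - 1)) e => P Q e.
  by rewrite (_ : P * (m * (Q * (X - b))) = m * (X - b) * (P * Q)); [rewrite e mulr1|ring].
have rs : rm * (rm - s) <= X - b.
  have -> : X - b = (rm + s) * (rm - s) by rewrite /X mulrC -subr_sqr rmE; ring.
  by apply: ler_wpM2r; [rewrite subr_ge0 ltW|rewrite lerDl].
have -> : rm * y `^ l * (rm - s) = rm * (rm - s) * y `^ l by ring.
apply: le_trans (ler_wpM2r (powR_ge0 y l) (le_trans rs Xb)) _.
by rewrite le_eqVlt; apply/orP; left; apply/eqP; ring.
Qed.

(** The integral in t comes first: the height is h - t^2, so the exponent rises to l + 1 >= 0, where
    [integral_section_weight_le] applies and yields x^(1 - a) h^(l + 2), h now taken at (t0, s). On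
    the right x^(1 - a) does not depend on t, and the integral of h^(l + 1) in t is bounded below by
    the same power. *)
Lemma integral_tail_section_weight_le a l : 0 < a -> -1 < l -> exists2 C, 0 < C &
  forall A B s t0, 0 <= B -> 0 <= s -> 0 <= t0 ->
  (\int[mu]_(t in `]t0, +oo[) (`|t|%:E *
      \int[mu]_(r in `]s, +oo[) (section_weight l a A (B + t ^+ 2) r)%:E) <=
   C%:E * \int[mu]_(t in `]t0, +oo[) (`|t| * reduced_weight l a A (B + t ^+ 2) s)%:E)%E.
Proof.
move=> a0 l1; have l10 : 0 <= l + 1 by move: l1; lra.
have [C1 C10 H1] := integral_cut_powR_le l1.
have [C2 C20 H2] := le_integral_cut_powR l10.
have [C3 C30 H3] := integral_section_weight_le a0 l10.
exists (C1 * C3 / C2); first by rewrite divr_gt0// mulr_gt0.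
move=> A B s t0 B0 s0 t00.
pose W (t r : R) : \bar R := (`|t| * section_weight l a A (B + t ^+ 2) r)%:E.
have W0 t r : (0 <= W t r)%E by rewrite lee_fin mulr_ge0 ?section_weight_ge0.
have mnorm : measurable_fun setT (fun x : R => `|x|).
  by apply: continuous_measurable_fun; exact: norm_continuous.
have mW : measurable_fun setT (fun q : measurableTypeR R * measurableTypeR R => W q.1 q.2).
  apply/measurable_EFinP; apply: measurable_funM.
    exact: measurableT_comp mnorm measurable_fst.
  apply: measurable_funM; first exact: measurableT_comp mnorm measurable_snd.
  apply: (measurableT_comp (measurable_cut_powR l)); rewrite /height.
  apply: measurable_funB.
    apply: (measurableT_comp (measurable_powR a)); exact: measurableT_comp (measurable_pos_part_sub_sq A) measurable_snd.
  by apply: measurable_funD => //; apply: measurable_funX.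
pose f t r : \bar R := (if (t0 < t)%R && (s < r)%R then W t r else 0)%E.
have f0 t r : (0 <= f t r)%E by rewrite /f; case: ifP.
have mf : measurable_fun setT (fun q : measurableTypeR R * measurableTypeR R => f q.1 q.2).
  apply: measurable_fun_ifT => //.
  by apply: measurable_and; exact: measurable_fun_ltr.
have E1 : (\int[mu]_(t in `]t0, +oo[) (`|t|%:E *
      \int[mu]_(r in `]s, +oo[) (section_weight l a A (B + t ^+ 2) r)%:E) = \int[mu]_t \int[mu]_r f t r)%E.
  rewrite integral_mkcond; apply: eq_integral => t _; rewrite patchE mem_setE in_itv/= andbT /f.
  case: ifPn => t0t; last by rewrite integral0_eq.
  rewrite -ge0_integralZl//; last 2 first.
  - exact: measurable_section_weightE.
  - by move=> r _; rewrite lee_fin section_weight_ge0.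
  rewrite integral_mkcond; apply: eq_integral => r _; rewrite patchE mem_setE in_itv/= andbT.
  by case: ifP => // _; rewrite /W EFinM.
have E2 : (\int[mu]_r \int[mu]_t f t r = \int[mu]_(r in `]s, +oo[) \int[mu]_(t in `]t0, +oo[) W t r)%E.
  rewrite [in RHS]integral_mkcond; apply: eq_integral => r _; rewrite patchE mem_setE in_itv/= andbT /f.
  case: ifPn => sr; last by rewrite integral0_eq// => t _; rewrite andbF.
  rewrite [in RHS]integral_mkcond; apply: eq_integral => t _; rewrite patchE mem_setE in_itv/= andbT.
  by rewrite ?sr ?andbT.
have mI : measurable_fun setT (fun r : R => \int[mu]_(t in `]t0, +oo[) W t r)%E.
  pose g (q : measurableTypeR R * measurableTypeR R) : \bar R := (if (t0 < q.1)%R then W q.1 q.2 else 0)%E.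
  have mg : measurable_fun setT g.
    by apply: measurable_fun_ifT => //; exact: measurable_fun_ltr.
  have g0 q : (0 <= g q)%E by rewrite /g; case: ifP.
  rewrite (_ : (fun r => _) = fun r => \int[mu]_t g (t, r))%E.
    exact: measurable_fun_fubini_tonelli_G.
  apply/funext => r; rewrite integral_mkcond; apply: eq_integral => t _.
  by rewrite patchE mem_setE in_itv/= andbT.
have inner r : (\int[mu]_(t in `]t0, +oo[) W t r <=
    C1%:E * (section_weight (l + 1) a A (B + t0 ^+ 2) r)%:E)%E.
  rewrite (_ : (fun t => W t r) = fun t : R => (`|r|%:E * (`|t| * cut_powR l (height a A B r - t ^+ 2))%:E)%E); last first.
    by apply/funext => t; rewrite /W /section_weight height_add -EFinM; congr (_%:E); ring.
  rewrite ge0_integralZl//; last 2 first.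
  - by apply: measurable_funTS; exact: measurable_cut_sq.
  - by move=> t _; rewrite lee_fin mulr_ge0 ?cut_powR_ge0.
  apply: le_trans (lee_wpmul2l _ (H1 (height a A B r) t0 t00)) _; first by rewrite lee_fin.
  rewrite -!EFinM lee_fin /section_weight height_add le_eqVlt; apply/orP; left; apply/eqP; ring.
rewrite E1 ge0_integral_swap// E2.
apply: (@le_trans _ _ (\int[mu]_(r in `]s, +oo[) (C1%:E * (section_weight (l + 1) a A (B + t0 ^+ 2) r)%:E))%E).
  apply: ge0_le_integral => //=.
  - by move=> r _; apply: integral_ge0.
  - exact: measurable_funTS.
  - by apply: measurable_funeM; exact: measurable_section_weightE.
have B1 : 0 <= B + t0 ^+ 2 by rewrite addr_ge0// sqr_ge0.
rewrite ge0_integralZl//; first last.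
- by rewrite lee_fin ltW.
- by move=> r _; rewrite lee_fin section_weight_ge0.
- exact: measurable_section_weightE.
apply: le_trans (lee_wpmul2l _ (H3 A _ s B1 s0)) _; first by rewrite lee_fin ltW.
pose P := pos_part (A - s ^+ 2) `^ (1 - a); have P0 : 0 <= P by exact: powR_ge0.
have low : ((P * (C2 * cut_powR (l + 1 + 1) (height a A B s - t0 ^+ 2)))%:E <=
    \int[mu]_(t in `]t0, +oo[) (`|t| * reduced_weight l a A (B + t ^+ 2) s)%:E)%E.
  rewrite EFinM; apply: le_trans (lee_wpmul2l _ (H2 (height a A B s) t0 t00)) _; first by rewrite lee_fin.
  rewrite -ge0_integralZl//; last 2 first.
  - by apply: measurable_funTS; exact: measurable_cut_sq.
  - by move=> t _; rewrite lee_fin mulr_ge0 ?cut_powR_ge0.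
  rewrite le_eqVlt; apply/orP; left; apply/eqP; apply: eq_integral => t _.
  by rewrite -EFinM /reduced_weight height_add -/P; congr (_%:E); ring.
have C0 : 0 <= C1 * C3 / C2 by rewrite divr_ge0 ?mulr_ge0 ?(ltW C10) ?(ltW C20) ?(ltW C30).
apply: le_trans (lee_wpmul2l _ low); last by rewrite lee_fin.
rewrite -!EFinM lee_fin /reduced_weight height_add -/P le_eqVlt; apply/orP; left; apply/eqP.
by move: (cut_powR _ _) => Q; field; rewrite gt_eqF.
Qed.

End section_tails.

(** * The weight of the egg domain in terms of radii *)

Section egg_radii.
Context (R : realType) (n m : nat) (a : R) (a0 : 0 < a).
Local Notation N := (n + m)%N.
Local Notation mu := (@lebesgue_measure R).
Local Notation lamN := (lebesgue_cvec R N).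
Implicit Types (x : N.-tuple R) (c : mindex N -> R[i]) (r l p : R).

Definition zsum x : R := \sum_(i < n) tnth x (lshift m i) ^+ 2.
Definition wsum x : R := \sum_(j < m) tnth x (rshift n j) ^+ 2.
Definition egg_height x : R := pos_part (1 - zsum x) `^ a - wsum x.

Lemma wsum_ge0 x : 0 <= wsum x.
Proof. by apply: sumr_ge0 => j _; exact: sqr_ge0. Qed.

Lemma zsum_tset_z i x r : zsum (tset x (lshift m i) r) = zsum (tset x (lshift m i) 0) + r ^+ 2.
Proof.
rewrite /zsum (bigD1 i)//= [in RHS](bigD1 i)//= !tnth_tset eqxx expr0n add0r addrC.
congr (_ + _); apply: eq_bigr => i' /negbTE ii.
by rewrite !tnth_tset eq_lshift ii.
Qed.

Lemma zsum_tset_w j x r : zsum (tset x (rshift n j) r) = zsum x.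
Proof. by apply: eq_bigr => i _; rewrite tnth_tset eq_lrshift. Qed.

Lemma wsum_tset_w j x r : wsum (tset x (rshift n j) r) = wsum (tset x (rshift n j) 0) + r ^+ 2.
Proof.
rewrite /wsum (bigD1 j)//= [in RHS](bigD1 j)//= !tnth_tset eqxx expr0n add0r addrC.
congr (_ + _); apply: eq_bigr => j' /negbTE jj.
by rewrite !tnth_tset eq_rshift jj.
Qed.

Lemma wsum_tset_z i x r : wsum (tset x (lshift m i) r) = wsum x.
Proof. by apply: eq_bigr => j _; rewrite tnth_tset eq_rlshift. Qed.

Lemma egg_height_z i x r : egg_height (tset x (lshift m i) r) =
  height a (1 - zsum (tset x (lshift m i) 0)) (wsum x) r.
Proof. by rewrite /egg_height /height zsum_tset_z wsum_tset_z opprD addrA. Qed.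

Lemma egg_height_w j x r l : cut_powR l (egg_height (tset x (rshift n j) r)) =
  cut_powR l (height 1 (pos_part (1 - zsum x) `^ a) (wsum (tset x (rshift n j) 0)) r).
Proof.
rewrite cut_height1 ?wsum_ge0// /egg_height zsum_tset_w wsum_tset_w.
by rewrite opprD addrA.
Qed.

(** Treats the z and w variables alike. The equality is between [cut_powR] of the heights because
    for a variable w_j the two heights may differ where both are nonpositive. *)
Lemma egg_section k : exists2 a' : R, 0 < a' & forall x, exists A, exists2 B, 0 <= B &
  forall l r, cut_powR l (egg_height (tset x k r)) = cut_powR l (height a' A B r).
Proof.
case: (split_ordP k) => i ->.
  exists a => // x; exists (1 - zsum (tset x (lshift m i) 0)), (wsum x); first exact: wsum_ge0.
  by move=> l r; rewrite egg_height_z.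
exists 1 => // x.
exists (pos_part (1 - zsum x) `^ a), (wsum (tset x (rshift n i) 0)); first exact: wsum_ge0.
by move=> l r; exact: egg_height_w.
Qed.

(** With exponent 0, [cut_powR] is the indicator of the positive reals, so [egg_section] also
    compares the signs of the heights. *)
Lemma cut_powR_gt0_eq (y z : R) : cut_powR 0 y = cut_powR 0 z -> 0 < z -> 0 < y.
Proof.
move=> E z0; move: E; rewrite (cut_powR_pos 0 z0) powRr0 /cut_powR.
by case: ifP => // _ /esym/eqP; rewrite oner_eq0.
Qed.

Lemma measurable_egg_height : measurable_fun setT egg_height.
Proof.
have msq i : measurable_fun setT (fun x : N.-tuple R => tnth x i ^+ 2).
  by apply: measurable_funX; exact: measurable_tnth.
apply: measurable_funB; last by apply: measurable_sum => j; exact: msq.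
apply: (measurableT_comp (measurable_powR a)); apply: measurable_maxr => //.
by apply: measurable_funB => //; apply: measurable_sum => i; exact: msq.
Qed.

(* h^l on the egg domain and 0 outside. *)
Definition egg_cut l x : R := cut_powR l (egg_height x).

Lemma egg_cut_ge0 l x : 0 <= egg_cut l x. Proof. exact: cut_powR_ge0. Qed.

Lemma measurable_egg_cut l : measurable_fun setT (fun x => (egg_cut l x)%:E).
Proof.
apply/measurable_EFinP.
exact: measurableT_comp (measurable_cut_powR l) measurable_egg_height.
Qed.

Definition egg_summable c := forall x, (forall i, 0 <= tnth x i) ->
  0 < egg_height x -> rsummable c x.

Lemma section_summable c x k a' A B (rm s : R) : egg_summable c -> (forall i, 0 <= tnth x i) ->
  (forall l r, cut_powR l (egg_height (tset x k r)) = cut_powR l (height a' A B r)) ->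
  0 < a' -> 0 <= B -> rm ^+ 2 = A - B `^ a'^-1 -> 0 <= s < rm -> rsummable c (tset x k s).
Proof.
move=> sc x0 E a'0 B0 rmE srm; have /andP[s0 sr] := srm.
apply: sc; first exact: tset_ge0.
apply: cut_powR_gt0_eq (E 0 s) _; apply: section_radius_le rmE srm => //.
exact: le_lt_trans s0 sr.
Qed.

Lemma section_integralE l x k a' A B (G : N.-tuple R -> \bar R) :
  (forall l r, cut_powR l (egg_height (tset x k r)) = cut_powR l (height a' A B r)) ->
  (\int[mu]_(r in `]0%R, +oo[) (r%:E * ((egg_cut l (tset x k r))%:E * G (tset x k r))) =
   \int[mu]_(r in `]0%R, +oo[) ((section_weight l a' A B r)%:E * G (tset x k r)))%E.
Proof.
move=> E; apply: eq_integral => r; rewrite mem_setE in_itv/= andbT => r0.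
by rewrite muleA -EFinM /egg_cut E /section_weight gtr0_norm.
Qed.

Lemma measurable_tmean p c : measurable_fun setT (torus_mean (pow_norm p c)).
Proof. by apply: measurable_torus_mean; [exact: measurable_pow_norm|exact: pow_norm_ge0]. Qed.

Lemma tmean_ge0 p c x : (0 <= torus_mean (pow_norm p c) x)%E.
Proof. by apply: torus_mean_ge0 => t; exact: pow_norm_ge0. Qed.

Definition egg_mean l (G : N.-tuple R -> \bar R) : \bar R :=
  (\int[lamN]_t ((egg_cut l (tnorm t))%:E * G (tnorm t)))%E.

Lemma measurable_egg_cutM l (G : N.-tuple R -> \bar R) : measurable_fun setT G ->
  measurable_fun setT (fun x => (egg_cut l x)%:E * G x)%E.
Proof. by move=> mG; apply: emeasurable_funM => //; exact: measurable_egg_cut. Qed.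

Lemma egg_cutM_ge0 l (G : N.-tuple R -> \bar R) : (forall x, 0 <= G x)%E ->
  (forall x, 0 <= (egg_cut l x)%:E * G x)%E.
Proof. by move=> G0 x; rewrite mule_ge0// lee_fin egg_cut_ge0. Qed.

Lemma le_integral_tnormZ (k : 'I_N) (C : R) (Phi Psi : N.-tuple R -> \bar R) : 0 <= C ->
  measurable_fun setT Phi -> (forall x, 0 <= Phi x)%E ->
  measurable_fun setT Psi -> (forall x, 0 <= Psi x)%E ->
  (forall x, (forall i, (0 <= tnth x i)%R) ->
    \int[mu]_(r in `]0%R, +oo[) (r%:E * Phi (tset x k r)) <=
    C%:E * \int[mu]_(r in `]0%R, +oo[) (r%:E * Psi (tset x k r)))%E ->
  (\int[lamN]_t Phi (tnorm t) <= C%:E * \int[lamN]_t Psi (tnorm t))%E.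
Proof.
move=> C0 mPhi Phi0 mPsi Psi0 H.
have mPt : measurable_fun setT (fun t => Psi (@tnorm R N t)).
  by apply: (measurableT_comp mPsi); exact: measurable_tnorm.
rewrite -(ge0_integralZl lamN measurableT mPt (fun t _ => Psi0 (tnorm t)) (_ : 0 <= C%:E)%E); last by rewrite lee_fin.
apply: (@le_integral_tnorm R N k Phi (fun x => C%:E * Psi x)%E) => //.
- exact: measurable_funeM.
- by move=> x; rewrite mule_ge0// lee_fin.
move=> x x0; apply: le_trans (H x x0) _.
have mPr : measurable_fun (`]0%R, +oo[%classic : set (measurableTypeR R)) (fun r => r%:E * Psi (tset x k r))%E.
  apply: measurable_funTS; apply: emeasurable_funM; first by apply/measurable_EFinP; exact: measurable_id.
  by apply: (measurableT_comp mPsi); apply: measurable_tset => //; exact: measurable_id.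
have Pr0 r : (`]0%R, +oo[%classic : set (measurableTypeR R)) r -> (0 <= r%:E * Psi (tset x k r))%E.
  by rewrite /= in_itv/= andbT => r0; rewrite mule_ge0// lee_fin ltW.
rewrite -(ge0_integralZl mu (measurable_itv _) mPr Pr0 (_ : 0 <= C%:E)%E); last by rewrite lee_fin.
rewrite le_eqVlt; apply/orP; left; apply/eqP; apply: eq_integral => r _.
by rewrite muleCA.
Qed.

Lemma le_egg_mean (k : 'I_N) (C l : R) (G1 G2 : N.-tuple R -> \bar R) : 0 <= C ->
  measurable_fun setT G1 -> (forall x, 0 <= G1 x)%E ->
  measurable_fun setT G2 -> (forall x, 0 <= G2 x)%E ->
  (forall x, (forall i, (0 <= tnth x i)%R) ->
    \int[mu]_(r in `]0%R, +oo[) (r%:E * ((egg_cut l (tset x k r))%:E * G1 (tset x k r))) <=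
    C%:E * \int[mu]_(r in `]0%R, +oo[) (r%:E * ((egg_cut l (tset x k r))%:E * G2 (tset x k r))))%E ->
  (egg_mean l G1 <= C%:E * egg_mean l G2)%E.
Proof.
move=> C0 mG1 G10 mG2 G20 H.
exact: (le_integral_tnormZ C0 (measurable_egg_cutM l mG1) (egg_cutM_ge0 l G10)
  (measurable_egg_cutM l mG2) (egg_cutM_ge0 l G20) H).
Qed.

Lemma le_egg_mean_section (k : 'I_N) (C l a' : R) (G1 G2 : N.-tuple R -> \bar R) : 0 <= C ->
  measurable_fun setT G1 -> (forall x, 0 <= G1 x)%E ->
  measurable_fun setT G2 -> (forall x, 0 <= G2 x)%E ->
  (forall x, (forall i, (0 <= tnth x i)%R) -> exists A B,
    (forall l r, cut_powR l (egg_height (tset x k r)) = cut_powR l (height a' A B r)) /\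
    (\int[mu]_(r in `]0%R, +oo[) ((section_weight l a' A B r)%:E * G1 (tset x k r)) <=
     C%:E * \int[mu]_(r in `]0%R, +oo[) ((section_weight l a' A B r)%:E * G2 (tset x k r)))%E) ->
  (egg_mean l G1 <= C%:E * egg_mean l G2)%E.
Proof.
move=> C0 mG1 G10 mG2 G20 H; apply: (le_egg_mean (k := k)) => // x x0.
have [A [B [E h]]] := H x x0.
by rewrite (section_integralE l G1 E) (section_integralE l G2 E).
Qed.

Lemma egg_mean_gcoef_hardy k p l : 1 < p -> 0 <= l -> exists2 C, 0 < C &
  forall c, egg_summable c ->
  (egg_mean l (torus_mean (pow_norm p (gcoef k c))) <=
   C%:E * egg_mean l (torus_mean (pow_norm p c)))%E.
Proof.
move=> p1 l0; have [a' a'0 Hs] := egg_section k.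
have Cp0 : 0 < 2 `^ p * (2 * (p - 1)) `^ (p - 1).
  by rewrite mulr_gt0 ?powR_gt0 ?mulr_gt0 ?subr_gt0.
have [C C0 HC] := integral_section_hardy a'0 l0 Cp0.
exists C => // c sc.
apply: (le_egg_mean_section (k := k) (a' := a') (ltW C0)
  (measurable_tmean _ _) (tmean_ge0 _ _) (measurable_tmean _ _) (tmean_ge0 _ _)).
move=> x x0; have [A [B B0 E]] := Hs x; exists A, B; split; first exact: E.
apply: (HC A B (radial_mean p k (gcoef k c) x) (radial_mean p k c x) B0
  (measurable_radial_mean _ _ _ _) (measurable_radial_mean _ _ _ _)
  (radial_mean_ge0 _ _ _ _) (radial_mean_ge0 _ _ _ _)).
move=> rm r rrm rmE; apply: (radial_mean_gcoef_hardy p1 x0 rrm) => s srm.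
exact: (section_summable sc x0 E a'0 B0 rmE srm).
Qed.

Lemma radial_dmean1_midpoint k c x (rm s : R) : (forall i, 0 <= tnth x i) -> 0 < s < rm ->
  (forall s, 0 <= s < rm -> rsummable c (tset x k s)) ->
  (radial_dmean 1 k c x s <= (2 / (rm - s))%:E * radial_mean 1 k c x ((s + rm) / 2))%E.
Proof.
move=> x0 /andP[s0 srm] sc.
have h1 : 0 < s < (s + rm) / 2 by apply/andP; split => //; move: srm; lra.
have h2 : 0 <= (s + rm) / 2 < rm by apply/andP; split; move: s0 srm; lra.
have := radial_dmean_cauchy (lexx 1) x0 h1 (sc _ h2).
have E : ((s + rm) / 2 - s)^-1 = 2 / (rm - s).
  by rewrite (_ : (s + rm) / 2 - s = (rm - s) / 2) ?invf_div//; field.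
rewrite E powRr1// divr_ge0// subr_ge0 ltW//.
Qed.

Lemma egg_mean_gcoef_w (j : 'I_m) l : -1 < l -> exists2 C, 0 < C &
  forall c, egg_summable c ->
  (egg_mean l (torus_mean (pow_norm 1 (gcoef (rshift n j) c))) <=
   C%:E * egg_mean l (torus_mean (pow_norm 1 c)))%E.
Proof.
move=> l1; have [C1 C10 H1] := integral_section_weight1_le l1.
have [C2 C20 H2] := integral_reduced_weight_le l (@ltr01 R).
pose k := rshift n j : 'I_N.
exists (C1 * C2); first exact: mulr_gt0.
have CC0 : 0 <= C1 * C2 by rewrite mulr_ge0// ltW.
move=> c sc.
apply: (le_egg_mean_section (k := k) (a' := 1) CC0
  (measurable_tmean _ _) (tmean_ge0 _ _) (measurable_tmean _ _) (tmean_ge0 _ _)).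
move=> x x0.
pose A : R := pos_part (1 - zsum x) `^ a; pose B := wsum (tset x k 0).
have B0 : 0 <= B by exact: wsum_ge0.
have E l' r : cut_powR l' (egg_height (tset x k r)) = cut_powR l' (height 1 A B r) by exact: egg_height_w.
exists A, B; split; first exact: E.
have sumS rm s : rm ^+ 2 = A - B `^ 1^-1 -> 0 <= s < rm -> rsummable c (tset x k s).
  by move=> rmE srm; exact: (section_summable sc x0 E ltr01 B0 rmE srm).
have S1 := @integral_section_swap R 1 l A B (radial_mean 1 k (gcoef k c) x)
  (radial_dmean 1 k c x) ltr01 B0 (measurable_radial_mean _ _ _ _) (measurable_radial_dmean _ _ _ _)
  (radial_mean_ge0 _ _ _ _) (radial_dmean_ge0 _ _ _ _).
apply: le_trans (S1 _) _.
  move=> rm r /andP[r0 rrm] rmE; apply: radial_mean1_gcoef_le => //.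
  by apply: sumS rmE _; rewrite (ltW r0).
have S3 := H2 A B (radial_dmean 1 k c x) (radial_mean 1 k c x) B0
  (measurable_radial_dmean _ _ _ _) (measurable_radial_mean _ _ _ _)
  (radial_dmean_ge0 _ _ _ _) (radial_mean_ge0 _ _ _ _).
rewrite EFinM -muleA; apply: le_trans (lee_wpmul2l _ (S3 _)); first last.
- move=> rm s srm rmE; apply: radial_dmean1_midpoint => // s' s'rm; exact: sumS rmE s'rm.
- by rewrite lee_fin ltW.
have mD := measurable_radial_dmean k 1 c x.
have D0 := radial_dmean_ge0 1 k c x.
move: (radial_dmean 1 k c x) mD D0 => D mD D0 {S1 S3 sc sumS}.
have mV : measurable_fun setT (fun s : R => (reduced_weight l 1 A B s)%:E * D s)%E.
  by apply: emeasurable_funM => //; apply/measurable_EFinP; exact: measurable_reduced_weight.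
have V0 s : (0 <= (reduced_weight l 1 A B s)%:E * D s)%E by rewrite mule_ge0// lee_fin reduced_weight_ge0.
rewrite -ge0_integralZl//; last 2 first.
- exact: measurable_funTS.
- by rewrite lee_fin ltW.
apply: ge0_le_integral => //.
- by move=> s _; rewrite mule_ge0//; apply: integral_ge0 => r _; rewrite lee_fin section_weight_ge0.
- by apply: measurable_funTS; apply: emeasurable_funM => //; exact: measurable_integral_section.
- by apply: measurable_funTS; apply: measurable_funeM.
move=> s; rewrite /= in_itv/= andbT => s0.
by rewrite muleA -EFinM muleC; apply: lee_wpmul2r => //; exact: H1 (ltW s0).
Qed.

End egg_radii.

(** * The case p = 1 for one of the z variables *)

Section egg_mean_z.
Context (R : realType) (n m : nat) (a : R) (a0 : 0 < a) (i : 'I_n) (j : 'I_m) (l : R).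
Local Notation N := (n + m)%N.
Local Notation mu := (@lebesgue_measure R).
Local Notation lamN := (lebesgue_cvec R N).
Local Notation egg_height := (@egg_height R n m a).
Local Notation egg_cut := (@egg_cut R n m a).
Local Notation zsum := (@zsum R n m).
Local Notation wsum := (@wsum R n m).
Implicit Types (x : N.-tuple R) (c : mindex N -> R[i]) (r s t : R).
Let k : 'I_N := lshift m i.
Let q : 'I_N := rshift n j.

(** Positive height leaves room to enlarge the k-th radius, here to its midpoint with rm, and the
    geometric gain absorbs the factor al_k. *)
Lemma dcoef_summable c x : egg_summable a c -> (forall i, 0 <= tnth x i) ->
  0 < egg_height x -> rsummable (dcoef k c) x.
Proof.
move=> sc x0 hx.
pose A := 1 - zsum (tset x k 0); pose B := wsum x; have B0 : 0 <= B by exact: wsum_ge0.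
have E r : egg_height (tset x k r) = height a A B r by exact: egg_height_z.
have hk : tnth x k ^+ 2 < A - B `^ a^-1 by rewrite -height_gt0// -E tsetK.
have d0 : 0 < A - B `^ a^-1 by apply: le_lt_trans hk; exact: sqr_ge0.
pose rm := Num.sqrt (A - B `^ a^-1); have rm0 : 0 < rm by rewrite sqrtr_gt0.
have rmE : rm ^+ 2 = A - B `^ a^-1 by rewrite sqr_sqrtr// ltW.
have krm : tnth x k < rm by rewrite -(@ltr_pXn2r _ 2) ?nnegrE ?(ltW rm0)// rmE.
have h1 : 0 <= tnth x k < (tnth x k + rm) / 2 by rewrite x0/=; move: krm; lra.
have h2 : 0 <= (tnth x k + rm) / 2 < rm by have := x0 k; move: krm; lra.
rewrite -[x](tsetK x k); apply: (rsummable_dcoef x0 h1).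
apply: (section_summable sc x0 (k := k) (a' := a) (A := A) (B := B) _ a0 B0 rmE h2).
by move=> l' r; rewrite E.
Qed.

(* [y `^ (-1)] rather than [y^-1], for measurability. *)
Definition dmean_density c x : \bar R :=
  ((tnth x k `^ (-1))%:E * ((tnth x k `^ (-1))%:E * torus_mean (pow_norm 1 (dcoef k c)) x))%E.

(** The tail of the weight along the k-th radius, as a function of all radii, so that polar
    coordinates can next be used in the radius of w_j. *)
Definition outer_weight x : \bar R :=
  (\int[mu]_(r in `]tnth x k, +oo[) (`|r| * egg_cut l (tset x k r))%:E)%E.

Definition inner_weight x : \bar R :=
  (pos_part (1 - zsum x) `^ (1 - a) * egg_cut (l + 1) x)%:E.

Lemma dmean_density_ge0 c x : (0 <= dmean_density c x)%E.
Proof. by rewrite !mule_ge0 ?lee_fin ?powR_ge0//; exact: tmean_ge0. Qed.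

Lemma outer_weight_ge0 x : (0 <= outer_weight x)%E.
Proof. by apply: integral_ge0 => r _; rewrite lee_fin mulr_ge0 ?egg_cut_ge0. Qed.

Lemma inner_weight_ge0 x : (0 <= inner_weight x)%E.
Proof. by rewrite lee_fin mulr_ge0 ?powR_ge0 ?egg_cut_ge0. Qed.

Lemma measurable_dmean_density c : measurable_fun setT (dmean_density c).
Proof.
have mk : measurable_fun setT (fun x : N.-tuple R => (tnth x k `^ (-1))%:E).
  apply/measurable_EFinP; apply: (measurableT_comp (measurable_powR (-1))).
  exact: measurable_tnth.
by apply: emeasurable_funM => //; apply: emeasurable_funM => //; exact: measurable_tmean.
Qed.

Lemma measurable_inner_weight : measurable_fun setT inner_weight.
Proof.
apply/measurable_EFinP; apply: measurable_funM; last first.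
  by apply/measurable_EFinP; exact: measurable_egg_cut.
apply: (measurableT_comp (measurable_powR _)); apply: measurable_maxr => //.
apply: measurable_funB => //; apply: measurable_sum => i'.
by apply: measurable_funX; exact: measurable_tnth.
Qed.

Lemma measurable_outer_weight : measurable_fun setT outer_weight.
Proof.
pose g (z : N.-tuple R * measurableTypeR R) : \bar R :=
  (if (tnth z.1 k < z.2)%R then (`|z.2| * egg_cut l (tset z.1 k z.2))%:E else 0)%E.
have mg : measurable_fun setT g.
  apply: measurable_fun_ifT => //.
    apply: measurable_fun_ltr; last exact: measurable_snd.
    exact: (measurableT_comp (@measurable_tnth _ _ _ k) measurable_fst).
  apply/measurable_EFinP; apply: measurable_funM.
    have mnorm : measurable_fun setT (fun r : R => `|r|).
      by apply: continuous_measurable_fun; exact: norm_continuous.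
    exact: (measurableT_comp mnorm measurable_snd).
  apply/measurable_EFinP; apply: (measurableT_comp (@measurable_egg_cut R n m a l)).
  by apply: measurable_tset; [exact: measurable_fst|exact: measurable_snd].
have g0 z : (0 <= g z)%E.
  by rewrite /g; case: ifP => // _; rewrite lee_fin mulr_ge0 ?egg_cut_ge0.
rewrite (_ : outer_weight = fun x => \int[mu]_r g (x, r))%E.
  exact: measurable_fun_fubini_tonelli_F.
apply/funext => x; rewrite /outer_weight integral_mkcond; apply: eq_integral => r _.
by rewrite patchE mem_setE in_itv/= andbT.
Qed.

(** One of the two factors s^-1 of the density cancels the polar Jacobian; the other is that of
    [radial_dmean]. *)
Lemma dmean_density_tset c x s (X : \bar R) : 0 < s ->
  (s%:E * (dmean_density c (tset x k s) * X) = radial_dmean 1 k c x s * X)%E.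
Proof.
move=> s0; rewrite /dmean_density /radial_dmean /radial_mean tnth_tset eqxx.
move: (torus_mean _ _) => T.
rewrite powR_inv1 ?(ltW s0)// powRr1 ?invr_ge0 ?(ltW s0)//.
have ss : (s%:E * (s^-1)%:E = 1)%E by rewrite -EFinM divff// gt_eqF.
by rewrite !muleA ss mul1e.
Qed.

Lemma egg_height_zw x t r : egg_height (tset (tset x q t) k r) =
  height a (1 - zsum (tset x k 0)) (wsum (tset x q 0) + t ^+ 2) r.
Proof.
rewrite egg_height_z wsum_tset_w; congr (height a (1 - _)).
by apply: eq_bigr => i' _; rewrite !tnth_tset eq_lrshift.
Qed.

Lemma outer_weight_k x s : outer_weight (tset x k s) =
  (\int[mu]_(r in `]s, +oo[) (section_weight l a (1 - zsum (tset x k 0)) (wsum x) r)%:E)%E.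
Proof.
rewrite /outer_weight tnth_tset eqxx; apply: eq_integral => r _.
by rewrite tset_tset /egg_cut egg_height_z.
Qed.

Lemma inner_weight_k x s : inner_weight (tset x k s) =
  (reduced_weight l a (1 - zsum (tset x k 0)) (wsum x) s)%:E.
Proof.
by rewrite /inner_weight /reduced_weight /egg_cut egg_height_z (zsum_tset_z i x s) opprD addrA.
Qed.

Lemma outer_weight_q x t : outer_weight (tset x q t) =
  (\int[mu]_(r in `]tnth x k, +oo[)
    (section_weight l a (1 - zsum (tset x k 0)) (wsum (tset x q 0) + t ^+ 2) r)%:E)%E.
Proof.
rewrite /outer_weight tnth_tset eq_lrshift; apply: eq_integral => r _.
by rewrite /egg_cut egg_height_zw.
Qed.

Lemma egg_height_q x t : egg_height (tset x q t) =
  height a (1 - zsum (tset x k 0)) (wsum (tset x q 0) + t ^+ 2) (tnth x k).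
Proof.
by rewrite -egg_height_zw; congr egg_height; rewrite -[LHS](tsetK _ k) tnth_tset eq_lrshift.
Qed.

Lemma inner_weight_q x t : inner_weight (tset x q t) =
  (reduced_weight l a (1 - zsum (tset x k 0)) (wsum (tset x q 0) + t ^+ 2) (tnth x k))%:E.
Proof.
rewrite /inner_weight /reduced_weight /egg_cut egg_height_q; congr (pos_part _ `^ _ * _)%:E.
by rewrite zsum_tset_w -{1}(tsetK x k) (zsum_tset_z i x (tnth x k)) opprD addrA.
Qed.

Hypothesis l1 : -1 < l.

(** Polar coordinates in the k-th variable and Tonelli along its radius. The bound is again written
    as an integral over the whole space, which allows a second choice of polar variable. *)
Lemma egg_mean_gcoef_le_outer c : egg_summable a c ->
  (egg_mean a l (torus_mean (pow_norm 1 (gcoef k c))) <=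
   \int[lamN]_t (dmean_density c (tnorm t) * outer_weight (tnorm t)))%E.
Proof.
move=> sc; apply: (@le_integral_tnorm R N k (fun x => (egg_cut l x)%:E * torus_mean (pow_norm 1 (gcoef k c)) x)%E
  (fun x => dmean_density c x * outer_weight x)%E).
- exact: measurable_egg_cutM (measurable_tmean _ _).
- exact: egg_cutM_ge0 (tmean_ge0 _ _).
- exact: emeasurable_funM (measurable_dmean_density c) measurable_outer_weight.
- by move=> x; exact: mule_ge0 (dmean_density_ge0 c x) (outer_weight_ge0 x).
move=> x x0.
pose A := 1 - zsum (tset x k 0); pose B := wsum x; have B0 : 0 <= B by exact: wsum_ge0.
have E l' r : cut_powR l' (egg_height (tset x k r)) = cut_powR l' (height a A B r).
  by rewrite egg_height_z.
rewrite (section_integralE l (torus_mean (pow_norm 1 (gcoef k c))) E).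
have S1 := @integral_section_swap R a l A B (radial_mean 1 k (gcoef k c) x)
  (radial_dmean 1 k c x) a0 B0 (measurable_radial_mean _ _ _ _) (measurable_radial_dmean _ _ _ _)
  (radial_mean_ge0 _ _ _ _) (radial_dmean_ge0 _ _ _ _).
have S2 : (\int[mu]_(s in `]0%R, +oo[) (s%:E * (dmean_density c (tset x k s) * outer_weight (tset x k s))) =
    \int[mu]_(s in `]0%R, +oo[) (radial_dmean 1 k c x s * \int[mu]_(r in `]s, +oo[) (section_weight l a A B r)%:E))%E.
  apply: eq_integral => s; rewrite mem_setE in_itv/= andbT => s0.
  by rewrite (dmean_density_tset c x _ s0) outer_weight_k.
rewrite S2; apply: S1 => rm r /andP[r0 rrm] rmE.
apply: (radial_mean1_gcoef_le x0 r0).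
by apply: (section_summable sc x0 E a0 B0 rmE); rewrite (ltW r0).
Qed.

(** Back to the k-th radius: here the Cauchy estimate at the midpoint is paid for by the additional
    power of h in [inner_weight]. *)
Lemma inner_le_egg_mean : exists2 C, 0 < C & forall c, egg_summable a c ->
  (\int[lamN]_t (dmean_density c (tnorm t) * inner_weight (tnorm t)) <=
   C%:E * egg_mean a l (torus_mean (pow_norm 1 c)))%E.
Proof.
have [C C0 HC] := integral_reduced_weight_le l a0; exists C => // c sc.
apply: (@le_integral_tnormZ R n m k C (fun x => dmean_density c x * inner_weight x)%E
  (fun x => (egg_cut l x)%:E * torus_mean (pow_norm 1 c) x)%E (ltW C0)).
- exact: emeasurable_funM (measurable_dmean_density c) measurable_inner_weight.
- by move=> x; exact: mule_ge0 (dmean_density_ge0 c x) (inner_weight_ge0 x).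
- exact: measurable_egg_cutM (measurable_tmean _ _).
- exact: egg_cutM_ge0 (tmean_ge0 _ _).
move=> x x0.
pose A := 1 - zsum (tset x k 0); pose B := wsum x; have B0 : 0 <= B by exact: wsum_ge0.
have E l' r : cut_powR l' (egg_height (tset x k r)) = cut_powR l' (height a A B r).
  by rewrite egg_height_z.
rewrite (section_integralE l (torus_mean (pow_norm 1 c)) E).
have S3 := HC A B (radial_dmean 1 k c x) (radial_mean 1 k c x) B0
  (measurable_radial_dmean _ _ _ _) (measurable_radial_mean _ _ _ _)
  (radial_dmean_ge0 _ _ _ _) (radial_mean_ge0 _ _ _ _).
have S2 : (\int[mu]_(s in `]0%R, +oo[) (s%:E * (dmean_density c (tset x k s) * inner_weight (tset x k s))) =
    \int[mu]_(s in `]0%R, +oo[) ((reduced_weight l a A B s)%:E * radial_dmean 1 k c x s))%E.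
  apply: eq_integral => s; rewrite mem_setE in_itv/= andbT => s0.
  by rewrite (dmean_density_tset c x _ s0) inner_weight_k muleC.
rewrite S2; apply: S3 => rm s srm rmE; apply: (radial_dmean1_midpoint x0 srm) => s' s'rm.
exact: (section_summable sc x0 E a0 B0 rmE s'rm).
Qed.

Lemma outer_le_inner : exists2 C, 0 < C & forall c, egg_summable a c ->
  (\int[lamN]_t (dmean_density c (tnorm t) * outer_weight (tnorm t)) <=
   C%:E * \int[lamN]_t (dmean_density c (tnorm t) * inner_weight (tnorm t)))%E.
Proof.
have [C C0 HC] := integral_tail_section_weight_le a0 l1; exists C => // c sc.
apply: (@le_integral_tnormZ R n m q C (fun x => dmean_density c x * outer_weight x)%E
  (fun x => dmean_density c x * inner_weight x)%E (ltW C0)).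
- exact: emeasurable_funM (measurable_dmean_density c) measurable_outer_weight.
- by move=> x; exact: mule_ge0 (dmean_density_ge0 c x) (outer_weight_ge0 x).
- exact: emeasurable_funM (measurable_dmean_density c) measurable_inner_weight.
- by move=> x; exact: mule_ge0 (dmean_density_ge0 c x) (inner_weight_ge0 x).
move=> x x0.
pose A := 1 - zsum (tset x k 0); pose B := wsum (tset x q 0).
have B0 : 0 <= B by exact: wsum_ge0.
pose G t : \bar R := dmean_density c (tset x q t).
have G0 t : (0 <= G t)%E by exact: dmean_density_ge0.
have mset : measurable_fun setT (fun t : R => tset x q t : N.-tuple R).
  by apply: measurable_tset => //; exact: measurable_id.
have mG : measurable_fun setT G by exact: measurableT_comp (measurable_dmean_density c) mset.
pose H t : R := height a A (B + t ^+ 2) (tnth x k).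
have mH : measurable_fun setT H.
  by apply: measurable_funB => //; apply: measurable_funD => //; exact: measurable_funX.
(* The k-th radius is fixed here, so this is the growth in the q-th radius of the mean of
   [dcoef k c], whose series converges wherever the height is positive. *)
have ndG s t : 0 < s -> s <= t -> 0 < H t -> (G s <= G t)%E.
  move=> s0 st Ht; rewrite /G /dmean_density !tnth_tset eq_lrshift.
  have y0 : forall i, 0 <= tnth (tset x q t) i by apply: tset_ge0 => //; exact: le_trans (ltW s0) st.
  have sy : rsummable (dcoef k c) (tset x q t) by apply: dcoef_summable => //; rewrite egg_height_q.
  have st' : 0 <= s <= t by rewrite (ltW s0).
  have h := le_radial_mean (lexx 1) x0 st' sy.
  have P0 : (0 <= (tnth x k `^ (-1))%:E)%E by rewrite lee_fin powR_ge0.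
  exact: (lee_wpmul2l P0 (lee_wpmul2l P0 h)).
have ndH s t : 0 < s -> s <= t -> 0 < H t -> 0 < H s.
  move=> s0 st; move=> h; apply: lt_le_trans h _; rewrite /H !height_add lerD2l lerN2.
  by rewrite lerXn2r// ?nnegrE ltW// (lt_le_trans s0).
pose K t : \bar R := (`|t|%:E * \int[mu]_(r in `]tnth x k, +oo[) (section_weight l a A (B + t ^+ 2) r)%:E)%E.
pose V t : \bar R := (`|t| * reduced_weight l a A (B + t ^+ 2) (tnth x k))%:E.
have KE t : 0 < t -> (t%:E * (dmean_density c (tset x q t) * outer_weight (tset x q t)) = K t * G t)%E.
  by move=> t0; rewrite outer_weight_q /K gtr0_norm// [(G t)]/G muleCA muleC.
have VE t : 0 < t -> (t%:E * (dmean_density c (tset x q t) * inner_weight (tset x q t)) = V t * G t)%E.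
  by move=> t0; rewrite inner_weight_q /V gtr0_norm// EFinM [(G t)]/G muleCA muleC.
have mK : measurable_fun setT K.
  apply: emeasurable_funM.
    by apply/measurable_EFinP; apply: continuous_measurable_fun; exact: norm_continuous.
  rewrite (_ : (fun t => _) = fun t : R => outer_weight (tset x q t)).
    exact: measurableT_comp measurable_outer_weight mset.
  by apply/funext => t; rewrite outer_weight_q.
have mV : measurable_fun setT V.
  rewrite (_ : V = fun t : R => (`|t|%:E * inner_weight (tset x q t))%E); last first.
    by apply/funext => t; rewrite inner_weight_q -EFinM.
  apply: emeasurable_funM.
    by apply/measurable_EFinP; apply: continuous_measurable_fun; exact: norm_continuous.
  exact: measurableT_comp measurable_inner_weight mset.
have K0 t : (0 <= K t)%E.
  by rewrite mule_ge0 ?lee_fin//; apply: integral_ge0 => r _; rewrite lee_fin section_weight_ge0.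
have V0 t : (0 <= V t)%E by rewrite lee_fin mulr_ge0 ?reduced_weight_ge0.
have Kz t : H t <= 0 -> K t = 0%E.
  move=> Ht; rewrite /K integral0_eq ?mule0// => r; rewrite /= in_itv/= andbT => kr.
  by rewrite section_weight_cut//; apply: le_trans Ht; apply: le_height => //; exact: ltW.
have Vz t : H t <= 0 -> V t = 0%E.
  by move=> Ht; rewrite /V /reduced_weight cut_powR_npos// !mulr0.
have tails s : 0 <= s -> (\int[mu]_(t in `]s, +oo[) K t <= C%:E * \int[mu]_(t in `]s, +oo[) V t)%E.
  by move=> s0; exact: HC.
rewrite (_ : (\int[mu]_(t in _) _ = \int[mu]_(t in `]0%R, +oo[) (K t * G t))%E); last first.
  by apply: eq_integral => t; rewrite mem_setE in_itv/= andbT => /KE.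
rewrite [X in (_ <= _ * X)%E](_ : _ = (\int[mu]_(t in `]0%R, +oo[) (V t * G t))%E); last first.
  by apply: eq_integral => t; rewrite mem_setE in_itv/= andbT => /VE.
move: K V G H mG mH G0 ndG ndH mK mV K0 V0 Kz Vz tails {KE VE HC mset} => K V G H mG mH G0 ndG ndH mK mV K0 V0 Kz Vz tails.
(* [G] is only known to increase inside the domain, outside of which [K] and [V] vanish. *)
pose F t : \bar R := (if (0 < H t)%R then G t else +oo)%E.
have FE (X : R -> \bar R) : (forall t, H t <= 0 -> X t = 0%E) ->
    (\int[mu]_(t in `]0%R, +oo[) (X t * G t) = \int[mu]_(t in `]0%R, +oo[) (X t * F t))%E.
  move=> Xz; apply: eq_integral => t _; rewrite /F; case: ifPn => //.
  by rewrite -leNgt => /Xz ->; rewrite !mul0e.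
rewrite (FE K Kz) (FE V Vz); apply: le_integral_nondecreasing => //.
- exact: ltW.
- by apply: measurable_fun_ifT => //; exact: measurable_fun_ltr.
- by move=> s; rewrite /F; case: ifP => // _; rewrite leey.
move=> s t s0 st; rewrite /F; case: (ltP 0 (H t)) => Ht; last by rewrite leey.
by rewrite (ndH s t s0 st Ht); exact: ndG.
Qed.

Lemma egg_mean_gcoef_z : exists2 C, 0 < C & forall c, egg_summable a c ->
  (egg_mean a l (torus_mean (pow_norm 1 (gcoef k c))) <=
   C%:E * egg_mean a l (torus_mean (pow_norm 1 c)))%E.
Proof.
have [C1 C10 H1] := outer_le_inner; have [C2 C20 H2] := inner_le_egg_mean.
exists (C1 * C2); first exact: mulr_gt0.
move=> c sc; apply: le_trans (egg_mean_gcoef_le_outer sc) _.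
apply: le_trans (H1 c sc) _; rewrite EFinM -muleA.
by apply: lee_wpmul2l; [rewrite lee_fin ltW|exact: H2].
Qed.

End egg_mean_z.

(** * From radii back to the Bergman space *)

Section bergman_egg.
Context (R : realType) (n m : nat) (a : R) (a0 : 0 < a).
Local Notation N := (n + m)%N.
Local Notation nc := (@Normc.normc R).
Local Notation plane := (measurableTypeR R * measurableTypeR R)%type.
Local Notation lamN := (lebesgue_cvec R N).
Implicit Types (x : N.-tuple R) (c : mindex N -> R[i]) (t : N.-tuple plane) (xi : 'rV[R[i]]_N).

Lemma enorm_sq p (z : 'rV[R[i]]_p) : enorm z ^+ 2 = \sum_j nc (z ord0 j) ^+ 2.
Proof. by rewrite sqr_sqrtr//; apply: sumr_ge0 => j _; exact: sqr_ge0. Qed.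

Lemma normc_cvec t i : nc (cvec t ord0 i) = tnth (tnorm t) i.
Proof. by rewrite mxE normc_cplx tnth_mktuple. Qed.

Lemma enorm_zsum t : enorm (lsubmx (cvec t)) ^+ 2 = zsum (tnorm t).
Proof. by rewrite enorm_sq; apply: eq_bigr => i _; rewrite mxE normc_cvec. Qed.

Lemma enorm_wsum t : enorm (rsubmx (cvec t)) ^+ 2 = wsum (tnorm t).
Proof. by rewrite enorm_sq; apply: eq_bigr => i _; rewrite mxE normc_cvec. Qed.

Lemma eggE t : egg a (cvec t) <-> 0 < egg_height a (tnorm t).
Proof.
have v0 : 0 <= enorm (rsubmx (cvec t)) by exact: sqrtr_ge0.
have -> : egg_height a (tnorm t) = height a 1 (wsum (tnorm t)) (enorm (lsubmx (cvec t))).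
  by rewrite /egg_height /height enorm_zsum.
rewrite height_gt0// ?wsum_ge0// ltrBrDr -enorm_wsum /egg/=.
by rewrite -(powR_mulrn 2 v0) -powRrM.
Qed.

Lemma egg_weightE t : egg a (cvec t) -> egg_weight a (cvec t) = egg_height a (tnorm t).
Proof.
move=> et; rewrite /egg_weight /egg_height enorm_zsum enorm_wsum /pos_part (@max_r _ _ 0)//.
rewrite subr_ge0 -enorm_zsum; move: et; rewrite /egg/= => h.
by apply: le_trans (ltW h); rewrite lerDl powR_ge0.
Qed.

Definition split_cvec xi : N.-tuple plane :=
  [tuple (complex.Re (xi ord0 i), complex.Im (xi ord0 i)) | i < N].

Lemma split_cvecK xi : cvec (split_cvec xi) = xi.
Proof.
apply/rowP => i; rewrite mxE tnth_mktuple/=; by case: (xi ord0 i).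
Qed.

Definition enlarge x (e : R) : N.-tuple R := [tuple tnth x i + e | i < N].

(** The domain is open, in the form required by [differentiable_power_series]: a whole polydisc
    about the point has its radii in the domain. [powR_gap] bounds the loss of height caused by a
    larger [zsum]. *)
Lemma egg_height_enlarge x : (forall i, 0 <= tnth x i) -> 0 < egg_height a x ->
  exists2 e, 0 < e & 0 < egg_height a (enlarge x e).
Proof.
move=> x0 hx.
(* For e <= 1, (x_i + e)^2 <= x_i^2 + e (2 x_i + 1); thus [zsum] and [wsum] each grow by at most e
   K. *)
pose K : R := \sum_i (2 * tnth x i + 1).
have K0 : 0 <= K by apply: sumr_ge0 => i _; rewrite addr_ge0// mulr_ge0.
have Y0 : 0 < 1 - zsum x.
  rewrite ltNge; apply/negP => Y; move: hx.
  by rewrite /egg_height /pos_part (@max_l _ _ 0)// powR0 ?gt_eqF// sub0r oppr_gt0 ltNge wsum_ge0.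
set Y := 1 - zsum x in Y0.
pose M := Num.max 1 a * Y `^ (a - 1); have M0 : 0 <= M.
  by rewrite mulr_ge0 ?powR_ge0// le_max ler01.
pose D := M * K + K + 1; have D0 : 0 < D.
  by rewrite ltr_wpDl// addr_ge0// mulr_ge0.
(* The three bounds ensure e <= 1, e K < Y and e D below the height, where e D exceeds the total
   loss M e K + e K; the division by 2 makes the last two strict. *)
pose e := Num.min 1 (Num.min (Y / (K + 1)) (egg_height a x / D)) / 2.
have K1 : 0 < K + 1 by rewrite ltr_wpDl.
have e0 : 0 < e by rewrite divr_gt0// !lt_min ltr01 !divr_gt0.
have em : 2 * e <= Num.min 1 (Num.min (Y / (K + 1)) (egg_height a x / D)).
  by rewrite /e mulrC divfK.
move: em; rewrite !le_min => /and3P[e1 eY eD].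
exists e => //.
have part p (f : 'I_p -> 'I_N) : \sum_(i < p) (2 * tnth x (f i) + 1) <= K ->
    \sum_(i < p) (tnth x (f i) + e) ^+ 2 <= \sum_(i < p) tnth x (f i) ^+ 2 + e * K.
  move=> fK; apply: (@le_trans _ _ (\sum_(i < p) (tnth x (f i) ^+ 2 + e * (2 * tnth x (f i) + 1)))).
    apply: ler_sum => i _; rewrite sqrrD -addrA lerD2l -mulr_natl mulrDr mulr1.
    have -> : e * (2 * tnth x (f i)) = 2 * (tnth x (f i) * e) by ring.
    by rewrite lerD2l expr2 ger_pMr//; move: e1 e0; lra.
  by rewrite big_split/= lerD2l -mulr_sumr; apply: ler_wpM2l => //; exact: ltW.
have nn p (f : 'I_p -> 'I_N) : 0 <= \sum_(i < p) (2 * tnth x (f i) + 1).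
  by apply: sumr_ge0 => i _; rewrite addr_ge0// mulr_ge0.
have KE : K = \sum_(i < n) (2 * tnth x (lshift m i) + 1) + \sum_(j < m) (2 * tnth x (rshift n j) + 1).
  by rewrite /K big_split_ord.
have zK : zsum (enlarge x e) <= zsum x + e * K.
  rewrite /zsum; under eq_bigr do rewrite tnth_mktuple.
  by apply: part; rewrite KE lerDl.
have wK : wsum (enlarge x e) <= wsum x + e * K.
  rewrite /wsum; under eq_bigr do rewrite tnth_mktuple.
  by apply: part; rewrite KE lerDr.
have eK0 : 0 <= e * K by rewrite mulr_ge0// ltW.
have eKY : e * K < Y.
  have : 2 * e * (K + 1) <= Y by rewrite -ler_pdivlMr.
  by move: e0 eK0; rewrite mulrDr; lra.
have h1 : Y - e * K <= 1 - zsum (enlarge x e) by rewrite /Y; move: zK; lra.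
have Yd0 : 0 < Y - e * K by rewrite subr_gt0.
have hp : (Y - e * K) `^ a <= pos_part (1 - zsum (enlarge x e)) `^ a.
  rewrite /pos_part (@max_r _ _ 0) ?(le_trans (ltW Yd0))//.
  by apply: ge0_ler_powR; rewrite ?nnegrE ?(ltW a0) ?(ltW Yd0) ?(le_trans (ltW Yd0)).
have gap : Y `^ a - (Y - e * K) `^ a <= M * (e * K).
  have [eK|eK] := eqVneq (e * K) 0; first by rewrite eK subr0 subrr mulr0.
  have lt : Y - e * K < Y by rewrite gtrBl lt_neqAle eq_sym eK.
  have /andP[_] := powR_gap a0 (ltW Yd0) lt.
  by rewrite (_ : Y - (Y - e * K) = e * K) ?mulrA//; ring.
have hE : egg_height a x = Y `^ a - wsum x.
  by rewrite /egg_height /pos_part (@max_r _ _ 0)// ltW.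
have De : e * D < egg_height a x.
  have : 2 * e * D <= egg_height a x by rewrite -ler_pdivlMr.
  have : 0 < e * D by exact: mulr_gt0.
  by move=> h h'; apply: lt_le_trans h'; rewrite -mulrA ltr_pMl// ltr1n.
have DE : e * D = M * (e * K) + e * K + e by rewrite /D; ring.
rewrite /egg_height; move: De hp gap wK; rewrite DE hE.
by move: (M * (e * K)) (e * K) (_ `^ a) ((Y - _) `^ a) => u v w y; lra.
Qed.

Lemma egg_integralE p l c (f : 'rV[R[i]]_N -> R[i]) : 0 < p ->
  (forall t, egg a (cvec t) -> csummable (term c t) /\ f (cvec t) = csum (term c t)) ->
  (\int[lamN]_(t in @cvec R N @^-1` egg a)
     (egg_weight a (cvec t) `^ l * nc (f (cvec t)) `^ p)%:E =
   \int[lamN]_t ((egg_cut a l (tnorm t))%:E * pow_norm p c t))%E.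
Proof.
move=> p0 H; rewrite integral_mkcond; apply: eq_integral => t _; rewrite patchE.
have [et|et] := pselect (egg a (cvec t)).
  rewrite mem_set//; have [h1 h2] := H t et.
  rewrite (pow_normE p0 h1) h2 egg_weightE// -EFinM /egg_cut cut_powR_pos//; exact/eggE.
rewrite memNset// /egg_cut cut_powR_npos ?mul0e// leNgt.
by apply/negP => h; apply: et; exact/eggE.
Qed.

Lemma egg_mean_torus p l c :
  egg_mean a l (torus_mean (pow_norm p c)) =
  (lamN (@pdisc R N) * \int[lamN]_t ((egg_cut a l (tnorm t))%:E * pow_norm p c t))%E.
Proof.
apply: (integral_torus_mean (W := fun x => (egg_cut a l x)%:E)).
- exact: measurable_egg_cut.
- by move=> x; rewrite lee_fin egg_cut_ge0.
- exact: measurable_pow_norm.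
- by move=> t; exact: pow_norm_ge0.
Qed.

Lemma egg_mean_gcoef_le p l (k : 'I_N) : (0 < m)%N ->
  (1 < p /\ 0 <= l) \/ (p = 1 /\ -1 < l) -> exists2 C, 0 < C &
  forall c, egg_summable a c ->
  (egg_mean a l (torus_mean (pow_norm p (gcoef k c))) <=
   C%:E * egg_mean a l (torus_mean (pow_norm p c)))%E.
Proof.
move=> m0 [[p1 l0]|[-> l1]]; first exact: egg_mean_gcoef_hardy.
case: (split_ordP k) => i ->; last exact: egg_mean_gcoef_w.
(* Any w_j can be the auxiliary variable; m >= 1 provides the first one. *)
exact: (egg_mean_gcoef_z a0 i (Ordinal m0) l1).
Qed.

(** The series is evaluated at the point whose coordinates are the radii themselves, where unordered
    convergence is absolute. *)
Lemma egg_summable_taylor c (f : 'rV[R[i]]_N -> R[i]) :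
  taylor_expansion_on (egg a) c f -> egg_summable a c.
Proof.
move=> cf x x0 hx; pose t : N.-tuple plane := [tuple (tnth x i, 0) | i < N].
have tx : tnorm t = x.
  apply: eq_from_tnth => i; rewrite !tnth_mktuple /plane_norm/= expr0n addr0 sqrtr_sqr.
  by rewrite ger0_norm.
have et : egg a (cvec t) by apply/eggE; rewrite tx.
have /totally_cvgP/has_csum_csummable[B HB] := cf _ et.
exists B => A; apply: le_trans (HB A); rewrite le_eqVlt; apply/orP; left; apply/eqP.
by apply: eq_bigr => al _; rewrite /= Normc.normcM normc_monomial tx.
Qed.

Lemma rsummable_gcoef k c x : (forall i, 0 <= tnth x i) -> rsummable c x -> rsummable (gcoef k c) x.
Proof.
by move=> x0; apply: (rsummable_le x0 ler01) => al; rewrite mul1r; exact: normc_gcoef.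
Qed.

End bergman_egg.

(** [P] will be the measure of the punctured polydisc, the common factor between the means and the
    Bergman integrals. *)
Lemma mul_le_finite (R : realType) (C : R) (P I1 I2 X1 X2 : \bar R) : (0 < P -> P < +oo ->
  0 <= I1 -> I1 < +oo -> X2 = P * I2 -> X1 = P * I1 -> X2 <= C%:E * X1 -> I2 < +oo)%E.
Proof.
move=> P0 Poo I10 I1oo -> -> le12; rewrite ltey; apply/eqP => I2oo; move: le12.
have I1f : I1 \is a fin_num by rewrite ge0_fin_numE.
have Pf : P \is a fin_num by rewrite ge0_fin_numE// ltW.
rewrite I2oo gt0_muley// -(fineK I1f) -(fineK Pf) -!EFinM leye_eq.
by [].
Qed.

Theorem theoremB (R : realType) (n m : nat) (a p lambda : R)
    (hn : (1 <= n)%N) (hm : (1 <= m)%N) (ha0 : 0 < a) (ha2 : a <= 2)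
    (hpl : (1 < p /\ 0 <= lambda) \/ (p = 1 /\ -1 < lambda))
    (k : 'I_(n + m)) (f : 'rV[R[i]]_(n + m) -> R[i])
    (c : mindex (n + m) -> R[i]) :
  bergman a p lambda f ->
  taylor_expansion_on (egg a) c f ->
  exists2 g : 'rV[R[i]]_(n + m) -> R[i],
    bergman a p lambda g &
    taylor_expansion_on (egg a)
      (fun alpha => if mdeg alpha == 0%N then 0
                    else (alpha k)%:R / (mdeg alpha)%:R * c alpha) g.
Proof.
move=> [_ fint] cf.
have p0 : 0 < p by case: hpl => [[p1 _]|[-> _]//]; exact: lt_trans p1.
have sc := egg_summable_taylor ha0 cf.
have tn0 t : forall i, 0 <= tnth (@tnorm R (n + m) t) i.
  by move=> i; rewrite tnth_mktuple plane_norm_ge0.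
have sg t : egg a (cvec t) -> csummable (term (gcoef k c) t).
  move=> /(eggE ha0) et; apply: csummable_term; apply: rsummable_gcoef => //.
  exact: sc.
have Hf t : egg a (cvec t) -> csummable (term c t) /\ f (cvec t) = csum (term c t).
  move=> et; have h : has_csum (term c t) (f (cvec t)) by apply/totally_cvgP; exact: cf.
  have h2 := has_csum_csummable h; split; first exact: h2.
  by rewrite (csumE h2 h).
(* Both integrals, up to the factor [lebesgue_pdisc], are integrals of torus means over the radii,
   where the bound has been proved. *)
have gint : (\int[lebesgue_cvec R (n + m)]_t
    ((egg_cut a lambda (tnorm t))%:E * pow_norm p (gcoef k c) t) < +oo)%E.
  rewrite (egg_integralE ha0 lambda p0 Hf) in fint.
  have [C C0 HC] := egg_mean_gcoef_le ha0 k hm hpl.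
  have le12 := HC c sc.
  have I0 : (0 <= \int[lebesgue_cvec R (n + m)]_t ((egg_cut a lambda (tnorm t))%:E * pow_norm p c t))%E.
    by apply: integral_ge0 => t _; rewrite mule_ge0 ?pow_norm_ge0// lee_fin egg_cut_ge0.
  have /andP[P0 Poo] := lebesgue_pdisc R (n + m).
  exact: (mul_le_finite P0 Poo I0 fint (egg_mean_torus a p lambda (gcoef k c))
    (egg_mean_torus a p lambda c) le12).
pose g xi := csum (fun al => gcoef k c al * monomial al xi).
exists g; last first.
  move=> xi exi; apply/totally_cvgP.
  have := csumP (@sg (split_cvec xi) _); rewrite /term split_cvecK; exact.
split.
  move=> xi exi; have et : 0 < egg_height a (tnorm (split_cvec xi)).
    by apply/(eggE ha0); rewrite split_cvecK.
  (* Absolute convergence at the enlarged radii is what holomorphy of the sum rests on. *)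
  have [e e0 he] := egg_height_enlarge ha0 (tn0 _) et.
  apply: (differentiable_power_series e0).
  have x0 : forall i, 0 <= tnth (enlarge (tnorm (split_cvec xi)) e) i.
    by move=> i; rewrite tnth_mktuple addr_ge0// ltW.
  have [B HB] := rsummable_gcoef k x0 (sc _ x0 he).
  exists B => A; apply: le_trans (HB A); rewrite le_eqVlt; apply/orP; left; apply/eqP.
  apply: eq_bigr => al _; congr (_ * _); apply: eq_bigr => i _.
  by rewrite [in RHS]tnth_mktuple -normc_cvec split_cvecK.
have Hg t : egg a (cvec t) -> csummable (term (gcoef k c) t) /\ g (cvec t) = csum (term (gcoef k c) t).
  by move=> et; split; [exact: sg|].
rewrite (egg_integralE ha0 lambda p0 Hg).
exact: gint.
Qed.
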